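(* Let $A=(a_1,a_2,a_3,a_4)\in (L_\infty(G;\mathbb{H}_{\mathbb{C}}))^4$, $1<p<\infty$ and $p'=\frac{p}{p-1}$. Then $$(\mathfrak{V}_A^p(G;\mathbb{H}_{\mathbb{C}}))^a=\overline{(\mathbf{D}-\mathbf{Q}_{A^\star})W_0^{1,p'}(G;\mathbb{H}_{\mathbb{C}})}^{L_{p'}},\qquad A^\star=(\overline{a_1},a_4,\overline{a_3},a_2).$$ For $p=2$, the following orthogonal decomposition holds: $$L_2(G;\mathbb{H}_{\mathbb{C}})=\mathfrak{V}_A^2(G;\mathbb{H}_{\mathbb{C}})\oplus\overline{(\mathbf{D}-\mathbf{Q}_{A^\dagger})W_0^{1,2}(G;\mathbb{H}_{\mathbb{C}})}^{L_2},\qquad A^\dagger=(a_1^\dagger,a_4^*,a_3^\dagger,a_2^* ).$$ Here $\overline{(\cdot)}^{L_q}$ denotes closure in the norm of $L_q(G;\mathbb{H}_{\mathbb{C}})$.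
   Context: Biquaternions: $\mathbb{H}_{\mathbb{C}}$ is the complex algebra of elements $p=p_0+\vec p$, $\vec p=\sum_{k=1}^3 p_ke_k$, $p_0,\dots,p_3\in\mathbb{C}$ (with $e_0=1$), with product $pq=p_0q_0+p_0\vec q+q_0\vec p-\vec p\cdot\vec q+\vec p\times\vec q$ (bilinear dot and cross products on $\mathbb{C}^3$, so $e_k^2=-1$ for $k=1,2,3$). Scalar part: $\operatorname{Sc}p=p_0$. Quaternionic conjugate: $\overline{p}=p_0-\vec p$. Complex conjugate $p^*=p_0^*+\sum_kp_k^*e_k$, and $p^\dagger=\overline{p^*}=p_0^*-\sum_{k=1}^3p_k^*e_k$. Inner product $\langle p,q\rangle_{\mathbb{H}_{\mathbb{C}}}=\operatorname{Sc}(p^\dagger q)=\sum_{k=0}^3p_k^*q_k$, norm $|p|_{\mathbb{H}_{\mathbb{C}}}=\sqrt{\langle p,p\rangle_{\mathbb{H}_{\mathbb{C}}}}$. These conjugations are applied pointwise to functions. Domain: $G\subset\mathbb{R}^3$ is a bounded domain whose boundary $\Gamma$ is a Liapunov surface (in particular a $C^1$ surface with Hölder continuous unit normal), with $\mathbb{R}^3\setminus\overline{G}$ connected. Function spaces: a function $u=\sum_{k=0}^3u_ke_k:G\to\mathbb{H}_{\mathbb{C}}$ belongs to $\mathscr{F}(G;\mathbb{H}_{\mathbb{C}})$ if each $u_k\in\mathscr{F}(G)$ (complex-valued space). $\langle u,v\rangle_{L_2(G;\mathbb{H}_{\mathbb{C}})}=\int_G\langle u(x),v(x)\rangle_{\mathbb{H}_{\mathbb{C}}}dV_x$.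 Operators: $\mathbf{D}=\sum_{k=1}^3e_k\frac{\partial}{\partial x_k}$ (acting from the left). A function $v\in L_{1,loc}(G;\mathbb{H}_{\mathbb{C}})$ is the weak $\mathbf{D}$-derivative of $u\in L_{1,loc}(G;\mathbb{H}_{\mathbb{C}})$, written $v=\mathbf{D}u$, if $\int_G\overline{u}(\mathbf{D}\varphi)=\int_G\overline{v}\varphi$ for all $\varphi\in C_0^\infty(G;\mathbb{H}_{\mathbb{C}})$. For $B=(b_1,b_2,b_3,b_4)\in(L_\infty(G;\mathbb{H}_{\mathbb{C}}))^4$, $\mathbf{Q}_Bw=wb_1+\overline{w}b_2+b_3w+b_4\overline{w}$. $\mathfrak{V}_A^p(G;\mathbb{H}_{\mathbb{C}})$ is the set of weak solutions $w\in L_p(G;\mathbb{H}_{\mathbb{C}})$ of $\mathbf{D}w-\mathbf{Q}_Aw=0$ in $G$, i.e. those $w\in L_p(G;\mathbb{H}_{\mathbb{C}})$ having a weak $\mathbf{D}$-derivative equal to $\mathbf{Q}_Aw$. Duality: the dual of $L_p(G;\mathbb{H}_{\mathbb{C}})$ is identified with $L_{p'}(G;\mathbb{H}_{\mathbb{C}})$ via the pairing $(v|u)_G=\operatorname{Sc}\int_G\overline{v}u$, $v\in L_{p'}$, $u\in L_p$. For $M\subset L_p(G;\mathbb{H}_{\mathbb{C}})$, the annihilator is $M^a=\{v\in L_{p'}(G;\mathbb{H}_{\mathbb{C}}): (v|u)_G=0\ \forall u\in M\}$. *)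

(* Defs.v *)
From HB Require Import structures.
From mathcomp Require Export all_boot all_order all_algebra.
From mathcomp Require Export complex.
From mathcomp Require Export all_classical all_reals all_analysis.

Set Implicit Arguments.
Unset Strict Implicit.
Unset Printing Implicit Defensive.

Export Order.TTheory GRing.Theory Num.Theory.
Export numFieldNormedType.Exports.

#[global] Open Scope classical_set_scope.
#[global] Open Scope ring_scope.

(* The coordinates are (p_0; p_1, p_2, p_3), so [lsubmx] is the scalar part
   and [rsubmx] the vector part. *)
Notation biquat R := 'rV[R[i]]_(1 + 3).

Section Biquaternions.
Context {R : realType}.
Implicit Types (p q : biquat R) (u v : 'rV[R[i]]_3).

Definition Sc p : R[i] := lsubmx p 0 0.
Definition Vec p : 'rV[R[i]]_3 := rsubmx p.
Definition mkq (s : R[i]) v : biquat R := row_mx s%:M v.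

(* Both products are bilinear, without complex conjugation. The indices
   [k + 1] and [k + 2] are taken modulo 3. *)
Definition dotc u v : R[i] := \sum_(k < 3) u 0 k * v 0 k.
Definition crossc u v : 'rV[R[i]]_3 :=
  \row_(k < 3) (u 0 (k + 1) * v 0 (k + 2%:R) - u 0 (k + 2%:R) * v 0 (k + 1)).

Definition mulq p q : biquat R :=
  mkq (Sc p * Sc q - dotc (Vec p) (Vec q))
      (Sc p *: Vec q + Sc q *: Vec p + crossc (Vec p) (Vec q)).

Definition conjq p : biquat R := mkq (Sc p) (- Vec p).
Definition cconjq p : biquat R := map_mx conjc p.
Definition daggerq p : biquat R := conjq (cconjq p).

Definition innerq p q : R[i] := Sc (mulq (daggerq p) q).
Definition normq p : R := Num.sqrt (complex.Re (innerq p p)).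

(* [eq_ k], for [k = 0, 1, 2], is the imaginary unit $e_{k+1}$. *)
Definition eq_ (k : 'I_3) : biquat R := mkq 0 (delta_mx 0 k).

End Biquaternions.

Notation R3 R := (R * R * R)%type.

Section Space.
Context {R : realType}.
Implicit Types (x y : R3 R) (G U : set (R3 R)).

Definition vol :
    {measure set (measurableTypeR R * measurableTypeR R * measurableTypeR R)
       -> \bar R} :=
  ((lebesgue_measure \x lebesgue_measure) \x lebesgue_measure)%E.

Definition basis3 (k : 'I_3) : R3 R :=
  ((k == 0%N :> nat)%:R, (k == 1%N :> nat)%:R, (k == 2%N :> nat)%:R).

Definition partial (k : 'I_3) (f : R3 R -> R) : R3 R -> R :=
  fun x => 'D_(basis3 k) f x.

Definition gradient (f : R3 R -> R) x : R3 R :=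
  (partial 0 f x, partial 1 f x, partial 2%:R f x).

Definition dot3 x y : R := x.1.1 * y.1.1 + x.1.2 * y.1.2 + x.2 * y.2.

(* The library norm of [R3 R] is the maximum norm. *)
Definition norm3 x : R := Num.sqrt (dot3 x x).

Definition C1_on U (F : R3 R -> R) : Prop :=
  forall (k : 'I_3) x, U x ->
    derivable F x (basis3 k) /\ {for x, continuous (partial k F)}.

(* [S] is locally a regular level set of a C^1 function whose normalized
   gradient is the unit field [nu]. *)
Definition C1_surface (S : set (R3 R)) (nu : R3 R -> R3 R) : Prop :=
  (forall x, S x -> norm3 (nu x) = 1) /\
  forall x0, S x0 -> exists (U : set (R3 R)) (F : R3 R -> R),
    [/\ open U, U x0, C1_on U F,
        S `&` U = [set x | U x /\ F x = 0] &
        forall x, S x -> U x -> gradient F x != 0 /\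
          gradient F x = norm3 (gradient F x) *: nu x].

(* Besides the existence of the normal: the angle between two normals is
   Hoelder-controlled by the distance, and there is a common radius [d] (of the
   Liapunov sphere) such that lines parallel to the normal at [x] meet the part
   of [S] within distance [d] of [x] at most once. *)
Definition liapunov_surface (S : set (R3 R)) : Prop :=
  exists nu : R3 R -> R3 R,
    [/\ C1_surface S nu,
        exists a lam : R, [/\ 0 < lam, lam <= 1 &
          forall x y, S x -> S y ->
            acos (dot3 (nu x) (nu y)) <= a * norm3 (x - y) `^ lam] &
        exists2 d : R, 0 < d &
          forall x y z, S x -> S y -> S z ->
            norm3 (y - x) < d -> norm3 (z - x) < d ->
            (exists t : R, z - y = t *: nu x) -> y = z].

Definition liapunov_domain G : Prop :=
  [/\ G !=set0, open G, connected G & bounded_set G] /\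
  liapunov_surface (closure G `\` G) /\ connected (~` closure G).

(* Functions on [G] are total functions on the whole space of which only the
   values on [G] matter ([f \_ G] is [f] on [G] and 0 elsewhere). Functions that
   agree almost everywhere on [G] are not identified: the function spaces below,
   closures and annihilators are instead invariant under modification outside
   [G] and on null sets (within Borel functions). *)

Section OnDomain.
Variable G : set (R3 R).

Definition Lp (p : \bar R) (f : R3 R -> R[i]) : Prop :=
  ((fun x => complex.Re (f x)) \_ G \in Lfun vol p) /\
  ((fun x => complex.Im (f x)) \_ G \in Lfun vol p).

Definition L1loc (f : R3 R -> R[i]) : Prop :=
  forall K : set (R3 R), compact K -> K `<=` G ->
    vol.-integrable K (fun x => (complex.Re (f x))%:E) /\
    vol.-integrable K (fun x => (complex.Im (f x))%:E).

Definition LpH (p : \bar R) (u : R3 R -> biquat R) : Prop :=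
  forall k, Lp p (fun x => u x 0 k).

Definition L1locH (u : R3 R -> biquat R) : Prop :=
  forall k, L1loc (fun x => u x 0 k).

Definition Lp_norm (p : \bar R) (f : R3 R -> R[i]) : \bar R :=
  ('N[vol]_p[EFin \o (fun x => ComplexField.Normc.normc (f x)) \_ G])%E.

Definition LpH_norm (p : \bar R) (u : R3 R -> biquat R) : \bar R :=
  ('N[vol]_p[EFin \o (fun x => normq (u x)) \_ G])%E.

Definition Lp_closure (p : \bar R) (S : set (R3 R -> biquat R)) :
    set (R3 R -> biquat R) :=
  [set u | LpH p u /\
    forall e : R, 0 < e -> exists2 v, S v & (LpH_norm p (u \- v)%R < e%:E)%E].

Definition intC (f : R3 R -> R[i]) : R[i] :=
  Complex (\int[vol]_(x in G) complex.Re (f x))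
          (\int[vol]_(x in G) complex.Im (f x)).

Definition intH (u : R3 R -> biquat R) : biquat R :=
  \row_k intC (fun x => u x 0 k).

Fixpoint Ck (n : nat) (f : R3 R -> R) : Prop :=
  continuous f /\
  if n is m.+1 then
    forall k : 'I_3, (forall x, derivable f x (basis3 k)) /\ Ck m (partial k f)
  else True.

Definition smooth (f : R3 R -> R) : Prop := forall n, Ck n f.

Definition test_fun (f : R3 R -> R[i]) : Prop :=
  [/\ smooth (fun x => complex.Re (f x)), smooth (fun x => complex.Im (f x)),
      compact (closure [set x | f x != 0]) &
      closure [set x | f x != 0] `<=` G].

Definition test_funH (u : R3 R -> biquat R) : Prop :=
  forall k, test_fun (fun x => u x 0 k).

Definition partialC (k : 'I_3) (f : R3 R -> R[i]) : R3 R -> R[i] :=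
  fun x => Complex (partial k (fun y => complex.Re (f y)) x)
                   (partial k (fun y => complex.Im (f y)) x).

Definition weak_partial (k : 'I_3) (f g : R3 R -> R[i]) : Prop :=
  forall phi, test_fun phi ->
    intC (fun x => f x * partialC k phi x) = - intC (fun x => g x * phi x).

(* [g] is the weak gradient of the function [f] of $W^{1,q}(G)$. *)
Definition sobolev1 (q : \bar R) (f : R3 R -> R[i])
    (g : 'I_3 -> R3 R -> R[i]) : Prop :=
  Lp q f /\ forall k, Lp q (g k) /\ weak_partial k f (g k).

(* $W_0^{1,q}(G)$ is the closure of the test functions in $W^{1,q}(G)$. *)
Definition W0 (q : \bar R) (f : R3 R -> R[i]) : Prop :=
  exists2 g : 'I_3 -> R3 R -> R[i], sobolev1 q f g &
    forall e : R, 0 < e -> exists2 phi, test_fun phi &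
      (Lp_norm q (f \- phi)%R +
       \sum_(k < 3) Lp_norm q (g k \- partialC k phi)%R < e%:E)%E.

Definition W0H (q : \bar R) (u : R3 R -> biquat R) : Prop :=
  forall k, W0 q (fun x => u x 0 k).

Definition Dop (u : R3 R -> biquat R) : R3 R -> biquat R :=
  fun x => \sum_(k < 3) mulq (eq_ k) (\row_j partialC k (fun y => u y 0 j) x).

Definition weakD (u v : R3 R -> biquat R) : Prop :=
  [/\ L1locH u, L1locH v &
    forall phi, test_funH phi ->
      intH (fun x => mulq (conjq (u x)) (Dop phi x)) =
      intH (fun x => mulq (conjq (v x)) (phi x))].

Definition coeffs : Type :=
  ((R3 R -> biquat R) * (R3 R -> biquat R) *
   (R3 R -> biquat R) * (R3 R -> biquat R))%type.

Definition Qop (B : coeffs) (w : R3 R -> biquat R) : R3 R -> biquat R :=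
  let: (b1, b2, b3, b4) := B in
  fun x => mulq (w x) (b1 x) + mulq (conjq (w x)) (b2 x)
         + mulq (b3 x) (w x) + mulq (b4 x) (conjq (w x)).

Definition coeffs_Loo (B : coeffs) : Prop :=
  let: (b1, b2, b3, b4) := B in
  [/\ LpH +oo b1, LpH +oo b2, LpH +oo b3 & LpH +oo b4].

Definition star_coeffs (A : coeffs) : coeffs :=
  let: (a1, a2, a3, a4) := A in (conjq \o a1, a4, conjq \o a3, a2).

Definition dagger_coeffs (A : coeffs) : coeffs :=
  let: (a1, a2, a3, a4) := A in
  (daggerq \o a1, cconjq \o a4, daggerq \o a3, cconjq \o a2).

Definition Vekua (p : \bar R) (A : coeffs) : set (R3 R -> biquat R) :=
  [set w | LpH p w /\ weakD w (Qop A w)].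

(* [v] ranges over all the representatives of the weak derivative of [u]. *)
Definition DQ_image (q : \bar R) (B : coeffs) : set (R3 R -> biquat R) :=
  [set g | exists u v, [/\ W0H q u, weakD u v & g = v \- Qop B u]].

Definition pairing (v u : R3 R -> biquat R) : R[i] :=
  Sc (intH (fun x => mulq (conjq (v x)) (u x))).

(* [q] is the exponent of the dual space. *)
Definition annihilator (q : \bar R) (M : set (R3 R -> biquat R)) :
    set (R3 R -> biquat R) :=
  [set v | LpH q v /\ forall u, M u -> pairing v u = 0].

Definition inner_L2 (u v : R3 R -> biquat R) : R[i] :=
  intC (fun x => innerq (u x) (v x)).

(* Uniqueness (almost everywhere) of the decomposition follows from
   orthogonality. *)
Definition orthogonal_sum (E M N : set (R3 R -> biquat R)) : Prop :=
  E = [set f | exists u v, [/\ M u, N v & f = u \+ v]] /\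
  forall u v, M u -> N v -> inner_L2 u v = 0.

End OnDomain.
End Space.

(* Main.v *)
(** With respect to the bilinear pairing, [Q_{A*}] is the transpose of [Q_A] and
    [D] is formally self-transposed, so that the weak solutions of [D w = Q_A w]
    annihilate [(D - Q_{A*}) phi] for test functions [phi], and by approximation
    the image of [W_0^{1,q}].  For the converse inclusion, a function [f] of [L^q]
    is written, up to small errors, as [m + h], where [m] ranges over
    [(D - Q_{A*}) phi] and [h] is the residual of least energy [sum_i |h_i|^q]
    (sum over the eight real components); the minimum exists by the uniform
    convexity of the energy.  The Euler-Lagrange equation of this problem says
    exactly that the function with components
    [sgn(Re h_j) |Re h_j|^(q-1) - i sgn(Im h_j) |Im h_j|^(q-1)] is a weak solution
    of [D w = Q_A w] in [L^p].  If [f] annihilates these solutions, pairing with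
    this one shows that the energy of [h] vanishes, hence that [f] is in the
    closure.  For [q = 2] the solution is the complex conjugate of [h], and the
    same construction applied to the conjugated coefficients is the orthogonal
    decomposition. *)

From HB Require Import structures.
Require Import Defs.
From mathcomp Require Import ring lra measurable_realfun.

Set Implicit Arguments.
Unset Strict Implicit.
Unset Printing Implicit Defensive.

(** * Convexity of powers *)

Section SignedPower.
Context {R : realType}.
Implicit Types (q x y a b t : R).

(** The residual plays the part of the separating functional in a Hahn-Banach argument: minimising
    produces that functional explicitly, as the duality map of [h], so no representation of a dual
    space enters. The range of D - Q need not be closed, hence the minimum is reached only in the
    limit, and approximants [m] are carried along with [h]. The energy sums over real components
    instead of using the Euclidean length because everything then reduces to scalar inequalities for
    |x|^q; the two agree up to constants, so the closures coincide. Two obstacles shape the rest.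
    The weak D-derivative of a function of W_0^{1,q} is given only as some locally integrable
    representative, and the fundamental lemma is what identifies it with the combination of the weak
    partial derivatives and thereby places it in L^q. And the weak equation is biquaternion-valued
    whereas the first variation is real: multiplying test functions by -i recovers the imaginary
    part, and multiplying them on the right by constants, which commutes with D, recovers the vector
    part. *)

Lemma ler_powR2 r x y : 0 <= r -> 0 <= x -> x <= y -> x `^ r <= y `^ r.
Proof.
by move=> r0 x0 xy; apply: ge0_ler_powR; rewrite ?nnegrE// (le_trans x0).
Qed.

Lemma powR_norm_continuous r : 0 < r -> continuous (fun x : R => `|x| `^ r).
Proof.
move=> r0 x; have [->|x0] := eqVneq x 0; last first.
  apply: (@continuous_comp _ _ _ (@Num.norm R R) (fun y => y `^ r)).
    exact: norm_continuous.
  apply: differentiable_continuous; apply/derivable1_diffP.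
  have nx0 : 0 < `|x| by rewrite normr_gt0.
  exact: (@ex_derive _ _ _ _ _ _ _ (is_derive1_powR r nx0)).
apply/cvgrPdist_lt => e e0; near=> y.
rewrite normr0 powR0 ?gt_eqF// sub0r normrN ger0_norm ?powR_ge0//.
have -> : e = (e `^ r^-1) `^ r by rewrite -powRrM mulVf ?gt_eqF// powRr1// ltW.
apply: gt0_ltr_powR => //; rewrite ?nnegrE// ?powR_ge0//.
near: y; have /cvgr0_norm_lt := @cvg_id _ (nbhs (0 : R)).
by apply; exact: powR_gt0.
Unshelve. all: by end_near. Qed.

(** The derivative of |x|^q / q, that is, the scalar duality map from L^q to the dual exponent. *)
Definition spowR q x : R := Num.sg x * `|x| `^ (q - 1).

(** Powers of the positive and negative parts avoid the sign function, which jumps at 0; continuity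
    is then immediate. *)
Lemma spowR_split q x : 1 < q ->
  spowR q x = `|Num.max x 0| `^ (q - 1) - `|Num.max (- x) 0| `^ (q - 1).
Proof.
move=> q1; have q0 : q - 1 != 0 by rewrite subr_eq0 gt_eqF.
rewrite /spowR; have [x0|x0|->] := ltrgtP x 0.
- rewrite ltr0_sg// max_l ?oppr_ge0 ?ltW//.
  by rewrite normr0 powR0// sub0r normrN mulN1r.
- rewrite gtr0_sg// max_r ?oppr_le0 ?ltW//.
  by rewrite normr0 powR0// subr0 mul1r.
- by rewrite sgr0 oppr0 maxxx mul0r subrr.
Qed.

Lemma spowR_continuous q : 1 < q -> continuous (spowR q).
Proof.
move=> q1; have q0 : 0 < q - 1 by rewrite subr_gt0.
rewrite (_ : spowR q = fun x => `|Num.max x 0| `^ (q - 1) - `|Num.max (- x) 0| `^ (q - 1)); last first.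
  by apply/funext => x; exact: spowR_split.
have mc : continuous (fun x : R => Num.max x 0).
  by move=> x; apply: continuous_max; [exact: cvg_id|exact: cvg_cst].
move=> x; apply: cvgB.
- apply: (@continuous_comp _ _ _ (fun x : R => Num.max x 0) (fun x => `|x| `^ (q - 1))).
    exact: mc.
  exact: powR_norm_continuous.
- apply: (@continuous_comp _ _ _ (fun x : R => Num.max (- x) 0) (fun x => `|x| `^ (q - 1))).
    apply: (@continuous_comp _ _ _ (fun x : R => - x) (fun x : R => Num.max x 0)).
      exact: opp_continuous.
    exact: mc.
  exact: powR_norm_continuous.
Qed.

Lemma powR_norm_pred q x : 1 < q -> `|x| `^ (q - 1) * `|x| = `|x| `^ q.
Proof.
move=> q1; rewrite -{2}(powRr1 (normr_ge0 x)) -powRD; last first.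
  by rewrite subrK; apply/implyP => /eqP q0; move: q1; rewrite q0 ltr10.
by rewrite subrK.
Qed.

Lemma spowRM q x : 1 < q -> spowR q x * x = `|x| `^ q.
Proof.
move=> q1; rewrite -(powR_norm_pred x q1) /spowR mulrAC [RHS]mulrC.
by rewrite -normrEsg.
Qed.

Lemma norm_spowR q x : `|spowR q x| <= `|x| `^ (q - 1).
Proof.
rewrite /spowR normrM [X in _ * X]ger0_norm ?powR_ge0//.
by apply: ler_piMl; rewrite ?powR_ge0// normr_sg; case: (x != 0).
Qed.

(** Young's inequality for the product t * 1 with exponents q and its conjugate, multiplied by q. *)
Lemma powR_bernoulli q t : 1 < q -> 0 <= t -> 1 + q * (t - 1) <= t `^ q.
Proof.
move=> q1 t0; have q0 : 0 < q by rewrite (lt_trans _ q1).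
have qq : 0 < 1 - q^-1 by rewrite subr_gt0 invf_lt1.
have := @conjugate_powR R t 1 q (1 - q^-1)^-1 t0 ler01 q0.
rewrite invr_gt0 qq invrK => /(_ isT); rewrite addrC subrK => /(_ erefl).
rewrite mulr1 powR1 mul1r -(ler_pM2l q0) mulrDr.
rewrite mulrCA divff ?gt_eqF// mulr1 mulrBr mulr1 divff ?gt_eqF//.
move=> h; lra.
Qed.

(** Strictness comes from squaring the weak inequality for z = sqrt t: the square of 1 + q(z - 1)
    exceeds 1 + q(z^2 - 1) by q(q - 1)(z - 1)^2. When 1 + q(z - 1) is negative, squaring is not
    monotone, but then the left-hand side is itself negative. *)
Lemma powR_bernoulli_lt q t : 1 < q -> 0 <= t -> t != 1 ->
  1 + q * (t - 1) < t `^ q.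
Proof.
move=> q1 t0 t1; pose z := Num.sqrt t.
have z0 : 0 <= z by rewrite sqrtr_ge0.
have tz : t = z ^+ 2 by rewrite sqr_sqrtr.
have zq : t `^ q = (z `^ q) ^+ 2 by rewrite tz !expr2 powRM.
have z1 : z != 1 by apply: contra_neq t1 => zz; rewrite tz zz expr1n.
have := powR_bernoulli q1 z0; rewrite zq tz.
set u := z `^ q; have u0 : 0 <= u by rewrite powR_ge0.
have z1' : 0 < (z - 1) ^+ 2 by rewrite exprn_even_gt0//= subr_eq0.
have [h|h] := leP 0 (1 + q * (z - 1)) => hu.
  have : (1 + q * (z - 1)) ^+ 2 <= u ^+ 2 by rewrite lerXn2r ?nnegrE.
  apply: lt_le_trans; rewrite -subr_gt0.
  have -> : (1 + q * (z - 1)) ^+ 2 - (1 + q * (z ^+ 2 - 1)) =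
     q * (q - 1) * (z - 1) ^+ 2 by ring.
  by rewrite mulr_gt0// mulr_gt0 ?subr_gt0// (lt_trans _ q1).
apply: (@lt_le_trans _ _ 0); last exact: sqr_ge0.
have -> : 1 + q * (z ^+ 2 - 1) = (1 + q * (z - 1)) * (z + 1) - z by ring.
rewrite -subr_lt0; have : (1 + q * (z - 1)) * (z + 1) < 0 by rewrite nmulr_rlt0//; lra.
lra.
Qed.

(** Bernoulli's inequality at |y| / |x|, scaled by |x|^q; passing from |y| to y costs nothing since
    [spowR q x * y] is at most |x|^(q-1) |y|. *)
Lemma powR_tangent q x y : 1 < q ->
  `|x| `^ q + q * spowR q x * (y - x) <= `|y| `^ q.
Proof.
move=> q1; have q0 : 0 < q by rewrite (lt_trans _ q1).
have [->|x0] := eqVneq x 0.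
  by rewrite /spowR sgr0 normr0 powR0 ?gt_eqF// !(mul0r,mulr0) addr0 powR_ge0.
have nx0 : 0 < `|x| by rewrite normr_gt0.
have h := powR_bernoulli q1 (divr_ge0 (normr_ge0 y) (normr_ge0 x)).
have yE : `|y| `^ q = `|x| `^ q * (`|y| / `|x|) `^ q.
  by rewrite -powRM// ?divr_ge0// mulrCA divff ?mulr1 ?gt_eqF.
rewrite yE; apply: le_trans (ler_wpM2l (powR_ge0 _ _) h).
have -> : `|x| `^ q * (1 + q * (`|y| / `|x| - 1)) =
    `|x| `^ q + q * (`|x| `^ (q - 1) * `|y|) - q * `|x| `^ q.
  rewrite -(powR_norm_pred x q1); field; exact: lt0r_neq0.
have -> : q * spowR q x * (y - x) = q * (spowR q x * y) - q * `|x| `^ q.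
  by rewrite -(spowRM x q1); ring.
have : spowR q x * y <= `|x| `^ (q - 1) * `|y|.
  by rewrite (le_trans (ler_norm _))// normrM ler_wpM2r// norm_spowR.
move=> /(ler_wpM2l (ltW q0)); lra.
Qed.

Lemma powR_midpoint q a b : 1 < q ->
  `|(a + b) / 2| `^ q <= (`|a| `^ q + `|b| `^ q) / 2.
Proof.
move=> q1; have := powR_tangent ((a + b) / 2) a q1.
have := powR_tangent ((a + b) / 2) b q1; lra.
Qed.

(** The tangent at the midpoint m bounds |t|^q weakly and 1 strictly, the latter by the strict
    Bernoulli inequality at 1/m; averaging cancels the linear terms. At t = -1 the midpoint is 0 and
    the claim is checked directly. *)
Lemma powR_midpoint_lt q t : 1 < q -> -1 <= t < 1 ->
  `|(1 + t) / 2| `^ q < (1 + `|t| `^ q) / 2.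
Proof.
move=> q1 /andP[t1 t2]; have q0 : 0 < q by rewrite (lt_trans _ q1).
have [->|tn] := eqVneq t (-1).
  by rewrite subrr mul0r normr0 powR0 ?gt_eqF// normrN1 powR1; lra.
have h0 : 0 < (1 + t) / 2.
  have : -1 < t by rewrite lt_neqAle eq_sym tn.
  lra.
set m := (1 + t) / 2.
have mq : 0 < m `^ q by rewrite powR_gt0.
have tl : `|m| `^ q + q * spowR q m * (t - m) <= `|t| `^ q.
  exact: powR_tangent.
have m1 : m^-1 != 1.
  rewrite invr_eq1; apply/eqP => mm; move: mm t2; rewrite /m; lra.
have h := powR_bernoulli_lt q1 (ltW (_ : 0 < m^-1)) m1.
have := h; rewrite invr_gt0 => /(_ h0); rewrite -(ltr_pM2l mq).
rewrite -powRM ?invr_ge0 ?(ltW h0)// divff ?gt_eqF// powR1.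
have sm : m `^ q = spowR q m * m by rewrite spowRM// gtr0_norm.
rewrite mulrDr mulr1 (_ : m `^ q * (q * (m^-1 - 1)) = q * spowR q m * (1 - m)); last first.
  rewrite sm; field; exact: lt0r_neq0.
rewrite gtr0_norm// in tl *.
move: tl; rewrite (_ : t - m = m - 1); last by rewrite /m; field.
set s := q * spowR q m; move=> tl; lra.
Qed.

(** A substitute for Clarkson's inequalities that treats q < 2 and q >= 2 alike. By homogeneity a =
    1 and |b| <= 1 may be assumed. For b = t near 1 the left side is below e; on the remaining
    compact interval the convexity defect [phi] has a positive minimum, and a large multiple of it
    absorbs the left side. *)
Lemma powR_uniform_convexity q (e : R) : 1 < q -> 0 < e ->
  exists2 C : R, 0 <= C & forall a b,
    `|a - b| `^ q <= e * (`|a| `^ q + `|b| `^ q)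
      + C * ((`|a| `^ q + `|b| `^ q) / 2 - `|(a + b) / 2| `^ q).
Proof.
move=> q1 e0; have q0 : 0 < q by rewrite (lt_trans _ q1).
(* Chosen so that t > 1 - d forces |1 - t|^q <= e. *)
pose d := Num.min (e `^ q^-1) 1.
have d0 : 0 < d by rewrite lt_min powR_gt0// ltr01.
have d1 : d <= 1 by rewrite ge_min lexx orbT.
have dq : d `^ q <= e.
  apply: (@le_trans _ _ ((e `^ q^-1) `^ q)).
    apply: ler_powR2; rewrite ?(ltW q0) ?(ltW d0)//.
    by rewrite ge_min lexx.
  by rewrite -powRrM mulVf ?gt_eqF// powRr1// ltW.
pose phi t := (1 + `|t| `^ q) / 2 - `|(1 + t) / 2| `^ q.
have cphi : continuous phi.
  move=> t; apply: cvgB; last first.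
    apply: (@continuous_comp _ _ _ (fun t : R => (1 + t) / 2) (fun x => `|x| `^ q)).
      by apply: cvgM; [apply: cvgD; [exact: cvg_cst|exact: cvg_id]|exact: cvg_cst].
    exact: powR_norm_continuous.
  apply: cvgM; last exact: cvg_cst.
  by apply: cvgD; [exact: cvg_cst|exact: powR_norm_continuous].
have ab : -1 <= 1 - d by lra.
have [c cI cmin] := EVT_min ab (continuous_subspaceT cphi).
have pc : 0 < phi c.
  rewrite subr_gt0; apply: powR_midpoint_lt => //.
  by move: cI; rewrite in_itv/= => /andP[-> c2]; lra.
(* The numerator bounds |1 - t|^q on [-1, 1]. *)
pose C := 2 `^ q / phi c.
have C0 : 0 <= C by rewrite divr_ge0 ?powR_ge0// ltW.
exists C => //.
have key t : -1 <= t <= 1 ->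
  `|1 - t| `^ q <= e * (1 + `|t| `^ q) + C * phi t.
  move=> /andP[t1 t2]; have [tc|tc] := leP t (1 - d).
    have pt : phi c <= phi t by apply: cmin; rewrite in_itv/= t1.
    apply: (@le_trans _ _ (C * phi t)); last first.
      by rewrite lerDr mulr_ge0// ?addr_ge0 ?powR_ge0// ltW.
    apply: (@le_trans _ _ (C * phi c)); last by rewrite ler_wpM2l.
    rewrite /C divfK ?gt_eqF//; apply: ler_powR2; rewrite ?(ltW q0)//.
    by rewrite ger0_norm; lra.
  apply: (@le_trans _ _ e).
    apply: le_trans dq; apply: ler_powR2; rewrite ?(ltW q0)//.
    by rewrite ger0_norm; lra.
  have p0 : 0 <= phi t.
    rewrite subr_ge0; have := powR_midpoint 1 t q1.
    by rewrite normr1 powR1.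
  have : 0 <= e * `|t| `^ q by rewrite mulr_ge0 ?powR_ge0// ltW.
  have : 0 <= C * phi t by rewrite mulr_ge0.
  lra.
have key2 a b : `|b| <= `|a| ->
  `|a - b| `^ q <= e * (`|a| `^ q + `|b| `^ q)
      + C * ((`|a| `^ q + `|b| `^ q) / 2 - `|(a + b) / 2| `^ q).
  move=> ba; have [a0|a0] := eqVneq a 0.
    move: ba; rewrite a0 normr0 normr_le0 => /eqP ->.
    by rewrite subrr addr0 mul0r normr0 powR0 ?gt_eqF//; lra.
  have na0 : 0 < `|a| by rewrite normr_gt0.
  have tb : -1 <= b / a <= 1.
    by rewrite -ler_norml normf_div ler_pdivrMr// mul1r.
  have := key _ tb; rewrite -(ler_pM2l (powR_gt0 q na0)).
  rewrite -powRM// -normrM mulrBr mulr1 mulrCA divff// mulr1.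
  move=> h; apply: (le_trans h); rewrite /phi le_eqVlt; apply/orP; left; apply/eqP.
  have hb : `|b| `^ q = `|a| `^ q * `|b / a| `^ q.
    by rewrite -powRM// -normrM mulrCA divff// mulr1.
  have hab : `|(a + b) / 2| `^ q = `|a| `^ q * `|(1 + b / a) / 2| `^ q.
    rewrite -powRM// -normrM; congr (`|_| `^ _); field; lra.
  rewrite hb hab; ring.
move=> a b; have [ba|ab'] := leP `|b| `|a|; first exact: key2.
have := key2 _ _ (ltW ab').
by rewrite distrC (addrC b a) (addrC (`|b| `^ q)).
Qed.

Lemma powR_normD q a b : 0 < q ->
  `|a + b| `^ q <= 2 `^ q * (`|a| `^ q + `|b| `^ q).
Proof.
move=> q0; wlog ab : a b / `|b| <= `|a| => [W|].
  have [|/ltW] := leP `|b| `|a|; first exact: W.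
  by move=> /W; rewrite addrC [X in _ * X]addrC.
apply: (@le_trans _ _ ((2 * `|a|) `^ q)).
  apply: ler_powR2; rewrite ?(ltW q0)//.
  by rewrite (le_trans (ler_normD _ _))// mulrDl mul1r lerD2l.
by rewrite powRM// ler_wpM2l ?powR_ge0// lerDl powR_ge0.
Qed.

Lemma powR_normZ q c a : `|c * a| `^ q = `|c| `^ q * `|a| `^ q.
Proof. by rewrite normrM powRM. Qed.

Lemma norm_spowRM q a b : 1 < q -> `|spowR q a * b| <= `|a| `^ q + `|b| `^ q.
Proof.
move=> q1; have q0 : 0 <= q by rewrite ltW// (lt_trans _ q1).
have q10 : 0 <= q - 1 by rewrite subr_ge0 ltW.
rewrite normrM (le_trans (ler_wpM2r (normr_ge0 _) (norm_spowR _ _)))//.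
have [ab|ab] := leP `|b| `|a|.
  apply: (le_trans (ler_wpM2l (powR_ge0 _ _) ab)).
  by rewrite powR_norm_pred// lerDl powR_ge0.
rewrite -(powR_norm_pred b q1); apply: (@le_trans _ _ (`|b| `^ (q - 1) * `|b|)).
  by rewrite ler_wpM2r// ler_powR2// ltW.
by rewrite lerDr powR_ge0.
Qed.

End SignedPower.

Lemma cvg_dist_geometric {R : realType} (u : R^nat) (B : R) :
  (forall n, `|u n.+1 - u n| <= B * 2^-1 ^+ n) ->
  exists2 l, u @ \oo --> l & forall n, `|l - u n| <= 2 * B * 2^-1 ^+ n.
Proof.
move=> uB.
have B0 : 0 <= B by have := uB 0; rewrite expr0 mulr1; exact: le_trans.
have h2 n : 0 <= (2^-1 : R) ^+ n by rewrite exprn_ge0.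
have cu : cvgn u.
  have cs : cvgn (series (fun n => u n.+1 - u n)).
    apply: normed_cvg; apply: (@series_le_cvg _ _ (geometric B 2^-1)) => //.
    - by move=> n; rewrite /geometric/=.
    - by move=> n; rewrite /geometric/= mulr_ge0.
    - by apply: is_cvg_geometric_series; rewrite gtr0_norm ?invf_lt1 ?ltr1n// invr_gt0.
  have -> : u = fun n => series (fun n => u n.+1 - u n) n + u 0.
    by apply/funext => n; rewrite /series/= telescope_sumr// subrK.
  by apply: is_cvgD => //; exact: is_cvg_cst.
exists (limn u) => // n.
(* The factor 1 - 2^-m is the exact partial geometric sum; without it the induction on m does not
   close. *)
have d m : `|u (n + m)%N - u n| <= 2 * B * 2^-1 ^+ n * (1 - 2^-1 ^+ m).
  elim: m => [|m IH]; first by rewrite addn0 subrr normr0 expr0 subrr mulr0.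
  have -> : u (n + m.+1)%N - u n = (u (n + m).+1 - u (n + m)%N) + (u (n + m)%N - u n).
    by rewrite addrA subrK addnS.
  apply: (le_trans (ler_normD _ _)); apply: (le_trans (lerD (uB _) IH)).
  by rewrite exprD exprS le_eqVlt; apply/orP; left; apply/eqP; field.
have : (fun m => `|u (m + n)%N - u n|) @ \oo --> `|limn u - u n|.
  apply: cvg_norm; apply: cvgB; last exact: cvg_cst.
  by rewrite (cvg_shiftn n u).
move=> h; rewrite -(cvg_lim _ h)//; apply: limr_le; first by apply/cvg_ex; eexists; exact: h.
apply: nearW => m; rewrite addnC; apply: (le_trans (d m)).
by rewrite ler_piMr ?mulr_ge0// gerBl.
Qed.

(** * Nearest points in families of L^q functions *)

Section RealIntegrals.
Context d (T : measurableType d) (R : realType) (mu : {measure set T -> \bar R}).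
Variables (D : set T) (mD : measurable D).
Local Notation ig f := (mu.-integrable D (EFin \o f)).
Implicit Types f g : T -> R.

Lemma integrable_measurable f : ig f -> measurable_fun D f.
Proof. by move=> /integrableP[/measurable_EFinP]. Qed.

Lemma integrableRD f g : ig f -> ig g -> ig (fun x => f x + g x).
Proof. by move=> hf hg; exact: (integrableD mD hf hg). Qed.

Lemma integrableRB f g : ig f -> ig g -> ig (fun x => f x - g x).
Proof. by move=> hf hg; exact: (integrableB mD hf hg). Qed.

Lemma integrableRZ (c : R) f : ig f -> ig (fun x => c * f x).
Proof. by move=> hf; exact: (integrableZl mD c hf). Qed.

Lemma integrableRN f : ig f -> ig (fun x => - f x).
Proof.
move=> /(integrableRZ (-1)); apply: eq_integrable => // x _ /=.
by rewrite mulN1r.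
Qed.

Lemma integrableR_sum (I : Type) (s : seq I) (h : I -> T -> R) :
  (forall i, ig (h i)) -> ig (fun x => \sum_(i <- s) h i x).
Proof.
move=> hi; have := @integrable_sum _ _ _ mu D mD I s predT (fun i => EFin \o h i) (fun i _ => hi i).
by apply: eq_integrable => // x _ /=; rewrite sumEFin.
Qed.

Lemma integrableR_le f g : measurable_fun D f -> ig g ->
  (forall x, D x -> `|f x| <= g x) -> ig f.
Proof.
move=> mf hg fg; apply: le_integrable hg => //; first exact/measurable_EFinP.
by move=> x Dx /=; rewrite lee_fin (le_trans (fg x Dx))// ler_norm.
Qed.

Lemma Rintegral_sum (I : Type) (s : seq I) (h : I -> T -> R) :
  (forall i, ig (h i)) ->
  \int[mu]_(x in D) (\sum_(i <- s) h i x) = \sum_(i <- s) \int[mu]_(x in D) h i x.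
Proof.
move=> hi; elim: s => [|i s IH].
  rewrite big_nil; under eq_Rintegral do rewrite big_nil.
  by rewrite Rintegral_cst// mul0r.
rewrite big_cons -IH -RintegralD//; last exact: integrableR_sum.
by apply: eq_Rintegral => x _; rewrite big_cons.
Qed.

Lemma RintegralN f : ig f -> \int[mu]_(x in D) (- f x) = - \int[mu]_(x in D) f x.
Proof.
move=> hf; rewrite -mulN1r -RintegralZl//.
by apply: eq_Rintegral => x _; rewrite mulN1r.
Qed.

Lemma EFin_Rintegral f : ig f ->
  (\int[mu]_(x in D) f x)%:E = (\int[mu]_(x in D) (f x)%:E)%E.
Proof. by move=> hf; rewrite /Rintegral fineK//; exact: integrable_fin_num. Qed.

Lemma Rdominated_convergence (f_ : nat -> T -> R) f g :
  (forall n, measurable_fun D (f_ n)) -> measurable_fun D f ->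
  {ae mu, forall x, D x -> f_ n x @[n --> \oo] --> f x} ->
  ig g -> {ae mu, forall x n, D x -> `|f_ n x| <= g x} ->
  ig f /\ (fun n => \int[mu]_(x in D) f_ n x) @ \oo --> \int[mu]_(x in D) f x.
Proof.
move=> mf_ mf cf hg bf.
have [hf _ cv] : [/\ mu.-integrable D (EFin \o f),
    [sequence (\int[mu]_(x in D) `|(EFin \o f_ n) x - (EFin \o f) x|)%E]_n @ \oo --> 0%E
  & [sequence (\int[mu]_(x in D) (EFin \o f_ n) x)%E]_n @ \oo --> (\int[mu]_(x in D) (EFin \o f) x)%E].
  apply: (dominated_convergence mD _ _ _ hg).
  - by move=> n; apply/measurable_EFinP.
  - exact/measurable_EFinP.
  - by apply: filterS cf => x h Dx; apply: cvg_EFin (h Dx); exact: nearW.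
  - by apply: filterS bf => x h n Dx; rewrite /= lee_fin h.
split => //; apply: fine_cvg; rewrite /= fineK//.
exact: integrable_fin_num.
Qed.

End RealIntegrals.

(** * Scalar L^q functions on a measure space *)

Section Lq.
Context d (T : measurableType d) (R : realType) (mu : {measure set T -> \bar R}).
Variables (q : R) (q1 : 1 < q).
Local Notation ig f := (mu.-integrable setT (EFin \o f)).
Implicit Types f g : T -> R.

Let q0 : 0 < q. Proof. exact: lt_trans ltr01 q1. Qed.
Let mT : measurable [set: T]. Proof. exact: measurableT. Qed.

Definition Lq f := measurable_fun setT f /\ ig (fun x => `|f x| `^ q).

Lemma measurable_powR_norm f : measurable_fun setT f ->
  measurable_fun setT (fun x => `|f x| `^ q).
Proof.
move=> mf; apply: (@measurableT_comp _ _ _ _ _ _ (fun y : R => `|y| `^ q)) => //.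
by apply: continuous_measurable_fun; exact: powR_norm_continuous.
Qed.

Lemma measurable_spowR f : measurable_fun setT f ->
  measurable_fun setT (fun x => spowR q (f x)).
Proof.
move=> mf; apply: (@measurableT_comp _ _ _ _ _ _ (spowR q)) => //.
by apply: continuous_measurable_fun; exact: spowR_continuous.
Qed.

Lemma Lq_le f g : measurable_fun setT f -> ig g ->
  (forall x, `|f x| `^ q <= g x) -> Lq f.
Proof.
move=> mf hg fg; split => //; apply: (integrableR_le mT) hg _.
  exact: measurable_powR_norm.
by move=> x _; rewrite ger0_norm ?powR_ge0.
Qed.

Lemma LqD f g : Lq f -> Lq g -> Lq (fun x => f x + g x).
Proof.
move=> [mf hf] [mg hg]; apply: (@Lq_le _ (fun x => 2 `^ q * (`|f x| `^ q + `|g x| `^ q))).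
- exact: measurable_funD.
- by apply: (integrableRZ mT); exact: (integrableRD mT).
- by move=> x; exact: powR_normD.
Qed.

Lemma LqZ c f : Lq f -> Lq (fun x => c * f x).
Proof.
move=> [mf hf]; apply: (@Lq_le _ (fun x => `|c| `^ q * (`|f x| `^ q))).
- by apply: measurable_funM => //; exact: measurable_cst.
- exact: (integrableRZ mT).
- by move=> x; rewrite powR_normZ.
Qed.

Lemma LqB f g : Lq f -> Lq g -> Lq (fun x => f x - g x).
Proof.
move=> hf /(LqZ (-1)) /(LqD hf); congr Lq.
by apply/funext => x; rewrite mulN1r.
Qed.

Lemma Lq_spowRM f g : Lq f -> Lq g -> ig (fun x => spowR q (f x) * g x).
Proof.
move=> [mf hf] [mg hg].
apply: (integrableR_le mT _ (integrableRD mT hf hg)).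
  by apply: measurable_funM => //; exact: measurable_spowR.
by move=> x _; exact: norm_spowRM.
Qed.

End Lq.


(** * Finite families: completeness, uniform convexity, first variation *)

Section LqFamilies.
Context d (T : measurableType d) (R : realType) (mu : {measure set T -> \bar R}).
Variables (q : R) (q1 : 1 < q) (I : finType).
Local Notation ig f := (mu.-integrable setT (EFin \o f)).
Implicit Types F G H : I -> T -> R.

Let q0 : 0 < q. Proof. exact: lt_trans ltr01 q1. Qed.
Let mT : measurable [set: T]. Proof. exact: measurableT. Qed.

Definition LqI F := forall i, Lq mu q (F i).
Definition sum_powR F x := \sum_i `|F i x| `^ q.
Definition Lq_energy F := \int[mu]_x sum_powR F x.

Lemma sum_powR_ge0 F x : 0 <= sum_powR F x.
Proof. by apply: sumr_ge0 => i _; exact: powR_ge0. Qed.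

Lemma integrable_sum_powR F : LqI F -> ig (sum_powR F).
Proof. by move=> hF; apply: (integrableR_sum mT) => i; case: (hF i). Qed.

Lemma Lq_energy_ge0 F : 0 <= Lq_energy F.
Proof. by apply: Rintegral_ge0 => x _; exact: sum_powR_ge0. Qed.

Lemma LqI_D F G : LqI F -> LqI G -> LqI (fun i x => F i x + G i x).
Proof. by move=> hF hG i; exact: LqD. Qed.
Lemma LqI_B F G : LqI F -> LqI G -> LqI (fun i x => F i x - G i x).
Proof. by move=> hF hG i; exact: LqB. Qed.
Lemma LqI_Z c F : LqI F -> LqI (fun i x => c * F i x).
Proof. by move=> hF i; exact: LqZ. Qed.

(** The completeness argument for L^q. The series [S] of the increments, weighted by 2^(qn), has
    integral at most the sum of the 1/2^(n+1), hence is finite almost everywhere; where it is finite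
    the n-th increment is at most S^(1/q) 2^-n, so the sequence converges geometrically. The bound
    [B] is returned as well because it serves as the dominating function when the energy is passed
    to the limit. *)
Lemma fast_Lq_cvg (G : nat -> I -> T -> R) : (forall n, LqI (G n)) ->
  (forall n, Lq_energy (fun i x => G n.+1 i x - G n i x)
     <= ((2 `^ q) ^+ n)^-1 * (1 / (2 ^ n.+1)%:R)) ->
  exists H, LqI H /\ exists B : T -> R, ig B /\
    {ae mu, forall x, (forall i, (fun n => G n i x) @ \oo --> H i x) /\
       forall n i, `|H i x - G n i x| `^ q <= B x}.
Proof.
move=> hG hE; pose w n : R := (2 `^ q) ^+ n.
have w0 n : 0 < w n by rewrite exprn_gt0// powR_gt0.
pose a n x : R := w n * sum_powR (fun i x => G n.+1 i x - G n i x) x.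
have a0 n x : 0 <= a n x by rewrite mulr_ge0 ?sum_powR_ge0// ltW.
have ia n : ig (a n).
  by apply: (integrableRZ mT); apply: integrable_sum_powR; exact: LqI_B.
pose S x : \bar R := (\sum_(0 <= n <oo) (a n x)%:E)%E.
have mS : measurable_fun setT S.
  apply: (@ge0_emeasurable_sum _ _ _ _ (fun n x => (a n x)%:E) predT) => //.
    by move=> n x _ _; rewrite lee_fin.
  by move=> n _; case/integrableP: (ia n).
have S0 x : (0 <= S x)%E by apply: nneseries_ge0 => n _ _; rewrite lee_fin.
have iS : mu.-integrable setT S.
  apply/integrableP; split => //.
  under eq_integral => x _ do rewrite gee0_abs//.
  rewrite /S integral_nneseries//; last 2 first.
  - by move=> n; case/integrableP: (ia n).
  - by move=> n x _; rewrite lee_fin.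
  apply: (@le_lt_trans _ _ (1%:E : \bar R)); last by rewrite ltry.
  have := @epsilon_trick0 R 1 predT ler01; apply: le_trans.
  apply: lee_nneseries => n _.
    by move=> _; apply: integral_ge0 => x _; rewrite lee_fin.
  rewrite -(EFin_Rintegral mT (ia n)) lee_fin RintegralZl//; last first.
    by apply: integrable_sum_powR; exact: LqI_B.
  by rewrite -ler_pdivlMl//; exact: hE.
pose E := [set x | S x \is a fin_num].
have mE : measurable E.
  rewrite -[E]setTI; apply: (@emeasurable_fin_num _ _ _ setT) => //.
have aS x n : E x -> a n x <= fine (S x).
  move=> Ex; rewrite -lee_fin fineK//.
  apply: (le_trans _ (nneseries_lim_ge n.+1 _)) => [|k _ _]; rewrite ?lee_fin//.
  by rewrite big_nat_recr//= leeDr// sume_ge0// => k _; rewrite lee_fin.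
have aw x n i : E x -> `|G n.+1 i x - G n i x| <= (fine (S x)) `^ q^-1 * 2^-1 ^+ n.
  move=> Ex; have : `|G n.+1 i x - G n i x| `^ q <= fine (S x) * (w n)^-1.
    rewrite ler_pdivlMr// mulrC; apply: le_trans (aS x n Ex).
    rewrite ler_wpM2l// ?(ltW (w0 n))// /sum_powR (bigD1 i)//= lerDl.
    by apply: sumr_ge0 => j _; exact: powR_ge0.
  have fS : 0 <= fine (S x) by rewrite fine_ge0.
  move=> /(ler_powR2 (ltW _ : 0 <= q^-1) (powR_ge0 _ _)).
  rewrite invr_gt0 => /(_ q0); rewrite -powRrM divff ?gt_eqF// powRr1//.
  rewrite powRM ?invr_ge0 ?(ltW (w0 n))//.
  suff -> : (w n)^-1 `^ q^-1 = 2^-1 ^+ n by [].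
  rewrite /w -powR_mulrn ?powR_ge0// -powRrM -powR_inv1 ?powR_ge0// -!powRrM.
  have -> : q * n%:R * (-1 / q) = -1 * n%:R :> R by field; exact: lt0r_neq0.
  by rewrite powRrM powR_inv1// powR_mulrn ?invr_ge0.
have cG x i : E x -> exists l, (fun n => G n i x) @ \oo --> l /\
     forall n, `|l - G n i x| <= 2 * (fine (S x)) `^ q^-1 * 2^-1 ^+ n.
  move=> Ex; have [l l1 l2] := cvg_dist_geometric (fun n => aw x n i Ex).
  by exists l.
have /choice[h hh] : forall xi : T * I, exists l, E xi.1 -> (fun n => G n xi.2 xi.1) @ \oo --> l /\
     forall n, `|l - G n xi.2 xi.1| <= 2 * (fine (S xi.1)) `^ q^-1 * 2^-1 ^+ n.
  move=> [x i] /=; have [Ex|nE] := pselect (E x).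
    by have [l hl] := cG x i Ex; exists l.
  by exists 0.
(* Cutting off outside [E] makes the restricted sequence converge at every point, which gives
   measurability of the limit. *)
pose H i := (fun x => h (x, i)) \_ E.
have HE i x : E x -> H i x = h (x, i) by move=> Ex; rewrite /H patchE mem_set.
have mH i : measurable_fun setT (H i).
  apply: (@measurable_fun_cvg _ _ _ setT (fun n => (G n i) \_ E)).
    move=> n; apply/(measurable_restrictT _ mE); apply: measurable_funTS.
    by case: (hG n i).
  move=> x _; have [Ex|nE] := pselect (E x).
    rewrite HE//; have [c _] := hh (x, i) Ex; move: c.
    by rewrite (_ : (fun n => G n _ _) = fun n => ((G n i) \_ E) x)//;
      apply/funext => n; rewrite patchE mem_set.
  rewrite /H patchE memNset//.
  rewrite (_ : (fun n => _) = fun=> 0); first exact: cvg_cst.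
  by apply/funext => n; rewrite patchE memNset.
(* The geometric tail contributes the factor 2, hence 2^q after taking powers; 4^q is a generous
   bound for it. *)
pose B x := 4 `^ q * fine (S x) : R.
have iB : ig B.
  apply: (integrableRZ mT); apply: (@le_integrable _ _ _ mu setT mT _ S) => //.
    apply/measurable_EFinP; apply: (@measurableT_comp _ _ _ _ _ _ (@fine R)) => //.
  move=> x _; rewrite [leRHS]gee0_abs// /= ger0_norm ?fine_ge0//.
  by case: (S x) (S0 x) => //= *; rewrite leey.
have bound x n i : E x -> `|H i x - G n i x| `^ q <= B x * (w n)^-1.
  move=> Ex; have [_ /(_ n)] := hh (x, i) Ex; rewrite HE//= => hb.
  apply: (le_trans (ler_powR2 (ltW q0) (normr_ge0 _) hb)).
  rewrite !powRM ?mulr_ge0 ?powR_ge0 ?exprn_ge0// -powRrM mulVf ?gt_eqF//.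
  rewrite powRr1 ?fine_ge0// /B ler_pM ?mulr_ge0 ?powR_ge0 ?fine_ge0//.
    by rewrite ler_wpM2r ?fine_ge0// ler_powR2 ?(ltW q0)// ler_nat.
  rewrite /w -!powR_mulrn ?powR_ge0// -!powRrM -powR_inv1 ?powR_ge0//.
  rewrite -[leRHS](powR_inv1 (powR_ge0 _ _)) -!powRrM.
  by have -> : q * n%:R * -1 = -1 * (n%:R * q) by ring.
have aeE : {ae mu, forall x, E x}.
  by apply: filterS (integrable_ae mT iS) => x; exact.
exists H; split; last first.
  exists B; split => //; apply: filterS aeE => x Ex; split.
    by move=> i; rewrite HE//; have [] := hh (x, i) Ex.
  move=> n i; apply: (le_trans (bound x n i Ex)).
  rewrite ler_piMr ?mulr_ge0 ?powR_ge0 ?fine_ge0// invf_le1//.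
  have h2q : (1 : R) <= 2 `^ q 
    by have := @ler_powR _ (2 : R) (ler1n _ 2) 0 q (ltW q0); rewrite powRr0.
  exact: exprn_ege1.
move=> i; apply: (@Lq_le _ _ _ _ _ q1 _ (fun x => 2 `^ q * (B x + `|G 0 i x| `^ q))) => //.
  apply: (integrableRZ mT); apply: (integrableRD mT) => //.
  by case: (hG 0 i).
move=> x; have [Ex|nE] := pselect (E x); last first.
  rewrite /H patchE memNset// normr0 powR0 ?gt_eqF// mulr_ge0 ?powR_ge0//.
  by rewrite addr_ge0 ?powR_ge0// mulr_ge0 ?powR_ge0// fine_ge0.
rewrite -{1}(subrK (G 0 i x) (H i x)) (le_trans (powR_normD _ _ q0))//.
rewrite ler_wpM2l ?powR_ge0// lerD2r.
by have := bound x 0 i Ex; rewrite /w expr0 invr1 mulr1.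
Qed.

Lemma Lq_energy_cvg (G : nat -> I -> T -> R) H (B : T -> R) F :
  (forall n, LqI (G n)) -> LqI H -> LqI F -> ig B ->
  {ae mu, forall x, (forall i, (fun n => G n i x) @ \oo --> H i x) /\
       forall n i, `|H i x - G n i x| `^ q <= B x} ->
  (fun n => Lq_energy (fun i x => G n i x + F i x)) @ \oo -->
    Lq_energy (fun i x => H i x + F i x).
Proof.
move=> hG hH hF hB hae; pose HF i x := H i x + F i x.
have hHF : LqI HF by exact: LqI_D.
have hGF n : LqI (fun i x => G n i x + F i x) by exact: LqI_D.
have := @Rdominated_convergence _ _ _ mu setT mT
  (fun n => sum_powR (fun i x => G n i x + F i x)) (sum_powR HF)
  (fun x => \sum_i 2 `^ q * (`|HF i x| `^ q + B x)).
move=> /(_ _ _ _ _ _)/proj2; apply.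
- by move=> n; apply: integrable_measurable; exact: integrable_sum_powR.
- by apply: integrable_measurable; exact: integrable_sum_powR.
- apply: filterS hae => x [hx _] _; rewrite /sum_powR.
  apply: cvg_big => [|i _]; first exact: add_continuous.
  apply: (@cvg_comp _ _ _ (fun n => G n i x + F i x) (fun y : R => `|y| `^ q)).
    by apply: cvgD; [exact: hx|exact: cvg_cst].
  exact: (powR_norm_continuous q0).
- apply: (integrableR_sum mT) => i; apply: (integrableRZ mT).
  by apply: (integrableRD mT) => //; case: (hHF i).
- apply: filterS hae => x [_ hx] n _; rewrite ger0_norm ?sum_powR_ge0//.
  apply: ler_sum => i _.
  have -> : G n i x + F i x = HF i x + (- (H i x - G n i x)) by rewrite /HF; ring.
  apply: (le_trans (powR_normD _ _ q0)); rewrite ler_wpM2l ?powR_ge0// lerD2l.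
  by rewrite normrN.
Qed.

Lemma Lq_uniform_convexity (e : R) : 0 < e -> exists2 C : R, 0 <= C &
  forall F G, LqI F -> LqI G ->
    Lq_energy (fun i x => F i x - G i x) <= e * (Lq_energy F + Lq_energy G)
    + C * ((Lq_energy F + Lq_energy G) / 2
           - Lq_energy (fun i x => 2^-1 * (F i x + G i x))).
Proof.
move=> e0; have [C C0 hC] := powR_uniform_convexity q1 e0.
exists C => // F G hF hG.
pose K i x := 2^-1 * (F i x + G i x).
have hK : LqI K by apply: LqI_Z; exact: LqI_D.
have iF := integrable_sum_powR hF; have iG := integrable_sum_powR hG.
have iK := integrable_sum_powR hK.
have -> : e * (Lq_energy F + Lq_energy G)
    + C * ((Lq_energy F + Lq_energy G) / 2 - Lq_energy K) =
  \int[mu]_x ((e + C / 2) * (sum_powR F x + sum_powR G x) - C * sum_powR K x).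
  rewrite RintegralB// ?RintegralZl// ?RintegralD//.
  - rewrite /Lq_energy.
    by move: (Rintegral _ _ _) (Rintegral _ _ _) (Rintegral _ _ _) => a b c; ring.
  - exact: (integrableRD mT).
  - by apply: (integrableRZ mT); exact: (integrableRD mT).
  - exact: (integrableRZ mT).
apply: le_Rintegral => //.
- by apply: integrable_sum_powR; exact: LqI_B.
- by apply: (integrableRB mT); apply: (integrableRZ mT) => //; exact: (integrableRD mT).
move=> x _; rewrite /sum_powR -big_split/= !mulr_sumr -sumrB.
apply: ler_sum => i _; apply: (le_trans (hC (F i x) (G i x))).
by rewrite /K (mulrC 2^-1) le_eqVlt; apply/orP; left; apply/eqP; ring.
Qed.

(** No differentiation under the integral: the tangent inequality at H + tF bounds its energy by
    that of H plus q t times the integral of [spowR] (H + tF) against F. Minimality makes this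
    integral nonnegative for every t > 0, and dominated convergence along t = 1/(n+1) gives the
    claim at t = 0. *)
Lemma Lq_energy_variation H F : LqI H -> LqI F ->
  (forall t : R, 0 < t -> Lq_energy H <= Lq_energy (fun i x => H i x + t * F i x)) ->
  0 <= \int[mu]_x \sum_i spowR q (H i x) * F i x.
Proof.
move=> hH hF hmin; pose K t i x := H i x + t * F i x.
have hK t : LqI (K t) by apply: LqI_D => //; exact: LqI_Z.
have ip t : ig (fun x => \sum_i spowR q (K t i x) * F i x).
  by apply: (integrableR_sum mT) => i; exact: (Lq_spowRM q1 (hK t i) (hF i)).
have pos t : 0 < t -> 0 <= \int[mu]_x \sum_i spowR q (K t i x) * F i x.
  move=> t0; have : Lq_energy (K t) <= Lq_energy H +
      q * t * \int[mu]_x \sum_i spowR q (K t i x) * F i x.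
    rewrite -RintegralZl// -RintegralD//; last 2 first.
    - exact: integrable_sum_powR.
    - exact: (integrableRZ mT).
    apply: le_Rintegral => //.
    - exact: integrable_sum_powR.
    - apply: (integrableRD mT); first exact: integrable_sum_powR.
      exact: (integrableRZ mT).
    move=> x _; rewrite /sum_powR mulr_sumr -big_split/=.
    apply: ler_sum => i _.
    have := powR_tangent (K t i x) (H i x) q1; rewrite /K.
    set s := spowR q _; set u := `|_ + _| `^ q; move=> h.
    by rewrite -lerBlDr; apply: le_trans h; rewrite le_eqVlt; apply/orP; left; apply/eqP; ring.
  have := hmin t t0; rewrite -/(K t) => h1 /(le_trans h1).
  by rewrite lerDl pmulr_rge0// mulr_gt0.
have tn0 n : 0 < (n.+1%:R^-1 : R) by rewrite invr_gt0.
have : (fun n => \int[mu]_x \sum_i spowR q (K n.+1%:R^-1 i x) * F i x) @ \oo -->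
    \int[mu]_x \sum_i spowR q (H i x) * F i x.
  have := @Rdominated_convergence _ _ _ mu setT mT
    (fun n x => \sum_i spowR q (K n.+1%:R^-1 i x) * F i x)
    (fun x => \sum_i spowR q (H i x) * F i x)
    (fun x => \sum_i (2 `^ q * (`|H i x| `^ q + `|F i x| `^ q) + `|F i x| `^ q)).
  move=> /(_ _ _ _ _ _)/proj2; apply.
  - by move=> n; exact: integrable_measurable.
  - apply: (integrable_measurable (mu := mu)); apply: (integrableR_sum mT) => i.
    exact: Lq_spowRM.
  - apply: nearW => x _; apply: cvg_big => [|i _]; first exact: add_continuous.
    apply: cvgM; last exact: cvg_cst.
    apply: (@cvg_comp _ _ _ (fun n => K n.+1%:R^-1 i x) (spowR q)); last exact: spowR_continuous.
    have : (fun n => H i x + n.+1%:R^-1 * F i x) @ \oo --> H i x + 0 * F i x.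
      apply: cvgD; first exact: cvg_cst.
      by apply: cvgM; [exact: cvg_harmonic|exact: cvg_cst].
    by rewrite mul0r addr0.
  - apply: (integrableR_sum mT) => i; have [_ h1] := hH i; have [_ h2] := hF i.
    apply: (integrableRD mT) => //; apply: (integrableRZ mT).
    exact: (integrableRD mT).
  - apply: nearW => x n _; apply: (le_trans (ler_norm_sum _ _ _)).
    apply: ler_sum => i _; apply: (le_trans (norm_spowRM _ _ q1)).
    rewrite lerD2r; apply: (le_trans (powR_normD _ _ q0)).
    rewrite ler_wpM2l ?powR_ge0// lerD2l powR_normZ ler_piMl ?powR_ge0//.
    have n1 : (n.+1%:R^-1 : R) <= 1 by rewrite invf_le1// ler1n.
    by have := ler_powR2 (ltW q0) (ltW (tn0 n)) n1; rewrite powR1 gtr0_norm.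
move=> h; rewrite -(cvg_lim _ h)//; apply: limr_ge; first by apply/cvg_ex; eexists; exact: h.
by apply: nearW => n; exact: pos.
Qed.

(* [H] is the limit of a minimizing sequence [F - m_n] for the energy. *)
Theorem Lq_nearest_point (M : set (I -> T -> R)) F :
  LqI F -> M `<=` LqI -> M (fun _ _ => 0) ->
  (forall m m', M m -> M m' -> M (fun i x => m i x + m' i x)) ->
  (forall c m, M m -> M (fun i x => c * m i x)) ->
  exists H, [/\ LqI H,
    forall m, M m -> \int[mu]_x \sum_i spowR q (H i x) * m i x = 0 &
    forall e, 0 < e -> exists2 m, M m & Lq_energy (fun i x => F i x - m i x - H i x) < e].
Proof.
move=> hF MLq M0 MD MZ.
pose E m := Lq_energy (fun i x => F i x - m i x).
pose A := [set E m | m in M].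
have hFm m : M m -> LqI (fun i x => F i x - m i x).
  by move=> /MLq; exact: LqI_B.
have hA : has_inf A.
  split; first by exists (E (fun _ _ => 0)), (fun _ _ => 0).
  by exists 0 => _ [m _ <-]; exact: Lq_energy_ge0.
pose D := inf A.
have DE m : M m -> D <= E m by move=> Mm; apply: ge_inf; [case: hA|exists m].
have D0 : 0 <= D by apply: lb_le_inf; [case: hA|move=> _ [m _ <-]; exact: Lq_energy_ge0].
have near_min e : 0 < e -> exists2 m, M m & E m < D + e.
  by move=> e0; have [_ [m Mm <-] h] := inf_adherent e0 hA; exists m.
have MB m m' : M m -> M m' -> M (fun i x => m i x - m' i x).
  move=> Mm /(MZ (-1)) /(MD _ _ Mm); congr M.
  by apply/funext => i; apply/funext => x; rewrite mulN1r.
(* Two near-minimizers are close: half their sum is again F minus an element of M, so its energy is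
   at least D and the convexity defect is at most e. The two halves of [eta] pay for the terms of
   uniform convexity; the first uses that the two energies add up to at most 2(D + 1). *)
have uc eta : 0 < eta -> exists2 e : R, 0 < e & forall m m', M m -> M m' ->
    E m < D + e -> E m' < D + e ->
    Lq_energy (fun i x => (F i x - m i x) - (F i x - m' i x)) <= eta.
  move=> eta0; have d1 : 0 < D + 1 by rewrite ltr_wpDl.
  have [C C0 hC] := @Lq_uniform_convexity (eta / (4 * (D + 1)))
    (divr_gt0 eta0 (mulr_gt0 (ltr0n _ 4) d1)).
  have C1 : 0 < C + 1 by rewrite ltr_wpDl.
  exists (Num.min 1 (eta / (2 * (C + 1)))).
    by rewrite lt_min ltr01 divr_gt0// mulr_gt0.
  set e := Num.min _ _ => m m' Mm Mm' h1 h2.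
  have e1 : e <= 1 by rewrite ge_min lexx.
  have e2 : C * e <= eta / 2.
    apply: (@le_trans _ _ ((C + 1) * (eta / (2 * (C + 1))))).
      by apply: ler_pM; rewrite ?lerDl ?ge_min ?lexx ?orbT// le_min ler01 divr_ge0 ?mulr_ge0 ?ltW.
    by rewrite le_eqVlt; apply/orP; left; apply/eqP; field; exact: lt0r_neq0.
  apply: (le_trans (hC _ _ (hFm m Mm) (hFm m' Mm'))).
  have hmid : D <= Lq_energy (fun i x => 2^-1 * (F i x - m i x + (F i x - m' i x))).
    have := DE _ (MZ 2^-1 _ (MD _ _ Mm Mm')); rewrite /E.
    by congr (_ <= Lq_energy _); apply/funext => i; apply/funext => x; field.
  rewrite -/(E m) -/(E m').
  have t1 : eta / (4 * (D + 1)) * (E m + E m') <= eta / 2.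
    have -> : eta / 2 = eta / (4 * (D + 1)) * (2 * (D + 1)) by field; exact: lt0r_neq0.
    have h12 : E m + E m' <= 2 * (D + 1).
      by move: h1 h2 e1; clear; move: (E m) (E m') D e => a b c x *; lra.
    by apply: ler_wpM2l h12; rewrite divr_ge0 ?mulr_ge0 ?ltW.
  have t2 : C * ((E m + E m') / 2 -
      Lq_energy (fun i x => 2^-1 * (F i x - m i x + (F i x - m' i x)))) <= C * e.
    apply: ler_wpM2l => //; move: h1 h2 hmid; clear.
    by move: (E m) (E m') D e (Lq_energy _) => a b c x y *; lra.
  move: t1 t2 e2; clear; set t3 := _ * (_ - _); set t4 := _ * (E m + _).
  by move: t3 t4 (C * e) => a b c *; lra.
pose eta n : R := ((2 `^ q) ^+ n)^-1 * (1 / (2 ^ n.+1)%:R).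
have eta0 n : 0 < eta n.
  by rewrite mulr_gt0// ?invr_gt0 ?exprn_gt0 ?powR_gt0// divr_gt0// ltr0n expn_gt0.
have /choice[e he] : forall n, exists e : R, 0 < e /\ forall m m', M m -> M m' ->
    E m < D + e -> E m' < D + e ->
    Lq_energy (fun i x => (F i x - m i x) - (F i x - m' i x)) <= eta n.
  by move=> n; have [e e0 h] := uc _ (eta0 n); exists e.
(* The condition at [n.-1] makes [m n.+1] comparable with [m n] at the tolerance of index n; the
   last condition makes the sequence minimizing. *)
have /choice[m hm] : forall n, exists m, [/\ M m, E m < D + e n,
    E m < D + e n.-1 & E m < D + n.+1%:R^-1].
  move=> n; pose r := Num.min (e n) (Num.min (e n.-1) n.+1%:R^-1).
  have r0 : 0 < r by rewrite !lt_min (he n).1 (he n.-1).1 invr_gt0/=.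
  have [m Mm Em] := near_min r r0.
  by exists m; split; rewrite // (lt_le_trans Em)// lerD2l !ge_min lexx ?orbT.
pose G n i x := F i x - m n i x.
have hG n : LqI (G n) by apply: hFm; case: (hm n).
have hstep n : Lq_energy (fun i x => G n.+1 i x - G n i x) <= eta n.
  by apply: (he n).2; case: (hm n.+1); case: (hm n).
have [H [hH [B [hB hae]]]] := fast_Lq_cvg hG hstep.
have cvgE f : LqI f -> (fun n => Lq_energy (fun i x => G n i x + f i x)) @ \oo -->
    Lq_energy (fun i x => H i x + f i x).
  by move=> hf; exact: (Lq_energy_cvg hG hH hf hB hae).
have hmin f : M f -> Lq_energy H <= Lq_energy (fun i x => H i x + f i x).
  move=> Mf; have c1 := cvgE _ (MLq _ M0); have c2 := cvgE _ (MLq _ Mf).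
  have c3 : (fun n => Lq_energy (fun i x => G n i x + f i x) + n.+1%:R^-1) @ \oo -->
      Lq_energy (fun i x => H i x + f i x) + 0.
    by apply: cvgD => //; exact: cvg_harmonic.
  rewrite addr0 in c3.
  have -> : Lq_energy H = Lq_energy (fun i x => H i x + 0).
    by congr Lq_energy; apply/funext => i; apply/funext => x; rewrite addr0.
  rewrite -(cvg_lim _ c1)// -(cvg_lim _ c3)//.
  apply: ler_lim; [by apply/cvg_ex; eexists; exact: c1|by apply/cvg_ex; eexists; exact: c3|].
  apply: nearW => n; have [Mn _ _ hn] := hm n.
  have -> : (fun i x => G n i x + 0) = (fun i x => F i x - m n i x).
    by apply/funext => i; apply/funext => x; rewrite addr0.
  apply: (le_trans (ltW hn)); rewrite lerD2r.
  have := DE _ (MB _ _ Mn Mf); rewrite /E; congr (_ <= Lq_energy _).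
  by apply/funext => i; apply/funext => x; rewrite /G; ring.
have hvar f : M f -> 0 <= \int[mu]_x \sum_i spowR q (H i x) * f i x.
  move=> Mf; apply: (Lq_energy_variation hH (MLq _ Mf)).
  by move=> t _; apply: hmin; exact: MZ.
exists H; split => //.
  (* Since M is a linear space, the one-sided variation applies to -f as well and becomes an
     equality. *)
  move=> f Mf; apply/eqP; rewrite eq_le hvar// andbT -oppr_ge0.
  have h := hvar _ (MZ (-1) _ Mf).
  rewrite -(RintegralN mT); last first.
    by apply: (integrableR_sum mT) => i; apply: Lq_spowRM => //; exact: MLq.
  apply: le_trans h _; rewrite le_eqVlt; apply/orP; left; apply/eqP.
  by apply: eq_Rintegral => x _; rewrite -sumrN; apply: eq_bigr => i _; ring.
(* Energy convergence tested with the perturbation -H says that the energy of G n - H tends to 0. *)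
move=> ep ep0; have := cvgE _ (LqI_Z (-1) hH).
have -> : Lq_energy (fun i x => H i x + -1 * H i x) = 0.
  rewrite /Lq_energy (_ : sum_powR _ = cst 0) ?Rintegral_cst ?mul0r//.
  apply/funext => x; rewrite /sum_powR big1// => i _.
  by rewrite mulN1r subrr normr0 powR0// gt_eqF.
move=> /cvgr0_norm_lt /(_ _ ep0)[n _ /(_ n (leqnn n))] /=.
rewrite ger0_norm ?Lq_energy_ge0// => hn.
exists (m n); first by case: (hm n).
apply: le_lt_trans hn; rewrite le_eqVlt; apply/orP; left; apply/eqP.
by congr Lq_energy; apply/funext => i; apply/funext => x; rewrite /G mulN1r.
Qed.

End LqFamilies.

Notation mR3 R := (measurableTypeR R * measurableTypeR R * measurableTypeR R)%type.

(** * Measurability in R^3 *)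

Section Boxes.
Context {R : realType}.
Implicit Types (a b x : R3 R) (U G K : set (R3 R)).

Definition obox a b : set (R3 R) :=
  (`]a.1.1, b.1.1[ `*` `]a.1.2, b.1.2[) `*` `]a.2, b.2[.
Definition cbox a b : set (R3 R) :=
  (`[a.1.1, b.1.1] `*` `[a.1.2, b.1.2]) `*` `[a.2, b.2].

Lemma obox_sub_cbox a b : obox a b `<=` cbox a b.
Proof.
by move=> [[x y] z] [[/= h1 h2] h3]; split; [split|]; exact: subset_itv_oo_cc.
Qed.

Lemma cbox_compact a b : compact (cbox a b).
Proof. by apply: compact_setX; [apply: compact_setX|]; exact: segment_compact. Qed.

Lemma measurable_obox a b : measurable (obox a b : set (mR3 R)).
Proof. by apply: measurableX; [apply: measurableX|]; exact: measurable_itv. Qed.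

Lemma measurable_cbox a b : measurable (cbox a b : set (mR3 R)).
Proof. by apply: measurableX; [apply: measurableX|]; exact: measurable_itv. Qed.

Lemma vol_setX (A B C : set (measurableTypeR R)) :
  measurable A -> measurable B -> measurable C ->
  vol ((A `*` B) `*` C) =
    (lebesgue_measure A * lebesgue_measure B * lebesgue_measure C)%E.
Proof.
move=> mA mB mC; rewrite /vol /= product_measure1E//; last exact: measurableX.
by congr (_ * _)%E; exact: product_measure1E.
Qed.

Lemma vol_cbox_fin a b : (vol (cbox a b) < +oo)%E.
Proof.
rewrite vol_setX; [|exact: measurable_itv..]; rewrite !lebesgue_measure_itv/=.
by case: ifP => _; case: ifP => _; case: ifP => _; rewrite -?EFinB -?EFinM ?(mul0e, mule0) ?ltry.
Qed.

Definition rat3 (i : rat * rat * rat) : R3 R := (ratr i.1.1, ratr i.1.2, ratr i.2).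

(** The closed box is compact, so local hypotheses apply on it, while the open box contains the
    point; rational corners keep the family countable, so that almost-everywhere statements can be
    united. *)
Lemma open_rat_cbox U x : open U -> U x ->
  exists i : (rat * rat * rat) * (rat * rat * rat),
    cbox (rat3 i.1) (rat3 i.2) `<=` U /\ obox (rat3 i.1) (rat3 i.2) x.
Proof.
move=> oU Ux; have /nbhs_ballP[e /= e0 he] := open_nbhs_nbhs (conj oU Ux).
have lo (y : R) : exists r : rat, ratr r \in `]y - e, y[.
  by apply: rat_in_itvoo; rewrite ltrBlDr ltrDl.
have hi (y : R) : exists r : rat, ratr r \in `]y, y + e[.
  by apply: rat_in_itvoo; rewrite ltrDl.
case: x Ux he => [[x1 x2] x3] _ he.
have [l1 h1] := lo x1; have [l2 h2] := lo x2; have [l3 h3] := lo x3.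
have [m1 k1] := hi x1; have [m2 k2] := hi x2; have [m3 k3] := hi x3.
move: h1 h2 h3 k1 k2 k3; rewrite !in_itv/=.
move=> /andP[? ?] /andP[? ?] /andP[? ?] /andP[? ?] /andP[? ?] /andP[? ?].
exists ((l1, l2, l3), (m1, m2, m3)); split; last first.
  by split; [split|]; rewrite /= in_itv/=; apply/andP.
move=> [[y1 y2] y3] [[/= ]]; rewrite !in_itv/= => /andP[? ?] /andP[? ?] /andP[? ?].
by apply: he; split; [split|]; rewrite /ball/= ltr_norml; apply/andP; split; lra.
Qed.

Lemma open_bigcup_obox U : open U ->
  U = \bigcup_(i in [set i : (rat * rat * rat) * (rat * rat * rat) |
         cbox (rat3 i.1) (rat3 i.2) `<=` U]) obox (rat3 i.1) (rat3 i.2).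
Proof.
move=> oU; apply/seteqP; split => x.
  by move=> Ux; have [i [i1 i2]] := open_rat_cbox oU Ux; exists i.
by move=> [i /= i1 i2]; apply: i1; exact: obox_sub_cbox.
Qed.

Lemma open_measurable3 U : open U -> measurable (U : set (mR3 R)).
Proof.
move=> oU; rewrite (open_bigcup_obox oU) bigcup_mkcond.
apply: (@countable_bigcupT_measurable _ (mR3 R)) => //= i.
by case: ifP => // _; exact: measurable_obox.
Qed.

Lemma continuous_measurable3 (f : R3 R -> R) : continuous f ->
  measurable_fun (setT : set (mR3 R)) f.
Proof.
move=> /continuousP cf; apply: (measurability _ (RGenOpens.measurableE R)).
move=> _ [_ [a [b ->] <-]]; rewrite setTI; apply: open_measurable3.
exact/cf/interval_open.
Qed.

Lemma closed_measurable3 K : closed K -> measurable (K : set (mR3 R)).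
Proof.
by move=> cK; rewrite -(setCK K); apply: measurableC; apply: open_measurable3; exact: closed_openC.
Qed.

Lemma compact_sub_cbox K : compact K -> exists M : R, K `<=` cbox (- M, - M, - M) (M, M, M).
Proof.
move=> /compact_bounded[M [Mr hM]]; exists (M + 1) => x Kx.
have := hM (M + 1); rewrite ltrDl ltr01 => /(_ isT x Kx) /=.
rewrite prod_normE /= ge_max prod_normE /= ge_max => /andP[/andP[h1 h2] h3].
by split; [split|]; rewrite /= in_itv/= -ler_norml.
Qed.

Lemma compact_closed3 K : compact K -> closed K.
Proof. by apply: compact_closed; exact: norm_hausdorff. Qed.

Lemma compact_measurable3 K : compact K -> measurable (K : set (mR3 R)).
Proof. by move=> /compact_closed3; exact: closed_measurable3. Qed.

Lemma vol_compact_fin K : compact K -> (vol K < +oo)%E.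
Proof.
move=> cK; have [M hM] := compact_sub_cbox cK.
apply: le_lt_trans (vol_cbox_fin (- M, - M, - M) (M, M, M)).
by apply: le_measure => //; rewrite inE; [exact: compact_measurable3|exact: measurable_cbox].
Qed.

Lemma continuous_norm_bounded K (f : R3 R -> R) : compact K -> continuous f ->
  exists2 M : R, 0 <= M & forall x, K x -> `|f x| <= M.
Proof.
move=> cK cf; have [->|/set0P[x0 Kx0]] := eqVneq K set0; first by exists 0.
have [| |c Kc hc] := @compact_EVT_max _ R (fun x => `|f x|) K _ cK.
- by exists x0.
- apply: continuous_subspaceT => x; apply: cvg_norm; exact: cf.
by exists `|f c| => // x Kx; apply: hc; rewrite inE.
Qed.

Lemma bounded_integrable3 K (f : R3 R -> R) (M : R) : compact K ->
  measurable_fun (setT : set (mR3 R)) f ->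
  (forall x, `|f x| <= M) -> (forall x, ~ K x -> f x = 0) ->
  vol.-integrable setT (EFin \o f).
Proof.
move=> cK mf fM f0; have mK := compact_measurable3 cK.
apply: (@integrableR_le _ _ _ vol setT measurableT f (fun x => M * \1_K x)) => //.
  apply: (integrableRZ measurableT); apply/integrableP; split.
    by apply/measurable_EFinP; exact: measurable_indic.
  under eq_integral => x _ do rewrite /= ger0_norm//.
  by rewrite integral_indic// setIT; exact: vol_compact_fin.
move=> x _; rewrite indicE; case: (boolP (x \in K)) => [|/negP]; rewrite inE => Kx.
  by rewrite mulr1.
by rewrite f0// mulr0 normr0.
Qed.

Lemma continuous_compact_integrable3 K (f : R3 R -> R) : compact K -> continuous f ->
  (forall x, ~ K x -> f x = 0) -> vol.-integrable setT (EFin \o f).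
Proof.
move=> cK cf f0; have [M M0 hM] := continuous_norm_bounded cK cf.
apply: (bounded_integrable3 cK (continuous_measurable3 cf) _ f0).
move=> x; have [Kx|nK] := pselect (K x); first exact: hM.
by rewrite f0// normr0.
Qed.

End Boxes.

(** * Smooth bump functions *)

Section FlatExponential.
Context {R : realType}.
Implicit Types t : R.

(** Both derivatives have the same difference quotient; directional derivatives thus inherit the
    one-variable chain rule. *)
Lemma is_derive_line (V : normedModType R) (f : V -> R) (x v : V) (d : R) :
  is_derive (0 : R) 1 (fun h => f (h *: v + x)) d <-> is_derive x v f d.
Proof.
have E : (fun h : R => h^-1 *: ((fun h => f (h *: v + x)) (h *: 1 + 0) - (fun h => f (h *: v + x)) 0))
    = (fun h => h^-1 *: (f (h *: v + x) - f x)).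
  by apply/funext => h /=; rewrite addr0 scale0r add0r [h *: 1]mulr1.
split=> -[h1 h2]; split.
- by move: h1; rewrite /derivable E.
- by rewrite -h2 /derive E.
- by rewrite /derivable E.
- by rewrite -h2 /derive E.
Qed.

(* The factors [t^-1 ^+ n] make the family stable under differentiation. *)
Definition flat n t : R := if 0 < t then t^-1 ^+ n * expR (- t^-1) else 0.

Lemma flat_ge0 n t : 0 <= flat n t.
Proof.
by rewrite /flat; case: ifP => // t0; rewrite mulr_ge0 ?expR_ge0// exprn_ge0// invr_ge0 ltW.
Qed.

Lemma flat0_gt0 t : (0 < flat 0 t) = (0 < t).
Proof.
rewrite /flat; case: ifP => [t0|]; last by rewrite ltxx.
by rewrite expr0 mul1r expR_gt0.
Qed.

Lemma flat0_le1 t : flat 0 t <= 1.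
Proof.
rewrite /flat; case: ifP => [t0|_]; last exact: ler01.
by rewrite expr0 mul1r -expR0 ler_expR oppr_le0 invr_ge0 ltW.
Qed.

(** With y = 1/t and k = n + 2, the inequality (y/k)^k <= exp y absorbs y^n and leaves t^2. A
    quadratic bound makes the difference quotient at 0 vanish. *)
Lemma flat_quadratic n : exists2 C : R, 0 <= C & forall t, `|flat n t| <= C * t ^+ 2.
Proof.
pose k := n.+2; exists (k%:R ^+ k) => [|t]; first exact: exprn_ge0.
rewrite ger0_norm ?flat_ge0// /flat; case: ifP => t0; last first.
  exact: mulr_ge0 (exprn_ge0 _ (ler0n _ _)) (sqr_ge0 _).
have k0 : 0 < k%:R :> R by rewrite ltr0n.
set y := t^-1; have y0 : 0 < y by rewrite invr_gt0.
have h : (y / k%:R) ^+ k <= expR y.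
  apply: (@le_trans _ _ (expR (y / k%:R) ^+ k)).
    rewrite lerXn2r ?nnegrE ?divr_ge0 ?expR_ge0 ?(ltW y0) ?(ltW k0)//.
    by apply: le_trans (expR_ge1Dx _); rewrite lerDr.
  by rewrite -expRM_natl mulrC divfK ?gt_eqF.
rewrite expRN ler_pdivrMr ?expR_gt0//.
rewrite -[t]invrK -/y; move: h; rewrite expr_div_n ler_pdivrMr ?exprn_gt0//.
move=> h; have -> : y ^+ n = y^-1 ^+ 2 * y ^+ k.
  rewrite (_ : k = (n + 2)%N); last by rewrite addn2.
  by rewrite exprD mulrCA -exprMn mulVf ?expr1n ?mulr1// gt_eqF.
have y2 : 0 <= y^-1 ^+ 2 by rewrite exprn_ge0// invr_ge0 ltW.
apply: (le_trans (ler_wpM2l y2 h)).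
by rewrite le_eqVlt; apply/orP; left; apply/eqP; ring.
Qed.

Lemma flat_is_derive n t :
  is_derive t (1 : R) (flat n) (- n%:R * flat n.+1 t + flat n.+2 t).
Proof.
have [t0|t0|->] := ltgtP t 0.
- have F0 m : flat m t = 0 by rewrite /flat ltNge (ltW t0).
  rewrite !F0 mulr0 addr0.
  apply: (@near_eq_is_derive _ _ _ (cst 0)).
    near=> s; rewrite /= /flat ifF//; apply/negbTE; rewrite -leNgt.
    by apply: ltW; near: s; exact: lt_nbhsl.
- rewrite /flat t0; have tn : t != 0 by rewrite gt_eqF.
  apply: (@near_eq_is_derive _ _ _ (fun s : R => s^-1 ^+ n * expR (- s^-1))).
    near=> s; rewrite /= ifT//.
    by near: s; exact: lt_nbhsr.
  have dV : is_derive t (1 : R) (fun s : R => s^-1) (- t^-1 ^+ 2).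
    have dt : derivable (fun s : R => s) t 1 by exact: derivable_id.
    split; first exact: (derivableV tn dt).
    by rewrite (deriveV tn dt) derive_id /GRing.scale/= mulr1 exprVn.
  have dE : is_derive t (1 : R) (fun s : R => expR (- s^-1)) (t^-1 ^+ 2 * expR (- t^-1)).
    apply: is_derive_eq.
    by rewrite opprK mulrC.
  have XE : (fun s : R => s^-1 ^+ n) = (fun s : R => s^-1) ^+ n.
    by elim: n => [|n IH]; apply/funext => s; rewrite ?expr0// !exprS -IH.
  have dX : is_derive t (1 : R) (fun s : R => s^-1 ^+ n) ((n%:R * t^-1 ^+ n.-1) * (- t^-1 ^+ 2)).
    by rewrite XE; exact: is_deriveX.
  have hM := is_deriveM dX dE.
  set D := (X in is_derive _ _ _ X).
  suff -> : D = t^-1 ^+ n *: (t^-1 ^+ 2 * expR (- t^-1)) +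
     expR (- t^-1) *: ((n%:R * t^-1 ^+ n.-1) * (- t^-1 ^+ 2)) by exact: hM.
  rewrite /D /GRing.scale/=.
  by clear; case: n => [|n]; rewrite !exprS/=; ring.
- have [C C0 hC] := flat_quadratic n.
  have -> : - n%:R * flat n.+1 0 + flat n.+2 0 = 0 :> R.
    by rewrite /flat ltxx mulr0 addr0.
  have c0 : (fun h : R => h^-1 *: (flat n (h *: 1 + 0) - flat n 0)) @ 0^' --> (0 : R).
    apply/cvgrPdist_lt => e e0; near=> h.
    rewrite sub0r normrN addr0 {2}/flat ltxx subr0 [h *: 1]mulr1.
    have h0 : h != 0 by near: h; exact: nbhs_dnbhs_neq.
    rewrite /GRing.scale/= normrM normfV mulrC ltr_pdivrMr ?normr_gt0//.
    apply: (le_lt_trans (hC h)); rewrite -(real_normK (num_real h)) expr2 mulrA.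
    rewrite ltr_pM2r ?normr_gt0//.
    apply: (@le_lt_trans _ _ ((C + 1) * `|h|)); first by rewrite ler_wpM2r// lerDl.
    rewrite mulrC -ltr_pdivlMr ?ltr_wpDl//.
    near: h; apply: dnbhs0_lt; rewrite divr_gt0// ltr_wpDl//.
  split; first by apply/cvg_ex; exists 0.
  exact: cvg_lim.
Unshelve. all: by end_near. Qed.

Lemma flat_continuous n : continuous (flat n).
Proof.
move=> t; apply: differentiable_continuous; apply/derivable1_diffP.
by have [] := flat_is_derive n t.
Qed.

End FlatExponential.

(** * Smooth functions on R^3 and smooth approximation of boxes *)

Section SmoothFunctions.
Context {R : realType}.
Implicit Types (f g : R3 R -> R) (x : R3 R).

Lemma Ck_continuous n f : Ck n f -> continuous f.
Proof. by case: n => [|n] []. Qed.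

Lemma CkS n f : Ck n.+1 f -> Ck n f.
Proof.
elim: n f => [|n IH] f; first by move=> [].
move=> [cf h]; split => // k; have [d c] := h k; split => //.
exact: IH.
Qed.

Lemma Ck_derivable n f k x : Ck n.+1 f -> derivable f x (basis3 k).
Proof. by move=> [_ /(_ k)[d _]]; exact: d. Qed.

Lemma partial_cst (c : R) k : partial k (fun=> c) = fun=> 0.
Proof. by apply/funext => x; exact: derive_cst. Qed.

Lemma Ck_cst n (c : R) : Ck n (fun=> c).
Proof.
elim: n c => [|n IH] c; first by split=> // x; exact: cvg_cst.
split; first by move=> x; exact: cvg_cst.
by move=> k; split; [move=> x; exact: derivable_cst|rewrite partial_cst].
Qed.

Lemma partialD f g k : (forall x, derivable f x (basis3 k)) ->
  (forall x, derivable g x (basis3 k)) ->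
  partial k (fun x => f x + g x) = fun x => partial k f x + partial k g x.
Proof. by move=> df dg; apply/funext => x; exact: deriveD. Qed.

Lemma partialM f g k : (forall x, derivable f x (basis3 k)) ->
  (forall x, derivable g x (basis3 k)) ->
  partial k (fun x => f x * g x) = fun x => f x * partial k g x + partial k f x * g x.
Proof.
move=> df dg; apply/funext => x; rewrite [LHS](deriveM (df x) (dg x)).
by rewrite /GRing.scale/= [X in _ + X]mulrC.
Qed.

Lemma CkD n f g : Ck n f -> Ck n g -> Ck n (fun x => f x + g x).
Proof.
elim: n f g => [|n IH] f g.
  by move=> [cf _] [cg _]; split=> // x; apply: cvgD; [exact: cf|exact: cg].
move=> [cf hf] [cg hg]; split.
  by move=> x; apply: cvgD; [exact: cf|exact: cg].
move=> k; have [df Cf] := hf k; have [dg Cg] := hg k; split.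
  by move=> x; exact: derivableD.
by rewrite partialD//; exact: IH.
Qed.

Lemma CkM n f g : Ck n f -> Ck n g -> Ck n (fun x => f x * g x).
Proof.
elim: n f g => [|n IH] f g.
  by move=> [cf _] [cg _]; split=> // x; apply: cvgM; [exact: cf|exact: cg].
move=> Cf' Cg'; have Cf0 := CkS Cf'; have Cg0 := CkS Cg'.
move: Cf' Cg' => [cf hf] [cg hg]; split.
  by move=> x; apply: cvgM; [exact: cf|exact: cg].
move=> k; have [df Cf] := hf k; have [dg Cg] := hg k; split.
  by move=> x; exact: derivableM.
by rewrite partialM//; apply: CkD; exact: IH.
Qed.

Lemma smooth_cst (c : R) : smooth (fun=> c). Proof. by move=> n; exact: Ck_cst. Qed.
Lemma smoothD f g : smooth f -> smooth g -> smooth (fun x => f x + g x).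
Proof. by move=> hf hg n; exact: CkD. Qed.
Lemma smoothM f g : smooth f -> smooth g -> smooth (fun x => f x * g x).
Proof. by move=> hf hg n; exact: CkM. Qed.
Lemma smoothZ c f : smooth f -> smooth (fun x => c * f x).
Proof. by move=> hf; apply: smoothM => //; exact: smooth_cst. Qed.
Lemma smoothN f : smooth f -> smooth (fun x => - f x).
Proof.
by move=> /(smoothZ (-1)); congr smooth; apply/funext => x; rewrite mulN1r.
Qed.
Lemma smoothB f g : smooth f -> smooth g -> smooth (fun x => f x - g x).
Proof. by move=> hf hg; apply: smoothD => //; exact: smoothN. Qed.
Lemma smoothX f n : smooth f -> smooth (fun x => f x ^+ n).
Proof.
move=> hf; elim: n => [|n IH]; first exact: smooth_cst.
by under [X in smooth X]funext => x do rewrite exprS; exact: smoothM.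
Qed.
Lemma smooth_partial f k : smooth f -> smooth (partial k f).
Proof. by move=> hf n; have [_ /(_ k)[]] := hf n.+1. Qed.
Lemma smooth_continuous f : smooth f -> continuous f.
Proof. by move=> /(_ 0%N)/Ck_continuous. Qed.
Lemma smooth_derivable f k x : smooth f -> derivable f x (basis3 k).
Proof. by move=> /(_ 1%N)/Ck_derivable. Qed.

Section AffineFlat.
Variables (l : R3 R -> R) (c : 'I_3 -> R).
Hypothesis cl : continuous l.
Hypothesis l_line : forall k x h, l (h *: basis3 k + x) = c k * h + l x.

Lemma is_derive_flat_affine n k x :
  is_derive x (basis3 k) (flat n \o l)
    (c k * (- n%:R * flat n.+1 (l x) + flat n.+2 (l x))).
Proof.
apply/is_derive_line.
have -> : (fun h : R => (flat n \o l) (h *: basis3 k + x)) = flat n \o (fun h => c k * h + l x).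
  by apply/funext => h /=; rewrite l_line.
have dl : is_derive (0 : R) 1 (fun h : R => c k * h + l x) (c k).
  have := is_deriveD (is_deriveZ (c k) (is_derive_id (0 : R) 1)) (is_derive_cst (l x) (0 : R) (1 : R)).
  by rewrite addr0 [c k *: 1]mulr1.
have h0 := flat_is_derive n (l x).
have := @is_derive1_comp R (flat n) (fun h : R => c k * h + l x) 0 _ _ _ dl.
by rewrite mulr0 add0r mulrC => /(_ _ h0).
Qed.

(** The induction on the order of differentiability must treat all n at once, because the derivative
    of [flat n] involves [flat n.+1] and [flat n.+2]. *)
Lemma smooth_flat_affine n : smooth (flat n \o l).
Proof.
move=> m; elim: m n => [|m IH] n.
  by split=> // x; apply: continuous_comp; [exact: cl|exact: flat_continuous].
split; first by move=> x; apply: continuous_comp; [exact: cl|exact: flat_continuous].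
move=> k; split; first by move=> x; have [] := is_derive_flat_affine n k x.
have -> : partial k (flat n \o l) =
    fun x => c k * (- n%:R * (flat n.+1 \o l) x + (flat n.+2 \o l) x).
  by apply/funext => x; rewrite /partial; have [_ ->] := is_derive_flat_affine n k x.
apply: CkM; first exact: Ck_cst.
by apply: CkD => //; apply: CkM => //; exact: Ck_cst.
Qed.

End AffineFlat.

Definition coord3 (k : 'I_3) x : R := tnth [tuple x.1.1; x.1.2; x.2] k.

Lemma coord3_continuous k : continuous (coord3 k).
Proof.
move=> x; case: k => -[|[|[|//]]] i; rewrite /coord3 /tnth/=.
- by apply: continuous_comp; [exact: cvg_fst|exact: cvg_fst].
- by apply: continuous_comp; [exact: cvg_fst|exact: cvg_snd].
- exact: cvg_snd.
Qed.

Lemma coord3_line k j x (h : R) :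
  coord3 j (h *: basis3 k + x) = (j == k)%:R * h + coord3 j x.
Proof.
by case: j => -[|[|[|//]]] ij; case: k => -[|[|[|//]]] ik;
  rewrite /coord3 /tnth/= /basis3/= /GRing.scale/= mulrC.
Qed.

Definition bump (a b : R3 R) x : R :=
  \prod_(j < 3) (flat 0 (coord3 j x - coord3 j a) * flat 0 (coord3 j b - coord3 j x)).

Lemma smooth_prod (I : Type) (s : seq I) (F : I -> R3 R -> R) :
  (forall i, smooth (F i)) -> smooth (fun x => \prod_(i <- s) F i x).
Proof.
move=> hF; elim: s => [|i s IH].
  by under [X in smooth X]funext => x do rewrite big_nil; exact: smooth_cst.
by under [X in smooth X]funext => x do rewrite big_cons; exact: smoothM.
Qed.

Lemma bump_smooth a b : smooth (bump a b).
Proof.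
apply: smooth_prod => j; apply: smoothM.
- apply: (@smooth_flat_affine (fun x => coord3 j x - coord3 j a) (fun k => (j == k)%:R)).
    by move=> x; apply: cvgB; [exact: coord3_continuous|exact: cvg_cst].
  by move=> k x h; rewrite coord3_line addrA.
- apply: (@smooth_flat_affine (fun x => coord3 j b - coord3 j x) (fun k => - (j == k)%:R)).
    by move=> x; apply: cvgB; [exact: cvg_cst|exact: coord3_continuous].
  by move=> k x h; rewrite coord3_line; ring.
Qed.

Lemma bump_ge0 a b x : 0 <= bump a b x.
Proof. by apply: prodr_ge0 => j _; rewrite mulr_ge0 ?flat_ge0. Qed.

Lemma bump_le1 a b x : bump a b x <= 1.
Proof.
by apply: prodr_ile1 => j _; rewrite mulr_ge0 ?flat_ge0//= mulr_ile1 ?flat_ge0 ?flat0_le1.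
Qed.

Lemma oboxE a b x : obox a b x <-> forall j, coord3 j a < coord3 j x < coord3 j b.
Proof.
split=> [[[h1 h2] h3] j|h].
  by move: h1 h2 h3; rewrite /= !in_itv/=; case: j => -[|[|[|//]]].
have := h 0; have := h 1; have := h 2%:R; rewrite /coord3 /tnth/= => ? ? ?.
by split; [split|]; rewrite /= in_itv.
Qed.

Lemma bump_gt0 a b x : obox a b x -> 0 < bump a b x.
Proof.
move=> /oboxE h; apply: prodr_gt0 => j _; have /andP[h1 h2] := h j.
by rewrite mulr_gt0// flat0_gt0 subr_gt0.
Qed.

Lemma bump_eq0 a b x : ~ obox a b x -> bump a b x = 0.
Proof.
move=> h; apply/eqP; rewrite eq_le bump_ge0 andbT leNgt; apply/negP => b0.
apply: h; apply/oboxE => j.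
have : 0 < flat 0 (coord3 j x - coord3 j a) * flat 0 (coord3 j b - coord3 j x).
  rewrite lt_neqAle mulr_ge0 ?flat_ge0// andbT eq_sym; apply/eqP => h0.
  by move: b0; rewrite /bump (bigD1 j)//= h0 mul0r ltxx.
move=> /lt0r_neq0; rewrite mulf_eq0 negb_or => /andP[n1 n2].
by apply/andP; split; rewrite -subr_gt0 -flat0_gt0 lt0r flat_ge0 ?n1 ?n2.
Qed.

(** As [bump] lies in ]0, 1] exactly on the open box, the powers of 1 - [bump] tend to 0 there and
    equal 1 elsewhere: smooth approximants of the indicator, all vanishing off the same box, without
    mollification. *)
Definition box_approx a b n x : R := 1 - (1 - bump a b x) ^+ n.

Lemma box_approx_smooth a b n : smooth (box_approx a b n).
Proof.
apply: smoothB; first exact: smooth_cst.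
apply: smoothX; apply: smoothB; [exact: smooth_cst|exact: bump_smooth].
Qed.

Lemma box_approx_itv a b n x : 0 <= box_approx a b n x <= 1.
Proof.
have h0 : 0 <= 1 - bump a b x by rewrite subr_ge0 bump_le1.
have h1 : 1 - bump a b x <= 1 by rewrite gerBl bump_ge0.
by rewrite /box_approx subr_ge0 exprn_ile1//= gerBl exprn_ge0.
Qed.

Lemma box_approx_eq0 a b n x : ~ obox a b x -> box_approx a b n x = 0.
Proof. by move=> /bump_eq0 h; rewrite /box_approx h subr0 expr1n subrr. Qed.

Lemma box_approx_cvg a b x : (fun n => box_approx a b n x) @ \oo --> (\1_(obox a b) x : R).
Proof.
rewrite indicE; case: (boolP (x \in _)) => [|/negP]; rewrite inE => hx; last first.
  under [X in X @ _]funext => n do rewrite box_approx_eq0//.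
  exact: cvg_cst.
rewrite -[X in _ --> X](subr0 (1%:R : R)); apply: cvgB; first exact: cvg_cst.
have := bump_gt0 hx; have := bump_le1 a b x => h1 h0.
by apply: cvg_expr; rewrite ger0_norm; lra.
Qed.

End SmoothFunctions.

(** * Integration by parts *)

Section FubiniZero.
Context d1 d2 (T1 : measurableType d1) (T2 : measurableType d2) (R : realType).
Variables (m1 : {sigma_finite_measure set T1 -> \bar R})
  (m2 : {sigma_finite_measure set T2 -> \bar R}) (f : T1 * T2 -> \bar R).
Hypothesis intf : (m1 \x m2)%E.-integrable setT f.
Local Open Scope ereal_scope.

Lemma integral_prod_eq0_snd : (forall x, \int[m2]_y f (x, y) = 0) ->
  \int[m1 \x m2]_z f z = 0.
Proof.
by move=> h; rewrite -(integral12_prod_meas1 intf); apply: integral0_eq => x _; exact: h.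
Qed.

(** The vanishing is asked only of integrable slices, which are almost all of them; a slice that is
    itself a function on a product can then be treated by Fubini again. *)
Lemma integral_prod_eq0_fst :
  (forall y, m1.-integrable setT (fun x => f (x, y)) -> \int[m1]_x f (x, y) = 0) ->
  \int[m1 \x m2]_z f z = 0.
Proof.
move=> h; rewrite -(integral21_prod_meas1 intf).
rewrite (ae_eq_integral (cst 0))// ?integral0//.
- exact: (measurable_fubini_G intf).
- by apply: filterS (ae_integrable2 intf) => y iy _; exact: h.
Qed.

End FubiniZero.

(* The canonical sigma-finite structure of a product of sigma-finite measures is
   shadowed in the library by the one of products of subprobabilities, hence a copy. *)
Section ProductSigmaFinite.
Context d1 d2 (T1 : measurableType d1) (T2 : measurableType d2) (R : realType).
Variables (m1 : {sigma_finite_measure set T1 -> \bar R})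
  (m2 : {sigma_finite_measure set T2 -> \bar R}).

Definition sigma_finite_prod : set (T1 * T2) -> \bar R := (m1 \x m2)%E.

HB.instance Definition _ := Measure.copy sigma_finite_prod (m1 \x m2)%E.

Let sigma_finite_prodT : sigma_finite setT sigma_finite_prod.
Proof.
by case: (lebesgue_integral_fubini.measure_function_Measure_isSigmaFinite__to__measure_function_isSigmaFinite m1 m2).
Qed.

HB.instance Definition _ :=
  Measure_isSigmaFinite.Build _ _ _ sigma_finite_prod sigma_finite_prodT.

End ProductSigmaFinite.

Section FubiniZero3.
Context d1 d2 d3 (T1 : measurableType d1) (T2 : measurableType d2)
  (T3 : measurableType d3) (R : realType).
Variables (m1 : {sigma_finite_measure set T1 -> \bar R})
  (m2 : {sigma_finite_measure set T2 -> \bar R})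
  (m3 : {sigma_finite_measure set T3 -> \bar R}) (f : T1 * T2 * T3 -> \bar R).
Local Open Scope ereal_scope.

Lemma integral_prod3_eq0 : ((m1 \x m2) \x m3)%E.-integrable setT f ->
  [\/ forall y z, \int[m1]_t f (t, y, z) = 0,
      forall x z, \int[m2]_t f (x, t, z) = 0 |
      forall x y, \int[m3]_t f (x, y, t) = 0] ->
  \int[(m1 \x m2) \x m3]_x f x = 0.
Proof.
pose m12 : {sigma_finite_measure set (T1 * T2)%type -> \bar R} := sigma_finite_prod m1 m2.
move=> intf h; have intf' : (m12 \x m3)%E.-integrable setT f by exact: intf.
suff : \int[m12 \x m3]_x f x = 0 by exact.
case: h => h.
- apply: (@integral_prod_eq0_fst _ _ _ _ _ m12 m3 f intf') => z iz.
  have iz' : (m1 \x m2)%E.-integrable setT (fun x => f (x, z)) by exact: iz.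
  have := @integral_prod_eq0_fst _ _ _ _ _ m1 m2 _ iz'.
  by apply => y _; exact: h.
- apply: (@integral_prod_eq0_fst _ _ _ _ _ m12 m3 f intf') => z iz.
  have iz' : (m1 \x m2)%E.-integrable setT (fun x => f (x, z)) by exact: iz.
  have := @integral_prod_eq0_snd _ _ _ _ _ m1 m2 _ iz'.
  by apply => y; exact: h.
- by apply: (@integral_prod_eq0_snd _ _ _ _ _ m12 m3 f intf') => -[x y]; exact: h.
Qed.

End FubiniZero3.

(** * Partial derivatives of compactly supported functions integrate to zero *)

Section IntegralPartial.
Context {R : realType}.
Implicit Types (f : R3 R -> R) (K : set (R3 R)).

Let lam : {sigma_finite_measure set (measurableTypeR R) -> \bar R} := lebesgue_measure.

Lemma vol_section_eq0 (f : mR3 R -> \bar R) : vol.-integrable setT f ->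
  [\/ forall y z, (\int[lam]_t f (t, y, z) = 0)%E,
      forall x z, (\int[lam]_t f (x, t, z) = 0)%E |
      forall x y, (\int[lam]_t f (x, y, t) = 0)%E] ->
  (\int[vol]_x f x = 0)%E.
Proof. exact: (@integral_prod3_eq0 _ _ _ _ _ _ R lam lam lam f). Qed.

Lemma integral_derive_eq0 (h h' : R -> R) (M : R) :
  (forall t, is_derive t (1 : R) h (h' t)) -> continuous h' ->
  (forall t, M < `|t| -> h t = 0) -> (forall t, M < `|t| -> h' t = 0) ->
  (\int[lebesgue_measure]_t (h' t)%:E = 0)%E.
Proof.
move=> dh ch h0 h'0; pose N := `|M| + 1.
have MN : M < N by rewrite /N (le_lt_trans (ler_norm M))// ltrDl.
have N0 : 0 < N by rewrite /N ltr_wpDl.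
have hh : continuous h.
  by move=> t; apply: differentiable_continuous; apply/derivable1_diffP; have [] := dh t.
transitivity (\int[lebesgue_measure]_(t in `[(- N)%R, N]) (h' t)%:E)%E.
  rewrite [RHS]integral_mkcond; apply: eq_integral => t _; rewrite patchE.
  case: ifPn => //; rewrite notin_setE /= in_itv/= -ler_norml => /negP.
  by rewrite -ltNge => Nt; rewrite h'0// (lt_trans MN).
rewrite (@continuous_FTC2 R h' h (- N) N).
- by rewrite !h0 ?subee// ?normrN gtr0_norm.
- by rewrite gtrN.
- exact: continuous_subspaceT.
- split.
  + by move=> t _; have [] := dh t.
  + by apply: cvg_at_right_filter; exact: hh.
  + by apply: cvg_at_left_filter; exact: hh.
- by move=> t _; rewrite derive1E; have [_ ->] := dh t.
Qed.

Lemma partial_eq0 f K (k : 'I_3) : closed K -> (forall x, ~ K x -> f x = 0) ->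
  forall x, ~ K x -> partial k f x = 0.
Proof.
move=> cK f0 x nK; rewrite /partial (@near_eq_derive _ _ _ f (cst 0)).
  exact: derive_cst.
have : open_nbhs x (~` K) by split => //; exact: closed_openC.
by move=> /open_nbhs_nbhs; apply: filterS => y; exact: f0.
Qed.

Lemma is_derive_section f (c : R -> R3 R) (k : 'I_3) :
  (forall s t, c (s + t) = s *: basis3 k + c t) ->
  (forall x, derivable f x (basis3 k)) ->
  forall t, is_derive t (1 : R) (f \o c) (partial k f (c t)).
Proof.
move=> hc df t; apply/is_derive_line.
have -> : (fun h : R => (f \o c) (h *: (1 : R) + t)) = fun h => f (h *: basis3 k + c t).
  by apply/funext => h /=; rewrite -hc [h *: 1]mulr1.
by apply/is_derive_line; exact/derivableP.
Qed.

(** [c] stands for a line in direction [k] parametrised by its k-th coordinate, so that the three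
    directions share one argument: the fundamental theorem of calculus along the line. *)
Lemma integral_section_eq0 f (c : R -> R3 R) (k : 'I_3) (M : R) : Ck 1 f ->
  (forall x, ~ cbox (- M, - M, - M) (M, M, M) x -> f x = 0) ->
  (forall s t, c (s + t) = s *: basis3 k + c t) -> continuous c ->
  (forall t, coord3 k (c t) = t) ->
  (\int[lebesgue_measure]_t (partial k f (c t))%:E = 0)%E.
Proof.
move=> [cf hf] f0 hc cc ck; have [df [cpf _]] := hf k.
have out t : M < `|t| -> ~ cbox (- M, - M, - M) (M, M, M) (c t).
  move=> Mt [[h1 h2] h3]; have : `|coord3 k (c t)| <= M.
    by move: h1 h2 h3; rewrite /= !in_itv/= -!ler_norml; case: k {hf hc ck df cpf} => -[|[|[|//]]].
  by rewrite ck leNgt Mt.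
apply: (@integral_derive_eq0 (f \o c) _ M).
- exact: is_derive_section.
- by move=> t; apply: continuous_comp; [exact: cc|exact: cpf].
- by move=> t Mt; apply: f0; exact: out.
- move=> t Mt; apply: (@partial_eq0 f _ k _ f0); last exact: out.
  by apply: compact_closed3; exact: cbox_compact.
Qed.

Lemma vol_partial_eq0 f K k : compact K -> Ck 1 f -> (forall x, ~ K x -> f x = 0) ->
  (\int[vol]_x (partial k f x)%:E = 0)%E.
Proof.
move=> cK Cf f0; have [M KM] := compact_sub_cbox cK.
have fM x : ~ cbox (- M, - M, - M) (M, M, M) x -> f x = 0.
  by move=> nx; apply: f0 => /KM.
have intp : vol.-integrable setT (EFin \o partial k f).
  apply: (continuous_compact_integrable3 cK); first by have [_ /(_ k)[_ []]] := Cf.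
  by apply: (partial_eq0 k _ f0); exact: compact_closed3.
have sec (c : R -> R3 R) := @integral_section_eq0 f c k M Cf fM.
apply: (vol_section_eq0 intp).
case: k intp sec => -[|[|[|//]]] ik intp sec.
- apply: Or31 => y z; apply: (sec (fun t => ((t, y), z))) => //.
  + move=> s t; have -> : s *: basis3 (Ordinal ik) + (t, y, z) =
      (s * 1 + t, s * 0 + y, s * 0 + z) by [].
    by rewrite mulr1 !mulr0 !add0r.
  + move=> t; apply: (@cvg_pair _ _ _ _ (nbhs (t, y)) (nbhs z)); last exact: cvg_cst.
    by apply: (@cvg_pair _ _ _ _ (nbhs t) (nbhs y)); [exact: cvg_id|exact: cvg_cst].
- apply: Or32 => x z; apply: (sec (fun t => ((x, t), z))) => //.
  + move=> s t; have -> : s *: basis3 (Ordinal ik) + (x, t, z) =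
      (s * 0 + x, s * 1 + t, s * 0 + z) by [].
    by rewrite mulr1 !mulr0 !add0r.
  + move=> t; apply: (@cvg_pair _ _ _ _ (nbhs (x, t)) (nbhs z)); last exact: cvg_cst.
    by apply: (@cvg_pair _ _ _ _ (nbhs x) (nbhs t)); [exact: cvg_cst|exact: cvg_id].
- apply: Or33 => x y; apply: (sec (fun t => ((x, y), t))) => //.
  + move=> s t; have -> : s *: basis3 (Ordinal ik) + (x, y, t) =
      (s * 0 + x, s * 0 + y, s * 1 + t) by [].
    by rewrite mulr1 !mulr0 !add0r.
  + move=> t; apply: (@cvg_pair _ _ _ _ (nbhs (x, y)) (nbhs t)); last exact: cvg_id.
    exact: cvg_cst.
Qed.

Lemma vol_integration_by_parts f g K k : compact K -> smooth f -> smooth g ->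
  (forall x, ~ K x -> f x = 0) ->
  \int[vol]_x (f x * partial k g x) = - \int[vol]_x (partial k f x * g x).
Proof.
move=> cK sf sg f0; have cKl := compact_closed3 cK.
have pf0 := partial_eq0 k cKl f0.
have i1 : vol.-integrable setT (EFin \o (fun x => f x * partial k g x)).
  apply: (continuous_compact_integrable3 cK).
    by apply: smooth_continuous; apply: smoothM => //; exact: smooth_partial.
  by move=> x nK; rewrite f0// mul0r.
have i2 : vol.-integrable setT (EFin \o (fun x => partial k f x * g x)).
  apply: (continuous_compact_integrable3 cK).
    by apply: smooth_continuous; apply: smoothM => //; exact: smooth_partial.
  by move=> x nK; rewrite pf0// mul0r.
apply/eqP; rewrite -addr_eq0 -RintegralD//.
have -> : (fun x => f x * partial k g x + partial k f x * g x) =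
    partial k (fun x => f x * g x).
  by rewrite partialM// => x; exact: smooth_derivable.
rewrite /Rintegral (@vol_partial_eq0 _ K)//.
  exact: (smoothM sf sg).
by move=> x nK; rewrite f0// mul0r.
Qed.

End IntegralPartial.

Lemma Rdominated_eq0 d (T : measurableType d) (R : realType)
    (mu : {measure set T -> \bar R}) (f_ : nat -> T -> R) (f g : T -> R) :
  (forall n, measurable_fun setT (f_ n)) -> measurable_fun setT f ->
  (forall x, f_ n x @[n --> \oo] --> f x) ->
  mu.-integrable setT (EFin \o g) -> (forall x n, `|f_ n x| <= `|g x|) ->
  (forall n, \int[mu]_x f_ n x = 0) -> \int[mu]_x f x = 0.
Proof.
move=> mf_ mf cf ig bf f0.
have cf' : {ae mu, forall x, setT x -> f_ n x @[n --> \oo] --> f x}.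
  by apply: nearW => x _; exact: cf.
have bf' : {ae mu, forall x n, setT x -> `|f_ n x| <= `|g x|}.
  by apply: nearW => x n _; exact: bf.
have /proj2 := Rdominated_convergence measurableT mf_ mf cf' (integrable_norm ig) bf'.
rewrite (_ : (fun n => _) = fun=> 0); last by apply/funext => n; exact: f0.
by move=> /cvg_lim <-//; rewrite lim_cst.
Qed.

(** * The fundamental lemma of the calculus of variations *)

Section FundamentalLemma.
Context {R : realType}.
Implicit Types (r f : R3 R -> R) (G K : set (R3 R)) (a b c d : R3 R).

Lemma ae_vol_impl (P Q : R3 R -> Prop) : (forall x, P x -> Q x) ->
  {ae vol, forall x, P x} -> {ae vol, forall x, Q x}.
Proof. by move=> PQ; apply: negligibleS => x /= nQ /PQ. Qed.

Definition box_sets : set (set (mR3 R)) := [set A | exists a b, A = obox a b].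

Definition box_max a c : R3 R :=
  (Num.max a.1.1 c.1.1, Num.max a.1.2 c.1.2, Num.max a.2 c.2).
Definition box_min b d : R3 R :=
  (Num.min b.1.1 d.1.1, Num.min b.1.2 d.1.2, Num.min b.2 d.2).

Lemma oboxI a b c d : obox a b `&` obox c d = obox (box_max a c) (box_min b d).
Proof.
apply/seteqP; split => [[[x y] z] [[[/= h1 h2] h3] [[/= k1 k2] k3]]|[[x y] z] [[/= h1 h2] h3]].
  move: h1 h2 h3 k1 k2 k3; rewrite !in_itv/=.
  move=> /andP[? ?] /andP[? ?] /andP[? ?] /andP[? ?] /andP[? ?] /andP[? ?].
  by split; [split|]; rewrite /= in_itv/= gt_max lt_min; apply/and3P; split=> //;
    apply/andP; split.
move: h1 h2 h3; rewrite !in_itv/= !gt_max !lt_min.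
move=> /andP[/andP[a1 c1] /andP[b1 d1]] /andP[/andP[a2 c2] /andP[b2 d2]] /andP[/andP[a3 c3] /andP[b3 d3]].
by split; split; rewrite /=; try split; rewrite in_itv/=; apply/andP.
Qed.

Lemma cbox_max_min_sub a b c d : cbox (box_max a c) (box_min b d) `<=` cbox a b.
Proof.
move=> [[x y] z] [[/= h1 h2] h3]; move: h1 h2 h3; rewrite !in_itv/= !ge_max !le_min.
move=> /andP[/andP[a1 c1] /andP[b1 d1]] /andP[/andP[a2 c2] /andP[b2 d2]] /andP[/andP[a3 c3] /andP[b3 d3]].
by split; [split|]; rewrite /= in_itv/=; apply/andP.
Qed.

(** The preimage of ]s, t[ under a coordinate is the union over n of boxes whose other sides are
    ]-n, n[. All three coordinates are therefore measurable for the sigma-algebra generated by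
    boxes, and so is the identity into the product. *)
Lemma measurable_box_sets : @measurable _ (mR3 R) = <<s box_sets >>.
Proof.
apply/seteqP; split; last first.
  apply: smallest_sub; first exact: sigma_algebra_measurable.
  by move=> _ [a [b ->]]; exact: measurable_obox.
pose S := g_sigma_algebraType box_sets.
have mbox a b : measurable (obox a b : set S).
  by apply: sub_sigma_algebra; exists a, b.
have big (x : R) : exists n : nat, - n%:R < x < n%:R.
  by exists (Num.bound `|x|); rewrite -ltr_norml archi_boundP.
have mcoord (p : S -> R) (A : R -> R -> nat -> set S) :
    (forall s t n, measurable (A s t n)) ->
    (forall s t, p @^-1` `]s, t[%classic = \bigcup_n A s t n) ->
    measurable_fun (setT : set S) p.
  move=> mA hA; apply: (measurability _ (RGenOpens.measurableE R)).
  move=> _ [_ [a [b ->] <-]]; rewrite setTI hA.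
  by apply: bigcupT_measurable => n; exact: mA.
have big2 (x y : R) : exists n : nat, - n%:R < x < n%:R /\ - n%:R < y < n%:R.
  have [n /andP[n1 n2]] := big x; have [m /andP[m1 m2]] := big y.
  have nm : (n%:R <= (n + m)%:R :> R) by rewrite ler_nat leq_addr.
  have mn : (m%:R <= (n + m)%:R :> R) by rewrite ler_nat leq_addl.
  by exists (n + m)%N; split; apply/andP; split; lra.
have m1 : measurable_fun (setT : set S) (fun x : S => (x : R3 R).1.1).
  apply: (mcoord _ (fun s t n => obox (s, - n%:R, - n%:R) (t, n%:R, n%:R))) => // s t.
  apply/seteqP; split => [[[x y] z] /= h|[[x y] z] [n _ [[]]]//].
  have [n [n1 n2]] := big2 y z.
  by exists n.
have m2 : measurable_fun (setT : set S) (fun x : S => (x : R3 R).1.2).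
  apply: (mcoord _ (fun s t n => obox (- n%:R, s, - n%:R) (n%:R, t, n%:R))) => // s t.
  apply/seteqP; split => [[[x y] z] /= h|[[x y] z] [n _ [[]]]//].
  have [n [n1 n2]] := big2 x z.
  by exists n.
have m3 : measurable_fun (setT : set S) (fun x : S => (x : R3 R).2).
  apply: (mcoord _ (fun s t n => obox (- n%:R, - n%:R, s) (n%:R, n%:R, t))) => // s t.
  apply/seteqP; split => [[[x y] z] /= h|[[x y] z] [n _ [[]]]//].
  have [n [n1 n2]] := big2 x y.
  by exists n.
have mid : measurable_fun (setT : set S) (fun x : S => (((x : R3 R).1.1, (x : R3 R).1.2), (x : R3 R).2) : mR3 R).
  apply: (@measurable_fun_pair _ _ _ S (measurableTypeR R * measurableTypeR R)%type (measurableTypeR R)) m3.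
  exact: (@measurable_fun_pair _ _ _ S (measurableTypeR R) (measurableTypeR R)) m1 m2.
move=> A mA; have := mid measurableT A mA; rewrite setTI.
by congr (<<s _ >> _); apply/seteqP; split=> [[[x y] z]|[[x y] z]].
Qed.

(** Dynkin's theorem: boxes are stable under intersection, and the sets over which [r] integrates to
    0 are stable under complements and disjoint countable unions. The total integral is itself a box
    integral because [r] vanishes off a box. *)
Lemma integral_indic_obox_eq0_ae r a b : vol.-integrable setT (EFin \o r) ->
  (forall x, ~ obox a b x -> r x = 0) ->
  (forall c d, \int[vol]_x (r x * \1_(obox c d) x) = 0) ->
  {ae vol, forall x, r x = 0}.
Proof.
move=> ir r0 hr; have mr := integrable_measurable ir.
have irA (A : set (mR3 R)) : measurable A -> vol.-integrable setT (EFin \o (fun x => r x * \1_A x)).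
  move=> mA; have iar : vol.-integrable setT (EFin \o (fun x => `|r x|)).
    exact: (integrable_norm ir).
  apply: (integrableR_le measurableT _ iar).
    by apply: measurable_funM => //; exact: measurable_indic.
  by move=> x _; rewrite normrM ler_piMr// indicE; case: (x \in A); rewrite ?normr1 ?normr0.
have all_sets : forall A : set (mR3 R), <<s box_sets >> A ->
    \int[vol]_x (r x * \1_A x) = 0.
  apply: (dynkin_induction measurable_box_sets).
  - by move=> _ _ [a1 [b1 ->]] [c1 [d1 ->]]; rewrite oboxI; eexists; eexists; reflexivity.
  - rewrite -[RHS](hr a b); apply: eq_Rintegral => x _; rewrite !indicE in_setT.
    case: (boolP (x \in obox a b)) => // /negP; rewrite inE => nx.
    by rewrite r0// !mul0r.
  - by move=> _ [c [d ->]]; exact: hr.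
  - move=> A mA hA; have ri : \int[vol]_x r x = 0.
      rewrite -[RHS](hr a b); apply: eq_Rintegral => x _; rewrite indicE.
      case: (boolP (x \in obox a b)) => [_|/negP]; first by rewrite mulr1.
      by rewrite inE => nx; rewrite r0// !mul0r.
    transitivity (\int[vol]_x (r x - r x * \1_A x)).
      apply: eq_Rintegral => x _; rewrite !indicE in_setC.
      by case: (x \in A); rewrite /= ?mulr1 ?mulr0 ?subrr ?subr0.
    by rewrite RintegralB// ?ri ?hA ?subr0//; exact: irA.
  - move=> F mF tF hF.
    pose S n := \big[setU/set0]_(i < n) F i.
    have mS n : measurable (S n) by exact: bigsetU_measurable.
    have S0 n : \int[vol]_x (r x * \1_(S n) x) = 0.
      elim: n => [|n IH].
        rewrite /S big_ord0; under eq_Rintegral do rewrite indic0 mulr0.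
        by rewrite Rintegral_cst// mul0r.
      rewrite (_ : (fun x => _) = (fun x => r x * \1_(S n) x + r x * \1_(F n) x)).
        by rewrite RintegralD// ?IH ?hF ?addr0//; exact: irA.
      apply/funext => x; rewrite -mulrDr; congr (_ * _).
      rewrite /S big_ord_recr/= -/(S n) !indicE in_setU.
      case: (boolP (x \in S n)) => [|_]; last by rewrite add0r.
      rewrite inE /S -bigcup_mkord => -[i /= ni Fi].
      case: (boolP (x \in F n)); last by rewrite addr0.
      rewrite inE => Fn; have := tF i n I I (ex_intro _ x (conj Fi Fn)).
      by move=> ein; rewrite ein ltnn in ni.
    apply: (@Rdominated_eq0 _ _ _ vol (fun n x => r x * \1_(S n) x) _ r) => //.
    + by move=> n; apply: integrable_measurable; exact: irA.
    + apply: integrable_measurable; apply: irA; exact: bigcupT_measurable.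
    + move=> x; apply: cvgM; first exact: cvg_cst.
      rewrite indicE; case: (boolP (x \in \bigcup_k F k)) => [|/negP]; rewrite inE.
        move=> [k _ Fk]; apply: (@cvg_trans _ ((fun=> 1 : R) @ \oo)); last exact: cvg_cst.
        apply: near_eq_cvg; near=> n; rewrite indicE mem_set//.
        rewrite /S -bigcup_mkord; exists k => //=.
        by near: n; exact: nbhs_infty_gt.
      move=> nx; rewrite (_ : (fun n => _) = fun=> 0); first exact: cvg_cst.
      apply/funext => n; rewrite indicE memNset// /S -bigcup_mkord => -[k _ Fk].
      by apply: nx; exists k.
    + move=> x n; rewrite normrM ler_piMr// indicE.
      by case: (x \in S n); rewrite ?normr1 ?normr0.
have : ae_eq vol setT (EFin \o r) (cst 0%E).
  apply: (integral_ae_eq measurableT ir); first exact: measurable_cst.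
  move=> E _ mE; rewrite integral0.
  have := all_sets E; rewrite -measurable_box_sets => /(_ mE).
  rewrite integral_mkcond /Rintegral.
  have -> : (EFin \o r) \_ E = (fun x => (r x * \1_E x)%:E).
    apply/funext => x; rewrite patchE indicE.
    by case: (x \in E); rewrite ?mulr1 ?mulr0.
  have := integrable_fin_num measurableT (irA E mE).
  by rewrite /comp/= => /fineK {2}<- ->.
by apply: filterS => x /(_ I) [].
Unshelve. all: by end_near. Qed.

Definition real_test G f :=
  smooth f /\ exists K, [/\ compact K, K `<=` G & forall x, ~ K x -> f x = 0].

(** On one closed box inside G, smooth approximants of indicators of sub-boxes are admissible tests,
    so [r] integrates to 0 over all sub-boxes and vanishes there almost everywhere. Countably many
    rational boxes cover G. *)
Lemma fundamental_lemma G r : open G ->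
  (forall K, compact K -> K `<=` G -> vol.-integrable K (EFin \o r)) ->
  (forall f, real_test G f -> \int[vol]_(x in G) (r x * f x) = 0) ->
  {ae vol, forall x, G x -> r x = 0}.
Proof.
move=> oG lr hr; have mG := open_measurable3 oG.
have box a b : cbox a b `<=` G -> {ae vol, forall x, obox a b x -> r x = 0}.
  move=> abG; pose r' := r \_ (obox a b).
  have icb : vol.-integrable (cbox a b : set (mR3 R)) (EFin \o r).
    by apply: lr => //; exact: cbox_compact.
  have restr_int (B : set (mR3 R)) : measurable B -> B `<=` cbox a b ->
      vol.-integrable setT (EFin \o (r \_ B)).
    move=> mB Bs.
    have iB := integrableS (measurable_cbox a b) mB Bs icb.
    have := (integrable_mkcond (EFin \o (r : mR3 R -> R)) mB).1 iB.
    by apply: eq_integrable => // x _ /=; rewrite !patchE; case: ifP.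
  have ir' : vol.-integrable setT (EFin \o r').
    by apply: restr_int; [exact: measurable_obox|exact: obox_sub_cbox].
  have : {ae vol, forall x, r' x = 0}.
    apply: (@integral_indic_obox_eq0_ae r' a b) => //.
      by move=> x nx; rewrite /r' patchE memNset.
    (* An arbitrary box is replaced by its intersection with the given one, so that the approximants
       are supported inside G. *)
    move=> c d; pose a' := box_max a c; pose b' := box_min b d.
    have c'G : cbox a' b' `<=` G.
      by apply: subset_trans abG; exact: cbox_max_min_sub.
    pose rc := r \_ (cbox a b).
    have irc : vol.-integrable setT (EFin \o rc).
      by apply: restr_int => //; exact: measurable_cbox.
    have sub : obox a' b' `<=` cbox a b.
      by apply: subset_trans (@obox_sub_cbox _ _ _) _; exact: cbox_max_min_sub.
    have E0 n : \int[vol]_x (rc x * box_approx a' b' n x) = 0.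
      rewrite -[RHS](hr (box_approx a' b' n)); last first.
        split; first exact: box_approx_smooth.
        exists (cbox a' b'); split => //; first exact: cbox_compact.
        by move=> x nx; apply: box_approx_eq0 => /obox_sub_cbox.
      rewrite [RHS]Rintegral_mkcond; apply: eq_Rintegral => x _.
      rewrite /rc !patchE.
      have [ox|nx] := pselect (obox a' b' x).
        by rewrite !mem_set//; [apply: c'G; exact: obox_sub_cbox|exact: sub].
      by rewrite box_approx_eq0// !mulr0; case: ifP.
    transitivity (\int[vol]_x (rc x * \1_(obox a' b') x)).
      apply: eq_Rintegral => x _; rewrite -oboxI /rc /r' !patchE !indicE in_setI.
      case: (boolP (x \in obox a b)) => [|_]/=; last by rewrite mul0r mulr0.
      by rewrite inE => /obox_sub_cbox/mem_set ->.
    apply: (@Rdominated_eq0 _ _ _ vol (fun n x => rc x * box_approx a' b' n x) _ rc) => //.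
    - move=> n; apply: measurable_funM; first exact: integrable_measurable irc.
      by apply: continuous_measurable3; apply: smooth_continuous; exact: box_approx_smooth.
    - apply: measurable_funM; first exact: integrable_measurable irc.
      by apply: measurable_indic; exact: measurable_obox.
    - by move=> x; apply: cvgM; [exact: cvg_cst|exact: box_approx_cvg].
    - move=> x n; rewrite normrM ler_piMr//.
      by have /andP[h0 h1] := box_approx_itv a' b' n x; rewrite ger0_norm.
  by apply: ae_vol_impl => x + ox; rewrite /r' patchE mem_set.
(* One condition for each code of a rational box; codes of no box, and boxes that leave G, impose
   nothing. *)
pose Pn n x := if (unpickle n : option ((rat * rat * rat) * (rat * rat * rat))) is Some i
  then cbox (rat3 i.1) (rat3 i.2) `<=` G -> obox (rat3 i.1) (rat3 i.2) x -> r x = 0 else True.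
have : {ae vol, forall x n, Pn n x}.
  apply/ae_foralln => n; rewrite /Pn; case: (unpickle n) => [i|]; last exact: nearW.
  have [iG|niG] := pselect (cbox (rat3 i.1 : R3 R) (rat3 i.2) `<=` G).
    by apply: ae_vol_impl (box _ _ iG) => x h _.
  by apply: nearW => x /niG.
apply: ae_vol_impl => x hx Gx; have [i [i1 i2]] := open_rat_cbox oG Gx.
by have := hx (pickle i); rewrite /Pn pickleK; exact.
Qed.

End FundamentalLemma.

(** * Integrability on a domain *)

Section LqOnDomain.
Context d (T : measurableType d) (R : realType) (mu : {measure set T -> \bar R}).
Variables (D : set T) (mD : measurable D).
Local Notation ig f := (mu.-integrable D (EFin \o f)).
Implicit Types (f g a b c : T -> R) (q p : R).

Definition Lq_on q f := measurable_fun D f /\ ig (fun x => `|f x| `^ q).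

Lemma measurable_powR_norm_on q f : 0 < q -> measurable_fun D f ->
  measurable_fun D (fun x => `|f x| `^ q).
Proof.
move=> q0 mf; apply: (@measurableT_comp _ _ _ _ _ _ (fun y : R => `|y| `^ q)) => //.
by apply: continuous_measurable_fun; exact: powR_norm_continuous.
Qed.

Lemma integrable_restrict f : ig f <-> mu.-integrable setT (EFin \o (f \_ D)).
Proof.
have -> : EFin \o (f \_ D) = (EFin \o f) \_ D.
  by apply/funext => x /=; rewrite !patchE; case: ifP.
exact: (integrable_mkcond (EFin \o f) mD).
Qed.

Lemma restrict_powR q f : 0 < q ->
  (fun x => `|(f \_ D) x| `^ q) = (fun x => `|f x| `^ q) \_ D.
Proof.
move=> q0; apply/funext => x; rewrite !patchE; case: ifP => // _.
by rewrite normr0 powR0// gt_eqF.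
Qed.

Lemma Lq_restrict q f : 0 < q -> Lq mu q (f \_ D) <-> Lq_on q f.
Proof.
move=> q0; rewrite /Lq /Lq_on restrict_powR//.
split=> -[h1 h2]; (split; [exact/(measurable_restrictT _ mD)|exact/integrable_restrict]).
Qed.

Lemma Lfun_restrict q f : 1 < q -> (f \_ D \in Lfun mu q%:E) <-> Lq_on q f.
Proof.
move=> q1; have q0 : 0 < q by rewrite (lt_trans ltr01).
rewrite -Lq_restrict//; split=> [h|[mf hf]].
  split; last exact: Lfun_integrable (ltW q1) h.
  by move: h; rewrite inE => /andP[/[!inE]].
rewrite inE; apply/andP; split; rewrite inE//= /finite_norm.
apply: (@lty_poweRy _ _ q); first by rewrite gt_eqF.
rewrite poweR_Lnorm ?gt_eqF//; have /integrableP[_] := hf.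
apply: le_lt_trans; rewrite le_eqVlt; apply/orP; left; apply/eqP.
by apply: eq_integral => x _ /=; rewrite [in RHS](ger0_norm (powR_ge0 _ _)).
Qed.

Lemma Lfun_infty_restrict f : f \_ D \in Lfun mu +oo%E ->
  measurable_fun D f /\ exists2 C : R, 0 <= C & {ae mu, forall x, D x -> `|f x| <= C}.
Proof.
rewrite inE => /andP[/[!inE]/= mf]; rewrite /finite_norm unlock => h.
split; first exact/(measurable_restrictT _ mD).
(* The essential supremum is at work only when the whole space has positive measure; otherwise every
   set is negligible and the bound 0 will do. *)
move: h; case: ifPn => [mu0 h|]; last first.
  rewrite -leNgt => mu0 _; exists 0 => //.
  apply: (@negligibleS _ _ _ mu setT) => //; apply/negligibleP => //.
  by apply/eqP; rewrite eq_le mu0 measure_ge0.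
set s := ess_sup_inf.ess_sup _ _ in h.
have s0 : (0 <= s)%E 
  by apply: ess_sup_inf.ess_sup_gee => //; apply: nearW => x; exact: abse_ge0.
have sfin : s \is a fin_num by rewrite ge0_fin_numE.
exists (fine s); first exact: fine_ge0.
apply: filterS (ess_sup_inf.ess_sup_ge mu (abse \o (EFin \o (f \_ D)))) => x + Dx.
rewrite -/s /=.
by rewrite patchE mem_set//= -lee_fin fineK.
Qed.

Lemma Lq_on_le q f g : 1 < q -> measurable_fun D f -> ig g ->
  (forall x, D x -> `|f x| `^ q <= g x) -> Lq_on q f.
Proof.
move=> q1 mf hg fg; have q0 : 0 < q by rewrite (lt_trans ltr01).
split => //; apply: (integrableR_le mD) hg _; first exact: measurable_powR_norm_on.
by move=> x Dx; rewrite ger0_norm ?powR_ge0//; exact: fg.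
Qed.

Lemma Lq_onD q f g : 1 < q -> Lq_on q f -> Lq_on q g -> Lq_on q (fun x => f x + g x).
Proof.
move=> q1 [mf hf] [mg hg]; have q0 : 0 < q by rewrite (lt_trans ltr01).
apply: (@Lq_on_le _ _ (fun x => 2 `^ q * (`|f x| `^ q + `|g x| `^ q))) => //.
- exact: measurable_funD.
- by apply: (integrableRZ mD); exact: (integrableRD mD).
- by move=> x _; exact: powR_normD.
Qed.

Lemma Lq_onZ q (k : R) f : 1 < q -> Lq_on q f -> Lq_on q (fun x => k * f x).
Proof.
move=> q1 [mf hf]; have q0 : 0 < q by rewrite (lt_trans ltr01).
apply: (@Lq_on_le _ _ (fun x => `|k| `^ q * (`|f x| `^ q))) => //.
- by apply: measurable_funM => //; exact: measurable_cst.
- exact: (integrableRZ mD).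
- by move=> x _; rewrite powR_normZ.
Qed.

Lemma Lq_onN q f : 1 < q -> Lq_on q f -> Lq_on q (fun x => - f x).
Proof.
move=> q1 /(Lq_onZ (-1) q1); congr Lq_on.
by apply/funext => x; rewrite mulN1r.
Qed.

Lemma Lq_onB q f g : 1 < q -> Lq_on q f -> Lq_on q g -> Lq_on q (fun x => f x - g x).
Proof. by move=> q1 hf hg; apply: Lq_onD => //; exact: Lq_onN. Qed.

Lemma Lq_on0 q : 0 < q -> Lq_on q (fun=> 0).
Proof.
move=> q0; split; first exact: measurable_cst.
apply: eq_integrable (integrable0 _ _) => // x _ /=.
by rewrite normr0 powR0// gt_eqF.
Qed.

Lemma Lq_on_ae_eq q f g : 0 < q -> Lq_on q f -> measurable_fun D g ->
  {ae mu, forall x, D x -> g x = f x} -> Lq_on q g.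
Proof.
move=> q0 [mf hf] mg fg; split => //.
have /integrableP[m1 i1] := hf.
have mgq : measurable_fun D (EFin \o (fun x => `|g x| `^ q)).
  by apply/measurable_EFinP; exact: measurable_powR_norm_on.
apply/integrableP; split; first exact: mgq.
rewrite (ae_eq_integral (abse \o (EFin \o (fun x => `|f x| `^ q)))) //.
- exact: measurableT_comp.
- exact: measurableT_comp.
- by apply: filterS fg => x h Dx /=; rewrite h.
Qed.

Lemma Rintegral_ae_eq f g : measurable_fun D f -> measurable_fun D g ->
  {ae mu, forall x, D x -> f x = g x} ->
  \int[mu]_(x in D) f x = \int[mu]_(x in D) g x.
Proof.
move=> mf mg fg; rewrite /Rintegral; congr fine; apply: ae_eq_integral => //.
- exact/measurable_EFinP.
- exact/measurable_EFinP.
- by apply: filterS fg => x h Dx; rewrite h.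
Qed.

(** Truncating the factor to [-C, C] changes it on a null set only and turns the essential bound
    into a pointwise one. *)
Lemma Lq_on_bounded_mul q (C : R) c f : 1 < q -> 0 <= C -> measurable_fun D c ->
  {ae mu, forall x, D x -> `|c x| <= C} -> Lq_on q f -> Lq_on q (fun x => c x * f x).
Proof.
move=> q1 C0 mc hc hf; have q0 : 0 < q by rewrite (lt_trans ltr01).
pose c' x := Num.min C (Num.max (- C) (c x)).
have mc' : measurable_fun D c'.
  apply: measurable_minr; first exact: measurable_cst.
  by apply: measurable_maxr => //; exact: measurable_cst.
have c'C x : `|c' x| <= C.
  by rewrite ler_norml /c' le_min ge_min lexx le_max lexx/= andbT; lra.
have [mf hfq] := hf.
apply: (@Lq_on_ae_eq q (fun x => c' x * f x)) => //.
- apply: (@Lq_on_le _ _ (fun x => C `^ q * (`|f x| `^ q))) => //.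
  + exact: measurable_funM.
  + exact: (integrableRZ mD).
  + move=> x _; rewrite powR_normZ ler_wpM2r ?powR_ge0//.
    by apply: ler_powR2; rewrite // ltW.
- exact: measurable_funM.
- apply: filterS hc => x h Dx; congr (_ * _); have := h Dx.
  by rewrite ler_norml => /andP[h1 h2]; rewrite /c' max_r// min_r.
Qed.

(** Young's inequality for l|x| and |y|/l; the factors 1/q and 1/p are dropped. *)
Lemma powR_young q (l x y : R) : 1 < q -> 0 < l ->
  `|x * y| <= l `^ q * `|x| `^ q + l^-1 `^ (q / (q - 1)) * `|y| `^ (q / (q - 1)).
Proof.
move=> q1 l0; have q0 : 0 < q by rewrite (lt_trans ltr01).
have q10 : 0 < q - 1 by rewrite subr_gt0.
have p0 : 0 < q / (q - 1) by rewrite divr_gt0.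
have := @conjugate_powR R (l * `|x|) (l^-1 * `|y|) q (q / (q - 1)).
rewrite !mulr_ge0 ?invr_ge0 ?(ltW l0)// => /(_ isT isT q0 p0).
rewrite invf_div -{1}[q^-1]mul1r -mulrDl addrCA subrr addr0 divff ?gt_eqF// => /(_ erefl).
rewrite mulrACA divff ?gt_eqF// mul1r -normrM => /le_trans; apply.
rewrite -!powRM ?invr_ge0 ?(ltW l0)//; apply: lerD.
  by rewrite ler_pdivrMr// ler_peMr ?powR_ge0// ltW.
by rewrite ler_piMr ?powR_ge0// ler_pdivrMr// mul1r gerBl.
Qed.

Lemma Lq_on_mul q a b : 1 < q -> Lq_on q a -> Lq_on (q / (q - 1)) b ->
  ig (fun x => a x * b x).
Proof.
move=> q1 [ma ha] [mb hb].
apply: (@integrableR_le _ _ _ mu D mD _ (fun x => `|a x| `^ q + `|b x| `^ (q / (q - 1)))).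
- exact: measurable_funM.
- exact: (integrableRD mD).
- move=> x _; have := powR_young (a x) (b x) q1 ltr01.
  by rewrite invr1 !powR1 !mul1r.
Qed.

(* Young's inequality with a large weight on [a] replaces Hoelder's inequality. *)
Lemma Rintegral_mul_small q b (e : R) : 1 < q -> Lq_on (q / (q - 1)) b -> 0 < e ->
  exists2 dl : R, 0 < dl & forall a, Lq_on q a ->
    \int[mu]_(x in D) `|a x| `^ q < dl -> `|\int[mu]_(x in D) (a x * b x)| < e.
Proof.
move=> q1 hb e0; set p := q / (q - 1) in hb *.
have p0 : 0 < p by rewrite divr_gt0 ?subr_gt0// (lt_trans ltr01).
pose W := \int[mu]_(x in D) `|b x| `^ p.
have W0 : 0 <= W by apply: Rintegral_ge0 => x _; exact: powR_ge0.
have W1 : 0 < 2 * (W + 1) by rewrite mulr_gt0// ltr_wpDl.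
(* [k] solves k^p = e / (2 (W + 1)), so the term in [b] stays below e/2; the weight on [a] is then
   1/k. Adding 1 covers the case W = 0. *)
pose k := (e / (2 * (W + 1))) `^ p^-1; have k0 : 0 < k by rewrite powR_gt0// divr_gt0.
pose l := k^-1; have l0 : 0 < l by rewrite invr_gt0.
have lW : l^-1 `^ p * W < e / 2.
  rewrite invrK -powRrM mulVf ?gt_eqF// powRr1; last by rewrite divr_ge0 ?ltW.
  rewrite mulrAC ltr_pdivrMr//.
  have -> : e / 2 * (2 * (W + 1)) = e * W + e by field.
  by rewrite ltrDl.
have lq : 0 < l `^ q by rewrite powR_gt0.
exists (e / 2 / l `^ q); first by rewrite !divr_gt0.
move=> a ha; rewrite ltr_pdivlMr// => small.
have iab := Lq_on_mul q1 ha hb.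
have [_ iaq] := ha; have [_ ibp] := hb.
apply: (le_lt_trans (le_normr_Rintegral mD iab)).
apply: (@le_lt_trans _ _ (\int[mu]_(x in D) (l `^ q * `|a x| `^ q + l^-1 `^ p * `|b x| `^ p))).
  apply: le_Rintegral => //.
  - exact: (integrable_norm iab).
  - by apply: (integrableRD mD); exact: (integrableRZ mD).
  - by move=> x _; exact: powR_young.
rewrite RintegralD//; [|exact: (integrableRZ mD)..].
rewrite (RintegralZl _ mD iaq) (RintegralZl _ mD ibp) -/W (splitr e); apply: ltrD lW.
by rewrite mulrC.
Qed.

(** The exponents multiply to (q - 1) q/(q - 1) = q: the duality map preserves energy and lands in
    the dual exponent. *)
Lemma powR_spowR q x : 1 < q -> `|spowR q x| `^ (q / (q - 1)) = `|x| `^ q.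
Proof.
move=> q1; have q0 : 0 < q by rewrite (lt_trans ltr01).
have q10 : 0 < q - 1 by rewrite subr_gt0.
have [->|x0] := eqVneq x 0.
  by rewrite /spowR sgr0 mul0r normr0 !powR0// gt_eqF// divr_gt0.
rewrite /spowR normrM normr_sg x0 mul1r ger0_norm ?powR_ge0// -powRrM.
by congr (_ `^ _); field; exact: lt0r_neq0.
Qed.

Lemma Lq_on_spowR q f : 1 < q -> Lq_on q f -> Lq_on (q / (q - 1)) (fun x => spowR q (f x)).
Proof.
move=> q1 [mf hf]; split.
  apply: (@measurableT_comp _ _ _ _ _ _ (spowR q)) => //.
  by apply: continuous_measurable_fun; exact: spowR_continuous.
by apply: eq_integrable hf => // x _ /=; rewrite powR_spowR.
Qed.

End LqOnDomain.

(** * Local integrability on an open set *)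

Section LocalIntegrability.
Context {R : realType}.
Variables (G : set (R3 R)) (oG : open G).
Implicit Types (r f : R3 R -> R) (K : set (R3 R)).

Let mG : measurable (G : set (mR3 R)). Proof. exact: open_measurable3. Qed.

Definition loc_integrable r :=
  forall K, compact K -> K `<=` G -> vol.-integrable K (EFin \o r).

(** Weak derivatives come only with integrability on compact sets; measurability on G is assembled
    from countably many rational boxes. *)
Lemma loc_integrable_measurable r : loc_integrable r ->
  measurable_fun (G : set (mR3 R)) r.
Proof.
move=> lr; pose E n : set (mR3 R) :=
  if (unpickle n : option ((rat * rat * rat) * (rat * rat * rat))) is Some i
  then if pselect (cbox (rat3 i.1) (rat3 i.2) `<=` G) then obox (rat3 i.1) (rat3 i.2)
       else set0 else set0.
have mE n : measurable (E n).
  rewrite /E; case: (unpickle n) => [i|]; last exact: measurable0.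
  by case: pselect => h; [exact: measurable_obox|exact: measurable0].
have GE : G = \bigcup_n E n.
  apply/seteqP; split => x.
    move=> Gx; have [i [i1 i2]] := open_rat_cbox oG Gx.
    exists (pickle i); first by [].
    by rewrite /E pickleK; case: pselect => [h|nh]; [exact: i2|case: (nh i1)].
  move=> [n _]; rewrite /E; case: (unpickle n) => [i|//].
  by case: pselect => // h /obox_sub_cbox /h.
rewrite GE; apply/measurable_fun_bigcup => // n; rewrite /E.
case: (unpickle n) => [i|]; last exact: measurable_fun_set0.
case: pselect => h; last exact: measurable_fun_set0.
apply: (@measurable_funS _ _ _ _ (cbox (rat3 i.1) (rat3 i.2) : set (mR3 R))).
- exact: measurable_cbox.
- exact: obox_sub_cbox.
- by apply: integrable_measurable; apply: lr => //; exact: cbox_compact.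
Qed.

Lemma Lq_on_loc_integrable q r : 1 < q -> Lq_on vol G q r -> loc_integrable r.
Proof.
move=> q1 [mr ir] K cK KG; have mK := compact_measurable3 cK.
have iK := integrableS mG mK KG ir.
have i1 : vol.-integrable (K : set (mR3 R)) (EFin \o (fun=> 1 : R)).
  apply/integrableP; split; first exact/measurable_EFinP/measurable_cst.
  under eq_integral do rewrite /= normr1.
  by rewrite integral_cst// mul1e; exact: vol_compact_fin.
apply: (@integrableR_le _ _ _ vol _ mK r (fun x => 1 + `|r x| `^ q)).
- exact: measurable_funS mr.
- exact: (integrableRD mK).
- move=> x _; have [h|/ltW h] := leP `|r x| 1.
    by rewrite (le_trans h)// lerDl powR_ge0.
  have : `|r x| `^ 1 <= `|r x| `^ q by rewrite ler_powR// ltW.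
  by rewrite powRr1// => /le_trans; apply; rewrite lerDr.
Qed.

Lemma loc_integrable_mul r f K : loc_integrable r -> compact K -> K `<=` G ->
  continuous f -> (forall x, ~ K x -> f x = 0) ->
  vol.-integrable (G : set (mR3 R)) (EFin \o (fun x => r x * f x)).
Proof.
move=> lr cK KG cf f0; have mK := compact_measurable3 cK.
have [M M0 hM] := continuous_norm_bounded cK cf.
have iK := lr K cK KG.
apply/(integrable_restrict vol mG).
have -> : (fun x => r x * f x) \_ G = (fun x => r x * f x) \_ K.
  apply/funext => x; rewrite !patchE.
  have [Kx|nK] := pselect (K x); first by rewrite !mem_set//; exact: KG.
  by rewrite f0// mulr0; do 2 case: ifP.
apply/(integrable_restrict vol mK).
have iMr : vol.-integrable (K : set (mR3 R)) (EFin \o (fun x => M * `|r x|)).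
  by apply: (integrableRZ mK); exact: (integrable_norm iK).
apply: (integrableR_le mK _ iMr).
- apply: measurable_funM; first exact: integrable_measurable iK.
  by apply: measurable_funTS; exact: continuous_measurable3.
- by move=> x Kx; rewrite normrM mulrC ler_wpM2r// hM.
Qed.

End LocalIntegrability.

(** * Biquaternions *)

Section BiquaternionAlgebra.
Context {R : realType}.
Implicit Types (p q a : biquat R) (c : R[i]).

Lemma Sc_mkq (s : R[i]) v : Sc (mkq s v) = s.
Proof. by rewrite /Sc /mkq row_mxKl mxE eqxx mulr1n. Qed.

Lemma Vec_mkq (s : R[i]) v : Vec (mkq s v) = v.
Proof. by rewrite /Vec /mkq row_mxKr. Qed.

Definition v1 p := Vec p 0 0.
Definition v2 p := Vec p 0 1.
Definition v3 p := Vec p 0 2%:R.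

Lemma I3_cases (P : 'I_3 -> Prop) : P 0 -> P 1 -> P 2%:R -> forall k, P k.
Proof.
move=> h0 h1 h2 k.
suff : [\/ k = 0, k = 1 | k = 2%:R] by case=> ->.
case: k => -[|[|[|//]]] ik; [apply: Or31|apply: Or32|apply: Or33]; exact: val_inj.
Qed.

Lemma sum_I3 (V : nmodType) (F : 'I_3 -> V) : \sum_k F k = F 0 + F 1 + F 2%:R.
Proof.
rewrite !big_ord_recl big_ord0 addr0 addrA.
by congr (F _ + F _ + F _); apply: val_inj.
Qed.

Lemma biquatP p q : Sc p = Sc q -> v1 p = v1 q -> v2 p = v2 q -> v3 p = v3 q -> p = q.
Proof.
move=> h0 h1 h2 h3; rewrite -[p]hsubmxK -[q]hsubmxK; congr row_mx.
  by apply/rowP => j; rewrite !ord1.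
by apply/rowP; apply: I3_cases.
Qed.

Lemma ScE p : Sc p = p 0 (lshift 3 0). Proof. by rewrite /Sc mxE. Qed.
Lemma VecE p k : Vec p 0 k = p 0 (rshift 1 k). Proof. by rewrite /Vec mxE. Qed.

Lemma sum_biquat (V : nmodType) (F : 'I_(1 + 3) -> V) :
  \sum_j F j = F (lshift 3 0) + F (rshift 1 0) + F (rshift 1 1) + F (rshift 1 2%:R).
Proof. by rewrite big_split_ord/= big_ord1 sum_I3 !addrA. Qed.

Lemma crossE0 (u v : 'rV[R[i]]_3) :
  crossc u v 0 0 = u 0 1 * v 0 2%:R - u 0 2%:R * v 0 1.
Proof. by rewrite mxE !add0r. Qed.
Lemma crossE1 (u v : 'rV[R[i]]_3) :
  crossc u v 0 1 = u 0 2%:R * v 0 0 - u 0 0 * v 0 2%:R.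
Proof.
have e : 1 + 2%:R = 0 :> 'I_3 by exact: val_inj.
by rewrite mxE e.
Qed.
Lemma crossE2 (u v : 'rV[R[i]]_3) :
  crossc u v 0 2%:R = u 0 0 * v 0 1 - u 0 1 * v 0 0.
Proof.
have e : 2%:R + 1 = 0 :> 'I_3 by exact: val_inj.
have e' : 2%:R + 2%:R = 1 :> 'I_3 by exact: val_inj.
by rewrite mxE e e'.
Qed.

Lemma Sc_mulq p q : Sc (mulq p q) = Sc p * Sc q - (v1 p * v1 q + v2 p * v2 q + v3 p * v3 q).
Proof. by rewrite /mulq Sc_mkq /dotc sum_I3. Qed.
Lemma v1_mulq p q : v1 (mulq p q) = Sc p * v1 q + Sc q * v1 p + (v2 p * v3 q - v3 p * v2 q).
Proof.
rewrite /v1 /mulq Vec_mkq mxE crossE0; congr (_ + _).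
by rewrite mxE; congr (_ + _); rewrite mxE.
Qed.
Lemma v2_mulq p q : v2 (mulq p q) = Sc p * v2 q + Sc q * v2 p + (v3 p * v1 q - v1 p * v3 q).
Proof.
rewrite /v2 /mulq Vec_mkq mxE crossE1; congr (_ + _).
by rewrite mxE; congr (_ + _); rewrite mxE.
Qed.
Lemma v3_mulq p q : v3 (mulq p q) = Sc p * v3 q + Sc q * v3 p + (v1 p * v2 q - v2 p * v1 q).
Proof.
rewrite /v3 /mulq Vec_mkq mxE crossE2; congr (_ + _).
by rewrite mxE; congr (_ + _); rewrite mxE.
Qed.

Lemma Sc_conjq p : Sc (conjq p) = Sc p. Proof. by rewrite /conjq Sc_mkq. Qed.
Lemma v1_conjq p : v1 (conjq p) = - v1 p. Proof. by rewrite /v1 /conjq Vec_mkq mxE. Qed.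
Lemma v2_conjq p : v2 (conjq p) = - v2 p. Proof. by rewrite /v2 /conjq Vec_mkq mxE. Qed.
Lemma v3_conjq p : v3 (conjq p) = - v3 p. Proof. by rewrite /v3 /conjq Vec_mkq mxE. Qed.

Lemma ScD p q : Sc (p + q) = Sc p + Sc q. Proof. by rewrite !ScE mxE. Qed.
Lemma v1D p q : v1 (p + q) = v1 p + v1 q. Proof. by rewrite /v1 !VecE mxE. Qed.
Lemma v2D p q : v2 (p + q) = v2 p + v2 q. Proof. by rewrite /v2 !VecE mxE. Qed.
Lemma v3D p q : v3 (p + q) = v3 p + v3 q. Proof. by rewrite /v3 !VecE mxE. Qed.
Lemma ScZ c p : Sc (c *: p) = c * Sc p. Proof. by rewrite !ScE mxE. Qed.
Lemma v1Z c p : v1 (c *: p) = c * v1 p. Proof. by rewrite /v1 !VecE mxE. Qed.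
Lemma v2Z c p : v2 (c *: p) = c * v2 p. Proof. by rewrite /v2 !VecE mxE. Qed.
Lemma v3Z c p : v3 (c *: p) = c * v3 p. Proof. by rewrite /v3 !VecE mxE. Qed.

Definition compE := (Sc_mulq, v1_mulq, v2_mulq, v3_mulq, Sc_conjq, v1_conjq, v2_conjq, v3_conjq,
  ScD, v1D, v2D, v3D, ScZ, v1Z, v2Z, v3Z).

Lemma mulqA p q a : mulq p (mulq q a) = mulq (mulq p q) a.
Proof. by apply: biquatP; rewrite !compE; ring. Qed.
Lemma mulqDl p q a : mulq (p + q) a = mulq p a + mulq q a.
Proof. by apply: biquatP; rewrite !compE; ring. Qed.
Lemma mulqDr p q a : mulq a (p + q) = mulq a p + mulq a q.
Proof. by apply: biquatP; rewrite !compE; ring. Qed.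
Lemma mulqZl c p a : mulq (c *: p) a = c *: mulq p a.
Proof. by apply: biquatP; rewrite !compE; ring. Qed.
Lemma mulqZr c p a : mulq a (c *: p) = c *: mulq a p.
Proof. by apply: biquatP; rewrite !compE; ring. Qed.
Lemma conjqD p q : conjq (p + q) = conjq p + conjq q.
Proof. by apply: biquatP; rewrite !compE; ring. Qed.
Lemma conjqZ c p : conjq (c *: p) = c *: conjq p.
Proof. by apply: biquatP; rewrite !compE; ring. Qed.
(** The complex-bilinear form under the integral in [pairing]; the Hermitian [innerq] is this form
    with its first argument conjugated. *)
Definition dotq p q : R[i] := \sum_j p 0 j * q 0 j.

Lemma dotqE p q : dotq p q = Sc p * Sc q + v1 p * v1 q + v2 p * v2 q + v3 p * v3 q.
Proof. by rewrite /dotq sum_biquat /v1 /v2 /v3 !ScE !VecE. Qed.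

Lemma Sc_conj_mulq p q : Sc (mulq (conjq p) q) = dotq p q.
Proof. by rewrite dotqE !compE; ring. Qed.
Lemma dotqC p q : dotq p q = dotq q p.
Proof. by rewrite !dotqE; ring. Qed.
Lemma dotqDr p q a : dotq a (p + q) = dotq a p + dotq a q.
Proof. by rewrite !dotqE !compE; ring. Qed.
Lemma dotqZr c p q : dotq p (c *: q) = c * dotq p q.
Proof. by rewrite !dotqE !compE; ring. Qed.
Lemma dotq_mull a p q : dotq (mulq a p) q = dotq p (mulq (conjq a) q).
Proof. by rewrite !dotqE !compE; ring. Qed.

Lemma Sc_eq_ k : Sc (eq_ k : biquat R) = 0. Proof. by rewrite /eq_ Sc_mkq. Qed.

Lemma Vec_mul_eq_ p k : Vec p 0 k = - Sc (mulq p (eq_ k)).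
Proof.
rewrite Sc_mulq Sc_eq_ mulr0 sub0r opprK /v1 /v2 /v3 /eq_ Vec_mkq !mxE eqxx/=.
by move: k; apply: I3_cases; rewrite ?mulr1 ?mulr0 ?addr0 ?add0r.
Qed.

(** For the bilinear form, multiplication by a has as transpose multiplication by the quaternionic
    conjugate on the same side, and conjugation is its own transpose. Conjugation also reverses
    products, so the transpose of w -> conj(w) a2 is q -> a2 conj(q): the second and fourth
    coefficients are exchanged and lose their conjugates. *)
Lemma dotq_star (a1 a2 a3 a4 w q : biquat R) :
  dotq (mulq w a1 + mulq (conjq w) a2 + mulq a3 w + mulq a4 (conjq w)) q =
  dotq w (mulq q (conjq a1) + mulq (conjq q) a4 + mulq (conjq a3) q + mulq a2 (conjq q)).
Proof. by rewrite !dotqE !compE; ring. Qed.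

Lemma innerqE p q : innerq p q = dotq (cconjq p) q.
Proof. by rewrite /innerq /daggerq Sc_conj_mulq. Qed.

End BiquaternionAlgebra.

(** * Complex-valued integrals and test functions *)

Section ComplexParts.
Context {R : realType}.
Implicit Types x y : R[i].

Lemma ReD x y : complex.Re (x + y) = complex.Re x + complex.Re y.
Proof. by case: x; case: y. Qed.
Lemma ImD x y : complex.Im (x + y) = complex.Im x + complex.Im y.
Proof. by case: x; case: y. Qed.
Lemma ReN x : complex.Re (- x) = - complex.Re x. Proof. by case: x. Qed.
Lemma ImN x : complex.Im (- x) = - complex.Im x. Proof. by case: x. Qed.
Lemma ReM x y : complex.Re (x * y) = complex.Re x * complex.Re y - complex.Im x * complex.Im y.
Proof. by case: x; case: y. Qed.
Lemma ImM x y : complex.Im (x * y) = complex.Re x * complex.Im y + complex.Im x * complex.Re y.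
Proof. by case: x => a b; case: y. Qed.

Lemma complexP x y : complex.Re x = complex.Re y -> complex.Im x = complex.Im y -> x = y.
Proof. by case: x => a b; case: y => c d /= -> ->. Qed.

Lemma Re_sum (I : Type) (s : seq I) (F : I -> R[i]) :
  complex.Re (\sum_(i <- s) F i) = \sum_(i <- s) complex.Re (F i).
Proof. by elim: s => [|i s IH]; rewrite ?big_nil// !big_cons ReD IH. Qed.
End ComplexParts.

Section ComplexIntegral.
Context {R : realType}.
Variables (G : set (R3 R)) (oG : open G).
Implicit Types (f g a b : R3 R -> R[i]).

Let mG : measurable (G : set (mR3 R)). Proof. exact: open_measurable3. Qed.
Local Notation ig f := (vol.-integrable (G : set (mR3 R)) (EFin \o f)).
Local Notation re f := (fun x => complex.Re (f x)).
Local Notation im f := (fun x => complex.Im (f x)).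

Definition integrableC f := ig (re f) /\ ig (im f).

Lemma eq_intC f g : (forall x, G x -> f x = g x) -> intC G f = intC G g.
Proof.
move=> fg; rewrite /intC; congr Complex; apply: eq_Rintegral => x; rewrite inE => Gx;
  by rewrite fg.
Qed.

Lemma eq_integrableC f g : (forall x, f x = g x) -> integrableC f -> integrableC g.
Proof. by move=> fg; congr integrableC; exact/funext. Qed.

Lemma integrableC_D f g : integrableC f -> integrableC g -> integrableC (fun x => f x + g x).
Proof.
move=> [f1 f2] [g1 g2]; split.
- rewrite (_ : (fun x => _) = (fun x => complex.Re (f x) + complex.Re (g x))).
    exact: integrableRD.
  by apply/funext => x; rewrite ReD.
- rewrite (_ : (fun x => _) = (fun x => complex.Im (f x) + complex.Im (g x))).
    exact: integrableRD.
  by apply/funext => x; rewrite ImD.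
Qed.

Lemma intC_D f g : integrableC f -> integrableC g ->
  intC G (fun x => f x + g x) = intC G f + intC G g.
Proof.
move=> [f1 f2] [g1 g2]; apply: complexP; rewrite ?ReD ?ImD /=.
- by rewrite -RintegralD//; apply: eq_Rintegral => x _; rewrite ReD.
- by rewrite -RintegralD//; apply: eq_Rintegral => x _; rewrite ImD.
Qed.

Lemma integrableC_Z (c : R[i]) f : integrableC f -> integrableC (fun x => c * f x).
Proof.
move=> [f1 f2]; split.
- rewrite (_ : (fun x => _) = (fun x => complex.Re c * complex.Re (f x) - complex.Im c * complex.Im (f x))).
    by apply: integrableRB => //; exact: integrableRZ.
  by apply/funext => x; rewrite ReM.
- rewrite (_ : (fun x => _) = (fun x => complex.Re c * complex.Im (f x) + complex.Im c * complex.Re (f x))).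
    by apply: integrableRD => //; exact: integrableRZ.
  by apply/funext => x; rewrite ImM.
Qed.

Lemma intC_Z (c : R[i]) f : integrableC f -> intC G (fun x => c * f x) = c * intC G f.
Proof.
move=> [f1 f2]; apply: complexP; rewrite ?ReM ?ImM /=.
- rewrite -!RintegralZl// -RintegralB//; [|exact: integrableRZ..].
  by apply: eq_Rintegral => x _; rewrite ReM.
- rewrite -!RintegralZl// -RintegralD//; [|exact: integrableRZ..].
  by apply: eq_Rintegral => x _; rewrite ImM.
Qed.

Lemma integrableC_N f : integrableC f -> integrableC (fun x => - f x).
Proof. by move=> /(integrableC_Z (-1)); apply: eq_integrableC => x; rewrite mulN1r. Qed.

Lemma intC_N f : integrableC f -> intC G (fun x => - f x) = - intC G f.
Proof.
move=> hf; rewrite -mulN1r -intC_Z//; apply: eq_intC => x _; by rewrite mulN1r.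
Qed.

Lemma integrableC_B f g : integrableC f -> integrableC g -> integrableC (fun x => f x - g x).
Proof. by move=> hf hg; apply: integrableC_D => //; exact: integrableC_N. Qed.

Lemma intC_B f g : integrableC f -> integrableC g ->
  intC G (fun x => f x - g x) = intC G f - intC G g.
Proof. by move=> hf hg; rewrite intC_D ?intC_N//; exact: integrableC_N. Qed.

Lemma intC0 : intC G (fun=> 0) = 0.
Proof. by rewrite /intC /= Rintegral_cst// mul0r. Qed.

Lemma integrableC0 : integrableC (fun=> 0).
Proof. by split; apply: eq_integrable (integrable0 _ _). Qed.

Lemma integrableC_sum (I : Type) (s : seq I) (F : I -> R3 R -> R[i]) :
  (forall i, integrableC (F i)) -> integrableC (fun x => \sum_(i <- s) F i x).
Proof.
move=> hF; elim: s => [|i s IH].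
  by apply: eq_integrableC integrableC0 => x; rewrite big_nil.
by apply: eq_integrableC (integrableC_D (hF i) IH) => x; rewrite big_cons.
Qed.

Lemma intC_sum (I : Type) (s : seq I) (F : I -> R3 R -> R[i]) :
  (forall i, integrableC (F i)) ->
  intC G (fun x => \sum_(i <- s) F i x) = \sum_(i <- s) intC G (F i).
Proof.
move=> hF; elim: s => [|i s IH].
  rewrite big_nil; transitivity (intC G (fun=> 0)); last exact: intC0.
  by apply: eq_intC => x _; rewrite big_nil.
rewrite big_cons -IH -intC_D//; last exact: integrableC_sum.
by apply: eq_intC => x _; rewrite big_cons.
Qed.

Definition LpC q f := Lq_on vol G q (re f) /\ Lq_on vol G q (im f).

Lemma Lp_LpC q f : 1 < q -> Lp G q%:E f <-> LpC q f.
Proof.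
move=> q1; rewrite /Lp /LpC.
by split=> -[h1 h2]; split; apply/(Lfun_restrict vol mG _ q1).
Qed.

Lemma LpC_D q f g : 1 < q -> LpC q f -> LpC q g -> LpC q (fun x => f x + g x).
Proof.
move=> q1 [f1 f2] [g1 g2]; split.
- rewrite (_ : (fun x => _) = (fun x => complex.Re (f x) + complex.Re (g x))).
    exact: Lq_onD.
  by apply/funext => x; rewrite ReD.
- rewrite (_ : (fun x => _) = (fun x => complex.Im (f x) + complex.Im (g x))).
    exact: Lq_onD.
  by apply/funext => x; rewrite ImD.
Qed.

Lemma LpC_Z q (c : R[i]) f : 1 < q -> LpC q f -> LpC q (fun x => c * f x).
Proof.
move=> q1 [f1 f2]; split.
- rewrite (_ : (fun x => _) = (fun x => complex.Re c * complex.Re (f x) - complex.Im c * complex.Im (f x))).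
    by apply: Lq_onB => //; exact: Lq_onZ.
  by apply/funext => x; rewrite ReM.
- rewrite (_ : (fun x => _) = (fun x => complex.Re c * complex.Im (f x) + complex.Im c * complex.Re (f x))).
    by apply: Lq_onD => //; exact: Lq_onZ.
  by apply/funext => x; rewrite ImM.
Qed.

Lemma LpC_N q f : 1 < q -> LpC q f -> LpC q (fun x => - f x).
Proof.
move=> q1 /(LpC_Z (-1) q1); congr LpC.
by apply/funext => x; rewrite mulN1r.
Qed.

Lemma LpC_B q f g : 1 < q -> LpC q f -> LpC q g -> LpC q (fun x => f x - g x).
Proof. by move=> q1 hf hg; apply: LpC_D => //; exact: LpC_N. Qed.

Lemma LpC0 q : 0 < q -> LpC q (fun=> 0).
Proof. by move=> q0; split; exact: Lq_on0. Qed.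

Lemma LpC_sum q (I : Type) (s : seq I) (F : I -> R3 R -> R[i]) : 1 < q ->
  (forall i, LpC q (F i)) -> LpC q (fun x => \sum_(i <- s) F i x).
Proof.
move=> q1 hF; elim: s => [|i s IH].
  rewrite (_ : (fun x => _) = fun=> 0); last by apply/funext => x; rewrite big_nil.
  by apply: LpC0; rewrite (lt_trans ltr01).
rewrite (_ : (fun x => _) = fun x => F i x + \sum_(j <- s) F j x).
  exact: LpC_D.
by apply/funext => x; rewrite big_cons.
Qed.

Definition ess_bounded (r : R3 R -> R) := measurable_fun (G : set (mR3 R)) r /\
  exists2 C : R, 0 <= C & {ae vol, forall x, G x -> `|r x| <= C}.

Definition LooC f := ess_bounded (re f) /\ ess_bounded (im f).

Lemma Lp_LooC f : Lp G +oo%E f -> LooC f.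
Proof. by move=> [h1 h2]; split; exact: Lfun_infty_restrict. Qed.

Lemma ess_boundedN r : ess_bounded r -> ess_bounded (fun x => - r x).
Proof.
move=> [mr [C C0 hC]]; split; first exact: measurableT_comp.
exists C => //; apply: ae_vol_impl hC => x h Gx; rewrite normrN; exact: h.
Qed.

Lemma LooC_N f : LooC f -> LooC (fun x => - f x).
Proof.
move=> [/ess_boundedN f1 /ess_boundedN f2]; split.
- by under [X in ess_bounded X]funext => x do rewrite ReN.
- by under [X in ess_bounded X]funext => x do rewrite ImN.
Qed.

Lemma LooC_conj f : LooC f -> LooC (fun x => conjc (f x)).
Proof.
move=> [f1 /ess_boundedN f2]; split.
- by rewrite (_ : (fun x => _) = re f)//; apply/funext => x; case: (f x).
- by rewrite (_ : (fun x => _) = fun x => - im f x)//; apply/funext => x /=; case: (f x).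
Qed.

Lemma LpC_Loo_mul q a f : 1 < q -> LooC a -> LpC q f -> LpC q (fun x => a x * f x).
Proof.
move=> q1 [[ma1 [C1 C10 h1]] [ma2 [C2 C20 h2]]] [f1 f2].
split.
- rewrite (_ : (fun x => _) = (fun x => complex.Re (a x) * complex.Re (f x) - complex.Im (a x) * complex.Im (f x))).
    apply: Lq_onB => //; first exact: (Lq_on_bounded_mul mG q1 C10 ma1 h1).
    exact: (Lq_on_bounded_mul mG q1 C20 ma2 h2).
  by apply/funext => x; rewrite ReM.
- rewrite (_ : (fun x => _) = (fun x => complex.Re (a x) * complex.Im (f x) + complex.Im (a x) * complex.Re (f x))).
    apply: Lq_onD => //; first exact: (Lq_on_bounded_mul mG q1 C10 ma1 h1).
    exact: (Lq_on_bounded_mul mG q1 C20 ma2 h2).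
  by apply/funext => x; rewrite ImM.
Qed.

Lemma integrableC_mul q a b : 1 < q -> LpC q a -> LpC (q / (q - 1)) b ->
  integrableC (fun x => a x * b x).
Proof.
move=> q1 [a1 a2] [b1 b2]; split.
- rewrite (_ : (fun x => _) = (fun x => complex.Re (a x) * complex.Re (b x) - complex.Im (a x) * complex.Im (b x))).
    by apply: integrableRB => //; exact: (Lq_on_mul mG q1).
  by apply/funext => x; rewrite ReM.
- rewrite (_ : (fun x => _) = (fun x => complex.Re (a x) * complex.Im (b x) + complex.Im (a x) * complex.Re (b x))).
    by apply: integrableRD => //; exact: (Lq_on_mul mG q1).
  by apply/funext => x; rewrite ImM.
Qed.

Definition energyC q f : R :=
  \int[vol]_(x in G) `|complex.Re (f x)| `^ q + \int[vol]_(x in G) `|complex.Im (f x)| `^ q.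

Lemma intC_mul_small q b (e : R) : 1 < q -> LpC (q / (q - 1)) b -> 0 < e ->
  exists2 dl : R, 0 < dl & forall a, LpC q a -> energyC q a < dl ->
    `|complex.Re (intC G (fun x => a x * b x))| < e /\
    `|complex.Im (intC G (fun x => a x * b x))| < e.
Proof.
move=> q1 [b1 b2] e0; have e2 : 0 < e / 2 by rewrite divr_gt0.
have [d1 d10 h1] := Rintegral_mul_small mG q1 b1 e2.
have [d2 d20 h2] := Rintegral_mul_small mG q1 b2 e2.
exists (Num.min d1 d2); first by rewrite lt_min d10.
move=> a [a1 a2]; rewrite lt_min => /andP[s1 s2].
have p1 : 0 <= \int[vol]_(x in G) `|complex.Re (a x)| `^ q.
  by apply: Rintegral_ge0 => x _; exact: powR_ge0.
have p2 : 0 <= \int[vol]_(x in G) `|complex.Im (a x)| `^ q.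
  by apply: Rintegral_ge0 => x _; exact: powR_ge0.
have E1 : \int[vol]_(x in G) `|complex.Re (a x)| `^ q <= energyC q a by rewrite lerDl.
have E2 : \int[vol]_(x in G) `|complex.Im (a x)| `^ q <= energyC q a by rewrite lerDr.
have k11 := h1 _ a1 (le_lt_trans E1 s1); have k12 := h2 _ a1 (le_lt_trans E1 s2).
have k21 := h1 _ a2 (le_lt_trans E2 s1); have k22 := h2 _ a2 (le_lt_trans E2 s2).
have r11 := Lq_on_mul mG q1 a1 b1. have r12 := Lq_on_mul mG q1 a1 b2.
have r21 := Lq_on_mul mG q1 a2 b1. have r22 := Lq_on_mul mG q1 a2 b2.
split; rewrite (splitr e) /=.
- under eq_Rintegral => x _ do rewrite ReM.
  rewrite RintegralB// (le_lt_trans (ler_normB _ _))//.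
  exact: ltrD k11 k22.
- under eq_Rintegral => x _ do rewrite ImM.
  rewrite RintegralD// (le_lt_trans (ler_normD _ _))//.
  exact: ltrD k12 k21.
Qed.

End ComplexIntegral.

(** * Test functions and weak partial derivatives *)

Section TestFunctions.
Context {R : realType}.
Variables (G : set (R3 R)) (oG : open G).
Implicit Types (f g phi psi : R3 R -> R[i]) (r : R3 R -> R).

Let mG : measurable (G : set (mR3 R)). Proof. exact: open_measurable3. Qed.
Local Notation re f := (fun x => complex.Re (f x)).
Local Notation im f := (fun x => complex.Im (f x)).

Lemma test_fun_support phi : test_fun G phi ->
  exists K, [/\ compact K, K `<=` G & forall x, ~ K x -> phi x = 0].
Proof.
move=> [_ _ cK KG]; exists (closure [set x | phi x != 0]); split => // x nx.
by apply/eqP; apply: contrapT => /negP h; apply: nx; exact: subset_closure.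
Qed.

Lemma test_funI phi K : smooth (re phi) -> smooth (im phi) -> compact K -> K `<=` G ->
  (forall x, ~ K x -> phi x = 0) -> test_fun G phi.
Proof.
move=> s1 s2 cK KG phi0.
have sub : closure [set x | phi x != 0] `<=` K.
  have := compact_closed3 cK; rewrite closure_id => ->; apply: closure_subset => x /= /eqP h.
  by apply: contrapT => /phi0.
split => //; last exact: subset_trans KG.
by apply: subclosed_compact cK sub; exact: closed_closure.
Qed.

Lemma test_fun_smooth phi : test_fun G phi -> smooth (re phi) /\ smooth (im phi).
Proof. by case. Qed.

Lemma partial_test phi k : test_fun G phi -> test_fun G (partialC k phi).
Proof.
move=> tp; have [K [cK KG phi0]] := test_fun_support tp.
have [s1 s2] := test_fun_smooth tp.
apply: (@test_funI _ K) => //; [exact: smooth_partial|exact: smooth_partial|].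
move=> x nx; apply: complexP => /=; apply: (@partial_eq0 _ _ K) => //;
  by [exact: compact_closed3|move=> y ny; rewrite phi0].
Qed.

Lemma test_funD phi psi : test_fun G phi -> test_fun G psi ->
  test_fun G (fun x => phi x + psi x).
Proof.
move=> tp tq; have [K [cK KG phi0]] := test_fun_support tp.
have [L [cL LG psi0]] := test_fun_support tq.
have [s1 s2] := test_fun_smooth tp; have [t1 t2] := test_fun_smooth tq.
apply: (@test_funI _ (K `|` L)).
- by under [X in smooth X]funext => x do rewrite ReD; exact: smoothD.
- by under [X in smooth X]funext => x do rewrite ImD; exact: smoothD.
- exact: compactU.
- by move=> x [/KG|/LG].
- move=> x nx; rewrite phi0 ?psi0 ?addr0// => ?; apply: nx; [by right|by left].
Qed.

Lemma test_funZ c phi : test_fun G phi -> test_fun G (fun x => c * phi x).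
Proof.
move=> tp; have [K [cK KG phi0]] := test_fun_support tp.
have [s1 s2] := test_fun_smooth tp; apply: (@test_funI _ K) => //.
- under [X in smooth X]funext => x do rewrite ReM.
  by apply: smoothB; exact: smoothZ.
- under [X in smooth X]funext => x do rewrite ImM.
  by apply: smoothD; exact: smoothZ.
- by move=> x /phi0 ->; rewrite mulr0.
Qed.

Lemma test_fun0 : test_fun G (fun=> 0).
Proof.
apply: (@test_funI _ set0) => //; [exact: smooth_cst|exact: smooth_cst|exact: compact0].
Qed.

Lemma test_fun_sum (I : Type) (s : seq I) (F : I -> R3 R -> R[i]) :
  (forall i, test_fun G (F i)) -> test_fun G (fun x => \sum_(i <- s) F i x).
Proof.
move=> hF; elim: s => [|i s IH].
  rewrite (_ : (fun x => _) = fun=> 0); last by apply/funext => x; rewrite big_nil.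
  exact: test_fun0.
rewrite (_ : (fun x => _) = fun x => F i x + \sum_(j <- s) F j x).
  exact: test_funD.
by apply/funext => x; rewrite big_cons.
Qed.

Lemma partialC_D k phi psi : test_fun G phi -> test_fun G psi ->
  partialC k (fun x => phi x + psi x) = fun x => partialC k phi x + partialC k psi x.
Proof.
move=> /test_fun_smooth[s1 s2] /test_fun_smooth[t1 t2]; apply/funext => x.
apply: complexP; rewrite ?ReD ?ImD /=.
- under [X in partial k X]funext => y do rewrite ReD.
  by rewrite partialD// => y; exact: smooth_derivable.
- under [X in partial k X]funext => y do rewrite ImD.
  by rewrite partialD// => y; exact: smooth_derivable.
Qed.

Lemma partialZ k (c : R) r x : smooth r -> partial k (fun y => c * r y) x = c * partial k r x.
Proof.
move=> sr; rewrite partialM; last 2 first.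
- by move=> y; exact: derivable_cst.
- by move=> y; exact: smooth_derivable.
by rewrite partial_cst mul0r addr0.
Qed.

Lemma partialC_Z k c phi : test_fun G phi ->
  partialC k (fun x => c * phi x) = fun x => c * partialC k phi x.
Proof.
move=> /test_fun_smooth[s1 s2]; apply/funext => x.
have dZ (a : R) (r : R3 R -> R) : smooth r -> forall y, derivable (fun y => a * r y) y (basis3 k).
  by move=> sr y; apply: smooth_derivable; exact: smoothZ.
apply: complexP; rewrite ?ReM ?ImM /=.
- under [X in partial k X]funext => y do rewrite ReM -mulNr.
  by rewrite partialD ?partialZ ?mulNr//; exact: dZ.
- under [X in partial k X]funext => y do rewrite ImM.
  by rewrite partialD ?partialZ//; exact: dZ.
Qed.

Lemma partialC_sum k (I : Type) (s : seq I) (F : I -> R3 R -> R[i]) :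
  (forall i, test_fun G (F i)) ->
  partialC k (fun x => \sum_(i <- s) F i x) = fun x => \sum_(i <- s) partialC k (F i) x.
Proof.
move=> hF; elim: s => [|i s IH]; apply/funext => x.
  under [X in partialC k X]funext => y do rewrite big_nil.
  by rewrite big_nil /partialC /= partial_cst.
under [X in partialC k X]funext => y do rewrite big_cons.
by rewrite big_cons partialC_D ?IH//; exact: test_fun_sum.
Qed.

Lemma test_LpC q phi : 1 < q -> test_fun G phi -> LpC G q phi.
Proof.
move=> q1 tp; have q0 : 0 < q by rewrite (lt_trans ltr01).
have [K [cK KG phi0]] := test_fun_support tp; have [s1 s2] := test_fun_smooth tp.
have real_case r : smooth r -> (forall x, ~ K x -> r x = 0) -> Lq_on vol G q r.
  move=> sr r0; have cr := smooth_continuous sr; split.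
    by apply: measurable_funTS; exact: continuous_measurable3.
  apply: (integrableS measurableT mG) => //.
  apply: (continuous_compact_integrable3 cK).
    move=> x; apply: (@continuous_comp _ _ _ r (fun y : R => `|y| `^ q)); first exact: cr.
    exact: powR_norm_continuous.
  by move=> x /r0 ->; rewrite normr0 powR0// gt_eqF.
by split; apply: real_case => // x nx; rewrite phi0.
Qed.

Lemma L1loc_test_mul f phi : L1loc G f -> test_fun G phi ->
  integrableC G (fun x => f x * phi x).
Proof.
move=> lf tp; have [K [cK KG phi0]] := test_fun_support tp; have [s1 s2] := test_fun_smooth tp.
have l1 : loc_integrable G (re f) by move=> L cL LG; case: (lf L cL LG).
have l2 : loc_integrable G (im f) by move=> L cL LG; case: (lf L cL LG).
have m r r' : loc_integrable G r -> smooth r' -> (forall x, ~ K x -> r' x = 0) ->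
    vol.-integrable (G : set (mR3 R)) (EFin \o (fun x => r x * r' x)).
  move=> lr sr r0; apply: (loc_integrable_mul oG lr cK KG) r0.
  exact: smooth_continuous.
have z1 x : ~ K x -> complex.Re (phi x) = 0 by move=> /phi0 ->.
have z2 x : ~ K x -> complex.Im (phi x) = 0 by move=> /phi0 ->.
split.
- rewrite (_ : (fun x => _) = (fun x => complex.Re (f x) * complex.Re (phi x) - complex.Im (f x) * complex.Im (phi x))).
    by apply: integrableRB => //; exact: m.
  by apply/funext => x; rewrite ReM.
- rewrite (_ : (fun x => _) = (fun x => complex.Re (f x) * complex.Im (phi x) + complex.Im (f x) * complex.Re (phi x))).
    by apply: integrableRD => //; exact: m.
  by apply/funext => x; rewrite ImM.
Qed.

Lemma LpC_L1loc q f : 1 < q -> LpC G q f -> L1loc G f.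
Proof.
by move=> q1 [f1 f2] K cK KG; split; exact: (Lq_on_loc_integrable oG q1 _ cK KG).
Qed.

Lemma test_L1loc phi : test_fun G phi -> L1loc G phi.
Proof. by move=> tp; apply: (@LpC_L1loc 2); [rewrite ltr1n|apply: test_LpC; rewrite ?ltr1n]. Qed.

Lemma weak_partial_test k phi : test_fun G phi -> weak_partial G k phi (partialC k phi).
Proof.
move=> tp psi tq; have tpp := partial_test k tp; have tqp := partial_test k tq.
have [K [cK KG phi0]] := test_fun_support tp.
have [s1 s2] := test_fun_smooth tp; have [t1 t2] := test_fun_smooth tq.
have onG r : (forall x, ~ K x -> r x = 0) -> \int[vol]_(x in G) r x = \int[vol]_x r x.
  move=> r0; rewrite Rintegral_mkcond; apply: eq_Rintegral => x _; rewrite patchE.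
  by case: ifPn => //; rewrite notin_setE => nG; rewrite r0// => /KG.
have z1 x : ~ K x -> complex.Re (phi x) = 0 by move=> /phi0 ->.
have z2 x : ~ K x -> complex.Im (phi x) = 0 by move=> /phi0 ->.
have cl := compact_closed3 cK.
have parts r r' : smooth r -> smooth r' -> (forall x, ~ K x -> r x = 0) ->
    \int[vol]_(x in G) (r x * partial k r' x) = - \int[vol]_(x in G) (partial k r x * r' x).
  move=> sr sr' r0.
  rewrite onG; last by move=> x /r0 ->; rewrite mul0r.
  rewrite onG; last by move=> x nK; rewrite (partial_eq0 k cl r0)// mul0r.
  exact: (vol_integration_by_parts k cK sr sr' r0).
have int r r' : smooth r -> smooth r' -> (forall x, ~ K x -> r x = 0) ->
    vol.-integrable (G : set (mR3 R)) (EFin \o (fun x => r x * r' x)).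
  move=> sr sr' r0; apply: (integrableS measurableT mG) => //.
  apply: (continuous_compact_integrable3 cK).
    by apply: smooth_continuous; exact: smoothM.
  by move=> x /r0 ->; rewrite mul0r.
have sp r : smooth r -> smooth (partial k r) by exact: smooth_partial.
have pz r : (forall x, ~ K x -> r x = 0) -> forall x, ~ K x -> partial k r x = 0.
  by move=> r0; exact: partial_eq0.
apply: complexP; rewrite ?ReN ?ImN /=.
- under eq_Rintegral => x _ do rewrite ReM /=.
  under [in RHS]eq_Rintegral => x _ do rewrite ReM /=.
  rewrite !RintegralB//; try (by apply: int => //; first [exact: sp|exact: pz]).
  by rewrite !parts// opprB opprK addrC.
- under eq_Rintegral => x _ do rewrite ImM /=.
  under [in RHS]eq_Rintegral => x _ do rewrite ImM /=.
  rewrite !RintegralD//; try (by apply: int => //; first [exact: sp|exact: pz]).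
  by rewrite !parts// opprD.
Qed.

(** Real-valued tests separate the real and imaginary parts, and each is covered by the real
    fundamental lemma. *)
Lemma L1loc_test_eq0 f : L1loc G f ->
  (forall phi, test_fun G phi -> intC G (fun x => f x * phi x) = 0) ->
  {ae vol, forall x, G x -> f x = 0}.
Proof.
move=> lf hf.
have test r : real_test G r -> intC G (fun x => f x * (r x)%:C%C) = 0.
  move=> [sr [K [cK KG r0]]]; apply: hf; apply: (@test_funI _ K) => //.
    exact: smooth_cst.
  by move=> x /r0 ->.
have h1 : {ae vol, forall x, G x -> complex.Re (f x) = 0}.
  apply: fundamental_lemma => //; first by move=> K cK KG; case: (lf K cK KG).
  move=> r tr; have := congr1 (@complex.Re R) (test r tr); rewrite /=.
  by under eq_Rintegral => x _ do rewrite ReM /= mulr0 subr0.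
have h2 : {ae vol, forall x, G x -> complex.Im (f x) = 0}.
  apply: fundamental_lemma => //; first by move=> K cK KG; case: (lf K cK KG).
  move=> r tr; have := congr1 (@complex.Im R) (test r tr); rewrite /=.
  by under eq_Rintegral => x _ do rewrite ImM /= mulr0 add0r.
have h12 : vol.-negligible (~` [set x : mR3 R | G x -> complex.Re (f x) = 0] `|`
    ~` [set x : mR3 R | G x -> complex.Im (f x) = 0]) by exact: negligibleU.
apply: negligibleS h12 => x /= h; apply: contrapT => /not_orP[/contrapT k1 /contrapT k2].
by apply: h => Gx; apply: complexP; [exact: k1|exact: k2].
Qed.

End TestFunctions.

(** * Norms of biquaternion-valued functions *)

Section EuclideanNorm.
Context {R : realType} {I : finType}.
Implicit Types c : I -> R.

Definition l2 c : R := Num.sqrt (\sum_i c i ^+ 2).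

Lemma l2_ge0 c : 0 <= l2 c. Proof. exact: sqrtr_ge0. Qed.

Lemma le_l2 c i : `|c i| <= l2 c.
Proof.
rewrite -sqrtr_sqr; apply: ler_wsqrtr.
rewrite (bigD1 i)//= lerDl; apply: sumr_ge0 => j _; exact: sqr_ge0.
Qed.

(** Every |c i| is at most the q-th root of the sum, so the Euclidean length is at most sqrt(card I)
    times that root. With [le_l2] this compares [LpH_norm] with the componentwise energy. *)
Lemma l2_powR (q : R) c : 1 < q ->
  l2 c `^ q <= Num.sqrt #|I|%:R `^ q * \sum_i `|c i| `^ q.
Proof.
move=> q1; have q0 : 0 < q by rewrite (lt_trans ltr01).
set S := \sum_i _; have S0 : 0 <= S by apply: sumr_ge0 => i _; exact: powR_ge0.
have ci i : `|c i| <= S `^ q^-1.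
  have -> : `|c i| = (`|c i| `^ q) `^ q^-1 by rewrite -powRrM mulfV ?gt_eqF// powRr1.
  apply: ler_powR2; [by rewrite invr_ge0 ltW|exact: powR_ge0|].
  by rewrite /S (bigD1 i)//= lerDl; apply: sumr_ge0 => j _; exact: powR_ge0.
have l2S : l2 c <= Num.sqrt #|I|%:R * S `^ q^-1.
  have t0 : 0 <= S `^ q^-1 by exact: powR_ge0.
  rewrite -(@ger0_norm _ (S `^ q^-1))// -sqrtr_sqr -sqrtrM ?ler0n//; apply: ler_wsqrtr.
  rewrite -sum1_card natr_sum mulr_suml; apply: ler_sum => i _.
  by rewrite mul1r -(real_normK (num_real (c i))) lerXn2r ?nnegrE.
apply: (@le_trans _ _ ((Num.sqrt #|I|%:R * S `^ q^-1) `^ q)).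
  by apply: ler_powR2 => //; [exact: ltW|exact: l2_ge0].
by rewrite powRM ?sqrtr_ge0 ?powR_ge0// -powRrM mulVf ?gt_eqF// powRr1.
Qed.
End EuclideanNorm.

Section NormOnDomain.
Context d (T : measurableType d) (R : realType) (mu : {measure set T -> \bar R}).
Variables (D : set T) (mD : measurable D).
Variables (q : R) (q1 : 1 < q).
Local Notation ig f := (mu.-integrable D (EFin \o f)).

Let q0 : 0 < q. Proof. exact: lt_trans ltr01 q1. Qed.

Lemma Lnorm_restrict_lt (s : T -> R) (e : R) : (forall x, 0 <= s x) ->
  ig (fun x => s x `^ q) -> 0 < e ->
  ('N[mu]_q%:E[EFin \o s \_ D] < e%:E)%E = (\int[mu]_(x in D) s x `^ q < e `^ q).
Proof.
move=> s0 hs e0.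
have J0 : 0 <= \int[mu]_(x in D) s x `^ q.
  by apply: Rintegral_ge0 => x _; exact: powR_ge0.
have -> : 'N[mu]_q%:E[EFin \o s \_ D]%E = ((\int[mu]_(x in D) s x `^ q) `^ q^-1)%:E.
  rewrite unlock.
  have -> : (\int[mu]_x (`|(EFin \o s \_ D) x| `^ q))%E = (\int[mu]_(x in D) s x `^ q)%:E.
    rewrite (EFin_Rintegral mD hs) [RHS]integral_mkcond; apply: eq_integral => x _ /=.
    rewrite !patchE; case: ifP => _ /=; first by rewrite ger0_norm.
    by rewrite normr0 powR0// gt_eqF.
  by rewrite poweR_EFin.
rewrite lte_fin -[in RHS](@powRr1 _ (\int[mu]_(x in D) s x `^ q))//.
rewrite -(@mulVf _ q) ?gt_eqF// powRrM; apply/idP/idP => h.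
  by apply: gt0_ltr_powR; rewrite ?nnegrE ?powR_ge0 ?ltW.
rewrite ltNge; apply/negP => h'; move: h; rewrite ltNge => /negP; apply.
by apply: ler_powR2 => //; exact: ltW.
Qed.

Context {I : finType}.
Variables (F : I -> T -> R) (hF : forall i, Lq_on mu D q (F i)).

Lemma measurable_l2 : measurable_fun D (fun x => l2 (F^~ x)).
Proof.
apply: (@measurableT_comp _ _ _ _ _ _ (@Num.sqrt R)) => //.
  by apply: continuous_measurable_fun; exact: sqrt_continuous.
by apply: measurable_sum => i; apply: measurable_funX; case: (hF i).
Qed.

Lemma integrable_l2_powR : ig (fun x => l2 (F^~ x) `^ q).
Proof.
apply: (integrableR_le mD _ (integrableRZ mD (Num.sqrt #|I|%:R `^ q)
  (integrableR_sum mD (index_enum I) (fun i => (hF i).2)))).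
  have := measurable_powR_norm_on q0 measurable_l2.
  by under eq_fun do rewrite ger0_norm ?l2_ge0//.
by move=> x _; rewrite ger0_norm ?powR_ge0//; exact: l2_powR.
Qed.

Lemma Lnorm_l2_component (e : R) i : 0 < e ->
  ('N[mu]_q%:E[EFin \o (fun x => l2 (F^~ x)) \_ D] < e%:E)%E ->
  \int[mu]_(x in D) `|F i x| `^ q < e `^ q.
Proof.
move=> e0; rewrite (Lnorm_restrict_lt (fun x => l2_ge0 (F^~ x)) integrable_l2_powR e0).
apply: le_lt_trans; apply: le_Rintegral => //; first by case: (hF i).
  exact: integrable_l2_powR.
by move=> x _; apply: ler_powR2; [exact: ltW|exact: normr_ge0|exact: (le_l2 (F^~ x))].
Qed.

Lemma Lnorm_l2_lt (e : R) : 0 < e ->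
  Num.sqrt #|I|%:R `^ q * (\int[mu]_(x in D) \sum_i `|F i x| `^ q) < e `^ q ->
  ('N[mu]_q%:E[EFin \o (fun x => l2 (F^~ x)) \_ D] < e%:E)%E.
Proof.
have hs := integrableR_sum mD (index_enum I) (fun i => (hF i).2).
move=> e0; rewrite (Lnorm_restrict_lt (fun x => l2_ge0 (F^~ x)) integrable_l2_powR e0).
apply: le_lt_trans; rewrite -RintegralZl//; apply: le_Rintegral => //.
- exact: integrable_l2_powR.
- exact: (integrableRZ mD _ hs).
- by move=> x _; exact: l2_powR.
Qed.
End NormOnDomain.

Section Components.
Context {R : realType}.
Implicit Types (z : R[i]) (p : biquat R).

Definition cpt (b : bool) z : R := if b then complex.Re z else complex.Im z.
Definition cptH (i : 'I_(1 + 3) * bool) p : R := cpt i.2 (p 0 i.1).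

Lemma normc_l2 z : ComplexField.Normc.normc z = l2 (fun b => cpt b z).
Proof. by case: z => x y; rewrite /l2 big_bool. Qed.

Lemma normq_l2 p : normq p = l2 (fun i => cptH i p).
Proof.
rewrite /normq /l2 innerqE /dotq Re_sum; congr Num.sqrt.
rewrite -(pair_bigA _ (fun j b => cptH (j, b) p ^+ 2))/=; apply: eq_bigr => j _.
by rewrite big_bool /cptH /cpt /= mxE; case: (p 0 j) => x y /=; ring.
Qed.

Lemma cptD b z z' : cpt b (z + z') = cpt b z + cpt b z'.
Proof. by case: b; [exact: ReD|exact: ImD]. Qed.
Lemma cptB b z z' : cpt b (z - z') = cpt b z - cpt b z'.
Proof. by case: b; [rewrite /= ReD ReN|rewrite /= ImD ImN]. Qed.
Lemma cptHD i p p' : cptH i (p + p') = cptH i p + cptH i p'.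
Proof. by rewrite /cptH mxE cptD. Qed.
Lemma cptHB i p p' : cptH i (p - p') = cptH i p - cptH i p'.
Proof. by rewrite /cptH !mxE cptB. Qed.
End Components.

Section LpNorms.
Context {R : realType}.
Variables (G : set (R3 R)) (oG : open G) (q : R) (q1 : 1 < q).
Implicit Types (f g : R3 R -> R[i]) (u v w : R3 R -> biquat R).

Let mG : measurable (G : set (mR3 R)). Proof. exact: open_measurable3. Qed.

Definition LqH u := forall j, LpC G q (fun x => u x 0 j).

Lemma LpH_LqH u : LpH G q%:E u <-> LqH u.
Proof. by split=> h j; apply/(Lp_LpC oG _ q1). Qed.

Lemma LqH_cptH u : LqH u -> forall i, Lq_on vol G q (fun x => cptH i (u x)).
Proof. by move=> hu [j [|]]; case: (hu j). Qed.

Lemma cptH_LqH u : (forall i, Lq_on vol G q (fun x => cptH i (u x))) -> LqH u.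
Proof. by move=> hu j; split; [exact: (hu (j, true))|exact: (hu (j, false))]. Qed.

Lemma LqH_D u v : LqH u -> LqH v -> LqH (fun x => u x + v x).
Proof.
move=> hu hv j; rewrite (_ : (fun x => _) = fun x => u x 0 j + v x 0 j); last first.
  by apply/funext => x; rewrite mxE.
exact: LpC_D.
Qed.

Lemma LqH_B u v : LqH u -> LqH v -> LqH (fun x => u x - v x).
Proof.
move=> hu hv j; rewrite (_ : (fun x => _) = fun x => u x 0 j - v x 0 j); last first.
  by apply/funext => x; rewrite !mxE.
exact: LpC_B.
Qed.

Lemma Lp_norm_energyC f (e : R) : LpC G q f -> 0 < e ->
  (Lp_norm G q%:E f < e%:E)%E -> energyC G q f < 2 * e `^ q.
Proof.
move=> hf e0; rewrite /Lp_norm.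
under [X in EFin \o X \_ _]funext => x do rewrite normc_l2.
pose F b x := cpt b (f x).
have hF b : Lq_on vol G q (F b) by case: b; [exact: hf.1|exact: hf.2].
move=> h; rewrite mulr_natl mulr2n; apply: ltrD.
  exact: (@Lnorm_l2_component _ (mR3 R) R vol G mG q q1 _ F hF e true).
exact: (@Lnorm_l2_component _ (mR3 R) R vol G mG q q1 _ F hF e false).
Qed.

Lemma LpH_norm_energyC u (e : R) j : LqH u -> 0 < e ->
  (LpH_norm G q%:E u < e%:E)%E -> energyC G q (fun x => u x 0 j) < 2 * e `^ q.
Proof.
move=> /LqH_cptH hF e0; rewrite /LpH_norm.
under [X in EFin \o X \_ _]funext => x do rewrite normq_l2.
move=> h; rewrite mulr_natl mulr2n; apply: ltrD.
  exact: (@Lnorm_l2_component _ (mR3 R) R vol G mG q q1 _ (fun i x => cptH i (u x)) hF e (j, true)).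
exact: (@Lnorm_l2_component _ (mR3 R) R vol G mG q q1 _ (fun i x => cptH i (u x)) hF e (j, false)).
Qed.

Lemma LpH_norm_lt (e : R) : 0 < e -> exists2 dl : R, 0 < dl & forall u, LqH u ->
  \int[vol]_(x in G) (\sum_i `|cptH i (u x)| `^ q) < dl -> (LpH_norm G q%:E u < e%:E)%E.
Proof.
move=> e0; set n := #|{: 'I_(1 + 3) * bool}|.
have C0 : 0 < Num.sqrt (n%:R : R) `^ q.
  by rewrite powR_gt0// sqrtr_gt0 ltr0n /n card_prod card_bool card_ord.
exists (e `^ q / Num.sqrt n%:R `^ q); first by rewrite divr_gt0// powR_gt0.
move=> u /LqH_cptH hF; rewrite ltr_pdivlMr// mulrC => h; rewrite /LpH_norm.
under [X in EFin \o X \_ _]funext => x do rewrite normq_l2.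
exact: (@Lnorm_l2_lt _ (mR3 R) R vol G mG q q1 _ (fun i x => cptH i (u x)) hF e).
Qed.

End LpNorms.

(** * Complex-linear maps of biquaternions in coordinates *)

Section BiquaternionCoordinates.
Context {R : realType}.
Implicit Types (p q : biquat R) (c : R[i]).

Definition qlinear (L : biquat R -> biquat R) :=
  (forall p q, L (p + q) = L p + L q) /\ (forall c p, L (c *: p) = c *: L p).

Lemma qlinear_sum L (I : Type) (s : seq I) (F : I -> biquat R) : qlinear L ->
  L (\sum_(i <- s) F i) = \sum_(i <- s) L (F i).
Proof.
move=> [LD LZ]; elim: s => [|i s IH].
  by rewrite !big_nil; have := LZ 0 0; rewrite !scale0r.
by rewrite !big_cons LD IH.
Qed.

(** The coefficients are constants, so every property of the components that is stable under complex
    linear combinations passes through multiplication by a constant and through quaternionic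
    conjugation. *)
Lemma qlinearE L p j : qlinear L ->
  L p 0 j = \sum_i L (delta_mx 0 i) 0 j * p 0 i.
Proof.
move=> lL; rewrite [in LHS](row_sum_delta p) (qlinear_sum _ _ lL) summxE.
by apply: eq_bigr => i _; rewrite lL.2 mxE mulrC.
Qed.

Lemma qlinear_mull a : qlinear (mulq a).
Proof. by split=> *; [exact: mulqDr|exact: mulqZr]. Qed.
Lemma qlinear_mulr a : qlinear (mulq^~ a).
Proof. by split=> *; [exact: mulqDl|exact: mulqZl]. Qed.
Lemma qlinear_conjq : qlinear conjq.
Proof. by split=> *; [exact: conjqD|exact: conjqZ]. Qed.
Lemma qlinearZ c : qlinear ( *:%R c).
Proof. by split=> *; [exact: scalerDr|rewrite !scalerA mulrC]. Qed.

Lemma mulq_bilinearE p q j :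
  mulq p q 0 j = \sum_a \sum_b mulq (delta_mx 0 a) (delta_mx 0 b) 0 j * (p 0 a * q 0 b).
Proof.
rewrite (qlinearE p j (qlinear_mulr q)); apply: eq_bigr => a _.
rewrite (qlinearE q j (qlinear_mull (delta_mx 0 a))) mulr_suml; apply: eq_bigr => b _.
by rewrite -mulrA; congr (_ * _); exact: mulrC.
Qed.

Lemma conjq_eq_ k : conjq (eq_ k) = (-1) *: eq_ k :> biquat R.
Proof. by apply: biquatP; rewrite !compE ?mulN1r// Sc_eq_ oppr0. Qed.

Lemma Sc_VecP p q : Sc p = Sc q -> (forall k, Vec p 0 k = Vec q 0 k) -> p = q.
Proof. by move=> h0 h; apply: biquatP => //; exact: h. Qed.

Lemma Vec_mulr k : exists c : biquat R, forall p, Vec p 0 k = Sc (mulq p c).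
Proof. by exists ((-1) *: eq_ k) => p; rewrite mulqZr ScZ mulN1r Vec_mul_eq_. Qed.

Lemma dotq_delta p c j : dotq p (c *: delta_mx 0 j) = p 0 j * c.
Proof.
rewrite /dotq (bigD1 j)//= big1 ?addr0 => [|i ij]; rewrite !mxE !eqxx/=.
  by rewrite mulr1.
by rewrite (negbTE ij) !mulr0.
Qed.

Lemma dotq_sumr (I : Type) (s : seq I) p (F : I -> biquat R) :
  dotq p (\sum_(i <- s) F i) = \sum_(i <- s) dotq p (F i).
Proof.
elim: s => [|i s IH]; last by rewrite !big_cons dotqDr IH.
by rewrite !big_nil -(scale0r 0) dotqZr mul0r.
Qed.

Lemma dotqBr p q a : dotq a (p - q) = dotq a p - dotq a q.
Proof. by rewrite dotqDr -scaleN1r dotqZr mulN1r. Qed.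
Lemma dotqBl p q a : dotq (p - q) a = dotq p a - dotq q a.
Proof. by rewrite ![dotq _ a]dotqC dotqBr. Qed.

End BiquaternionCoordinates.

(** * The operator D *)

Section Dirac.
Context {R : realType}.
Variables (G : set (R3 R)) (oG : open G).
Implicit Types (u v w phi psi : R3 R -> biquat R).

Let mG : measurable (G : set (mR3 R)). Proof. exact: open_measurable3. Qed.

Definition partialH (k : 'I_3) u x : biquat R := \row_j partialC k (fun y => u y 0 j) x.

Lemma DopE u x : Dop u x = \sum_k mulq (eq_ k) (partialH k u x).
Proof. by []. Qed.

Lemma test_funH_comp L phi : qlinear L -> test_funH G phi -> test_funH G (fun x => L (phi x)).
Proof.
move=> lL tp j; under [X in test_fun _ X]funext => x do rewrite (qlinearE _ _ lL).
by apply: test_fun_sum => i; apply: test_funZ.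
Qed.

Lemma test_funH_D phi psi : test_funH G phi -> test_funH G psi ->
  test_funH G (fun x => phi x + psi x).
Proof.
move=> tp tq j; under [X in test_fun _ X]funext => x do rewrite mxE.
exact: test_funD.
Qed.

Lemma test_funH_sum (I : Type) (s : seq I) (F : I -> R3 R -> biquat R) :
  (forall i, test_funH G (F i)) -> test_funH G (fun x => \sum_(i <- s) F i x).
Proof.
move=> hF j; under [X in test_fun _ X]funext => x do rewrite summxE.
by apply: test_fun_sum => i; exact: hF.
Qed.

Lemma test_funH_partialH k phi : test_funH G phi -> test_funH G (partialH k phi).
Proof.
move=> tp j; under [X in test_fun _ X]funext => x do rewrite mxE.
exact: partial_test.
Qed.

Lemma test_funH_Dop phi : test_funH G phi -> test_funH G (Dop phi).
Proof.
move=> tp; apply: test_funH_sum => k; apply: test_funH_comp (qlinear_mull _) _.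
exact: test_funH_partialH.
Qed.

Lemma test_funH0 : test_funH G (fun=> 0).
Proof. move=> j; under [X in test_fun _ X]funext => x do rewrite mxE; exact: test_fun0. Qed.

Lemma test_funH_delta (f : R3 R -> R[i]) j : test_fun G f ->
  test_funH G (fun x => f x *: delta_mx 0 j).
Proof.
move=> tf i; under [X in test_fun _ X]funext => x do rewrite !mxE mulrC.
exact: test_funZ.
Qed.

Lemma partialH_comp k L phi : qlinear L -> test_funH G phi ->
  partialH k (fun x => L (phi x)) = fun x => L (partialH k phi x).
Proof.
move=> lL tp; apply/funext => x; apply/rowP => j.
rewrite mxE; under [X in partialC k X]funext => y do rewrite (qlinearE _ _ lL).
rewrite (@partialC_sum _ G) => [|i]; last exact: test_funZ.
rewrite (qlinearE _ _ lL); apply: eq_bigr => i _.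
by rewrite (@partialC_Z _ G)// mxE.
Qed.

Lemma Dop_mulr a phi : test_funH G phi ->
  Dop (fun x => mulq (phi x) a) = fun x => mulq (Dop phi x) a.
Proof.
move=> tp; apply/funext => x; rewrite !DopE (qlinear_sum _ _ (qlinear_mulr a)).
by apply: eq_bigr => k _; rewrite (partialH_comp k (qlinear_mulr a))// mulqA.
Qed.

Lemma Dop_Z c phi : test_funH G phi ->
  Dop (fun x => c *: phi x) = fun x => c *: Dop phi x.
Proof.
move=> tp; apply/funext => x; rewrite !DopE scaler_sumr.
by apply: eq_bigr => k _; rewrite (partialH_comp k (qlinearZ c))// mulqZr.
Qed.

Lemma Dop_D phi psi : test_funH G phi -> test_funH G psi ->
  Dop (fun x => phi x + psi x) = fun x => Dop phi x + Dop psi x.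
Proof.
move=> tp tq; apply/funext => x; rewrite !DopE -big_split/=.
apply: eq_bigr => k _; rewrite -mulqDr; congr mulq; apply/rowP => j.
rewrite !mxE; under [X in partialC k X]funext => y do rewrite mxE.
by rewrite (@partialC_D _ G).
Qed.

Lemma pairingE u v : pairing G u v = intC G (fun x => dotq (u x) (v x)).
Proof.
rewrite /pairing ScE mxE; apply: eq_intC => x _; by rewrite -ScE Sc_conj_mulq.
Qed.

Lemma weakD_dotq u v phi : weakD G u v -> test_funH G phi ->
  intC G (fun x => dotq (u x) (Dop phi x)) = intC G (fun x => dotq (v x) (phi x)).
Proof. by move=> [_ _ h] /h /(congr1 (@Sc R)); rewrite -!pairingE. Qed.

(* The vector part is recovered by testing with right multiples of the test
   function, which commute with the left operator D. *)
Lemma dotq_weakD u v : L1locH G u -> L1locH G v ->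
  (forall phi, test_funH G phi ->
    intC G (fun x => dotq (u x) (Dop phi x)) = intC G (fun x => dotq (v x) (phi x))) ->
  weakD G u v.
Proof.
move=> lu lv h; split; [exact: lu|exact: lv|] => phi tp; apply/Sc_VecP => [|k].
  by move: (h _ tp); rewrite -!pairingE.
have [c hc] := @Vec_mulr R k.
have VecI (f : R3 R -> biquat R) :
    Vec (intH G f) 0 k = intC G (fun x => Sc (mulq (f x) c)).
  by rewrite VecE mxE; apply: eq_intC => x _; rewrite -VecE hc.
have e := h _ (test_funH_comp (qlinear_mulr c) tp).
rewrite (Dop_mulr c tp) in e.
apply: (etrans (VecI _)); apply: (etrans _ (esym (VecI _))).
transitivity (intC G (fun x => dotq (u x) (mulq (Dop phi x) c))).
  by apply: eq_intC => x _; rewrite -mulqA Sc_conj_mulq.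
by rewrite e; apply: eq_intC => x _; rewrite -mulqA Sc_conj_mulq.
Qed.

Lemma integrableC_dotq_test u phi : L1locH G u -> test_funH G phi ->
  integrableC G (fun x => dotq (u x) (phi x)).
Proof. by move=> lu tp; apply: integrableC_sum => // j; exact: L1loc_test_mul. Qed.

(** D is its own transpose because two signs cancel: the one from integration by parts and the one
    from the conjugate of e_k being -e_k. *)
Lemma weak_partial_weakD u (g : 'I_3 -> R3 R -> biquat R) :
  let v := fun x => \sum_k mulq (eq_ k) (g k x) in
  L1locH G u -> (forall k, L1locH G (g k)) -> L1locH G v ->
  (forall k j, weak_partial G k (fun x => u x 0 j) (fun x => g k x 0 j)) ->
  weakD G u v.
Proof.
move=> v lu lg lv wp; apply: dotq_weakD => // phi tp.
have tpk k := test_funH_comp (qlinear_mull (eq_ k)) tp.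
have tpp k := test_funH_partialH k (tpk k).
transitivity (\sum_k intC G (fun x => dotq (u x) (partialH k (fun y => mulq (eq_ k) (phi y)) x))).
  rewrite -intC_sum// => [|k]; last exact: integrableC_dotq_test.
  apply: eq_intC => x _; rewrite DopE dotq_sumr; apply: eq_bigr => k _.
  by rewrite (partialH_comp k (qlinear_mull _)).
transitivity (\sum_k - intC G (fun x => dotq (g k x) (mulq (eq_ k) (phi x)))).
  apply: eq_bigr => k _; rewrite /dotq !intC_sum//; last 2 first.
  - by move=> j; exact: L1loc_test_mul (lg k j) (tpk k j).
  - by move=> j; exact: L1loc_test_mul (lu j) (tpp k j).
  rewrite -sumrN; apply: eq_bigr => j _; rewrite -wp; last exact: tpk.
  by apply: eq_intC => x _; rewrite mxE.
have li k : integrableC G (fun x => dotq (g k x) (mulq (eq_ k) (phi x))).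
  exact: integrableC_dotq_test (lg k) (tpk k).
transitivity (\sum_k intC G (fun x => - dotq (g k x) (mulq (eq_ k) (phi x)))).
  by apply: eq_bigr => k _; rewrite intC_N.
rewrite -intC_sum// => [|k]; last exact: integrableC_N.
apply: eq_intC => x _; rewrite [RHS]dotqC dotq_sumr; apply: eq_bigr => k _.
by rewrite [RHS]dotqC dotq_mull conjq_eq_ mulqZl dotqZr mulN1r.
Qed.

Lemma test_L1locH phi : test_funH G phi -> L1locH G phi.
Proof. by move=> tp j; exact: test_L1loc. Qed.

Lemma weakD_test phi : test_funH G phi -> weakD G phi (Dop phi).
Proof.
move=> tp; apply: weak_partial_weakD.
- exact: test_L1locH.
- by move=> k; apply: test_L1locH; exact: test_funH_partialH.
- by apply: test_L1locH; exact: test_funH_Dop.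
- move=> k j; under [X in weak_partial _ _ _ X]funext => x do rewrite mxE.
  exact: weak_partial_test.
Qed.

Lemma test_W0 q (f : R3 R -> R[i]) : 1 < q -> test_fun G f -> W0 G q%:E f.
Proof.
move=> q1 tf; have n0 (g : R3 R -> R[i]) : Lp_norm G q%:E (g \- g) = 0%E.
  rewrite /Lp_norm (_ : EFin \o _ = cst 0%E) ?Lnorm0//.
    by rewrite eqe gt_eqF// (lt_trans ltr01).
  apply/funext => x /=; rewrite patchE; case: ifP => // _.
  by rewrite subrr /= expr0n /= addr0 sqrtr0.
exists (fun k => partialC k f).
  split; first by apply/(Lp_LpC oG _ q1); exact: test_LpC.
  move=> k; split; last exact: weak_partial_test.
  by apply/(Lp_LpC oG _ q1); apply: test_LpC => //; exact: partial_test.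
move=> e e0; exists f => //; rewrite n0 add0e big1 ?lte_fin// => k _; exact: n0.
Qed.

(** An element of [DQ_image] may use any representative of the weak derivative; uniqueness allows
    exchanging it for a convenient one. Tests of the form [f *: delta_mx 0 j] isolate one
    coordinate. *)
Lemma weakD_unique u v v' j : weakD G u v -> weakD G u v' ->
  {ae vol, forall x, G x -> v x 0 j = v' x 0 j}.
Proof.
move=> h h'; have [_ lv _] := h; have [_ lv' _] := h'.
apply: (@ae_vol_impl _ (fun x => G x -> v x 0 j - v' x 0 j = 0)).
  by move=> x hx Gx; apply/eqP; rewrite -subr_eq0; apply/eqP; exact: hx.
apply: (L1loc_test_eq0 oG) => [K cK KG|f tf].
  have mK := compact_measurable3 cK.
  have [a1 a2] := lv j K cK KG; have [b1 b2] := lv' j K cK KG; split.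
  - by apply: eq_integrable (integrableRB mK a1 b1) => // x _ /=; rewrite ReD ReN.
  - by apply: eq_integrable (integrableRB mK a2 b2) => // x _ /=; rewrite ImD ImN.
have tp := test_funH_delta j tf.
have := weakD_dotq h tp; rewrite (weakD_dotq h' tp) => e.
transitivity (intC G (fun x => dotq (v x) (f x *: delta_mx 0 j) - dotq (v' x) (f x *: delta_mx 0 j))).
  by apply: eq_intC => x _; rewrite !dotq_delta mulrBl.
by rewrite intC_B ?e ?subrr//; exact: integrableC_dotq_test.
Qed.

End Dirac.

(** * Weak solutions and best approximation *)

Section VekuaOperator.
Context {R : realType}.
Variables (G : set (R3 R)) (oG : open G).
Implicit Types (u v w a : R3 R -> biquat R) (A B : @coeffs R).

Let mG : measurable (G : set (mR3 R)). Proof. exact: open_measurable3. Qed.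

Lemma Qop_D B u v x : Qop B (fun y => u y + v y) x = Qop B u x + Qop B v x.
Proof.
case: B => [[[b1 b2] b3] b4] /=; rewrite !conjqD !mulqDl !mulqDr.
by rewrite [RHS]addrACA [X in _ = X + _]addrACA [X in _ = X + _ + _]addrACA.
Qed.

Lemma Qop_Z B c u x : Qop B (fun y => c *: u y) x = c *: Qop B u x.
Proof. by case: B => [[[b1 b2] b3] b4] /=; rewrite !conjqZ !mulqZl !mulqZr -!scalerDr. Qed.

Lemma Qop_dotq A w v x : dotq (Qop A w x) (v x) = dotq (w x) (Qop (star_coeffs A) v x).
Proof. by case: A => [[[a1 a2] a3] a4] /=; rewrite dotq_star. Qed.

Definition LooH a := forall j, LooC G (fun x => a x 0 j).

Definition coeffs_LooH B := let: (b1, b2, b3, b4) := B in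
  [/\ LooH b1, LooH b2, LooH b3 & LooH b4].

Lemma coeffs_Loo_LooH B : coeffs_Loo G B -> coeffs_LooH B.
Proof.
case: B => [[[b1 b2] b3] b4] [h1 h2 h3 h4].
by split=> j; apply: (Lp_LooC oG); [exact: h1|exact: h2|exact: h3|exact: h4].
Qed.

Lemma conjq_lshift (p : biquat R) : conjq p 0 (lshift 3 0) = p 0 (lshift 3 0).
Proof. by rewrite -!ScE compE. Qed.
Lemma conjq_rshift (p : biquat R) k : conjq p 0 (rshift 1 k) = - p 0 (rshift 1 k).
Proof. by rewrite -!VecE /conjq Vec_mkq mxE. Qed.

Lemma LooH_conjq a : LooH a -> LooH (conjq \o a).
Proof.
move=> ha j; case: (split_ordP j) => k ->.
  rewrite (_ : (fun x => _) = fun x => a x 0 (lshift 3 0)) //.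
  by apply/funext => x; rewrite (ord1 k) /= conjq_lshift.
rewrite (_ : (fun x => _) = fun x => - a x 0 (rshift 1 k)).
  by apply: LooC_N; exact: ha.
by apply/funext => x; rewrite /= conjq_rshift.
Qed.

Lemma LooH_cconjq a : LooH a -> LooH (cconjq \o a).
Proof.
move=> ha j; under [X in LooC _ X]funext => x do rewrite /= mxE.
by apply: LooC_conj; exact: ha.
Qed.

Lemma star_LooH B : coeffs_LooH B -> coeffs_LooH (star_coeffs B).
Proof.
case: B => [[[b1 b2] b3] b4] [h1 h2 h3 h4].
by split => //; exact: LooH_conjq.
Qed.

Definition cconj_coeffs B : @coeffs R := let: (b1, b2, b3, b4) := B in
  (cconjq \o b1, cconjq \o b2, cconjq \o b3, cconjq \o b4).

Lemma cconj_LooH B : coeffs_LooH B -> coeffs_LooH (cconj_coeffs B).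
Proof. by case: B => [[[b1 b2] b3] b4] [h1 h2 h3 h4]; split; exact: LooH_cconjq. Qed.

Variables (q : R) (q1 : 1 < q).

Lemma LqH_comp L u : qlinear L -> LqH G q u -> LqH G q (fun x => L (u x)).
Proof.
move=> lL hu j; under [X in LpC _ _ X]funext => x do rewrite (qlinearE _ _ lL).
by apply: LpC_sum => // i; apply: LpC_Z.
Qed.

Lemma LqH_sum (I : Type) (s : seq I) (F : I -> R3 R -> biquat R) :
  (forall i, LqH G q (F i)) -> LqH G q (fun x => \sum_(i <- s) F i x).
Proof.
move=> hF j; under [X in LpC _ _ X]funext => x do rewrite summxE.
by apply: LpC_sum => // i; exact: hF.
Qed.

Lemma LqH_Loo_mull a u : LooH a -> LqH G q u -> LqH G q (fun x => mulq (a x) (u x)).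
Proof.
move=> ha hu j; under [X in LpC _ _ X]funext => x do rewrite mulq_bilinearE.
apply: LpC_sum => // i; apply: LpC_sum => // l; apply: LpC_Z => //.
exact: LpC_Loo_mul.
Qed.

Lemma LqH_Loo_mulr a u : LooH a -> LqH G q u -> LqH G q (fun x => mulq (u x) (a x)).
Proof.
move=> ha hu j; under [X in LpC _ _ X]funext => x do rewrite mulq_bilinearE.
apply: LpC_sum => // i; apply: LpC_sum => // l; apply: LpC_Z => //.
under [X in LpC _ _ X]funext => x do rewrite mulrC.
exact: LpC_Loo_mul.
Qed.

Lemma LqH_Qop B u : coeffs_LooH B -> LqH G q u -> LqH G q (Qop B u).
Proof.
case: B => [[[b1 b2] b3] b4] [h1 h2 h3 h4] hu; have hc := LqH_comp qlinear_conjq hu.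
change (LqH G q (fun x => mulq (u x) (b1 x) + mulq (conjq (u x)) (b2 x)
  + mulq (b3 x) (u x) + mulq (b4 x) (conjq (u x)))).
apply: (LqH_D oG q1 (LqH_D oG q1 (LqH_D oG q1 (LqH_Loo_mulr h1 hu) (LqH_Loo_mulr h2 hc))
  (LqH_Loo_mull h3 hu)) (LqH_Loo_mull h4 hc)).
Qed.

Lemma LqH_test phi : test_funH G phi -> LqH G q phi.
Proof. by move=> tp j; exact: test_LpC. Qed.

Lemma LqH_L1locH u : LqH G q u -> L1locH G u.
Proof. by move=> hu j; exact: (LpC_L1loc oG q1 (hu j)). Qed.

Lemma integrableC_dotq u v : LqH G q u -> LqH G (q / (q - 1)) v ->
  integrableC G (fun x => dotq (u x) (v x)).
Proof. by move=> hu hv; apply: integrableC_sum => // j; exact: (integrableC_mul oG q1). Qed.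

End VekuaOperator.

(** * The least-energy residual and its Euler-Lagrange equation *)

Section NearestPoint.
Context {R : realType}.
Variables (G : set (R3 R)) (oG : open G).
Variables (q : R) (q1 : 1 < q).
Implicit Types (u v w h f : R3 R -> biquat R) (A B : @coeffs R).

Let mG : measurable (G : set (mR3 R)). Proof. exact: open_measurable3. Qed.
Let q0 : 0 < q. Proof. exact: lt_trans ltr01 q1. Qed.

(* Up to the factor [q], the real part of the pairing with [sgH h] is the
   derivative at [h] of [energyH]. *)
Definition sgH h x : biquat R :=
  \row_j Complex (spowR q (complex.Re (h x 0 j))) (- spowR q (complex.Im (h x 0 j))).

Definition energyH u := \int[vol]_(x in G) \sum_i `|cptH i (u x)| `^ q.

Lemma Re_dotq_sgH h x (m : biquat R) :
  complex.Re (dotq (sgH h x) m) = \sum_i spowR q (cptH i (h x)) * cptH i m.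
Proof.
rewrite /dotq Re_sum -(pair_bigA _ (fun j b => spowR q (cptH (j, b) (h x)) * cptH (j, b) m))/=.
apply: eq_bigr => j _; rewrite big_bool /cptH /= mxE ReM /=; ring.
Qed.

Lemma LqH_sgH h : LqH G q h -> LqH G (q / (q - 1)) (sgH h).
Proof.
move=> hh j; have [h1 h2] := hh j; have p1 : 1 < q / (q - 1).
  by rewrite ltr_pdivlMr ?subr_gt0// mul1r ltrBlDr ltrDl.
split.
- under [X in Lq_on _ _ _ X]funext => x do rewrite mxE /=.
  exact: Lq_on_spowR.
- under [X in Lq_on _ _ _ X]funext => x do rewrite mxE /=.
  by apply: Lq_onN => //; exact: Lq_on_spowR.
Qed.

Lemma integrable_energyH u : LqH G q u ->
  vol.-integrable (G : set (mR3 R)) (EFin \o (fun x => \sum_i `|cptH i (u x)| `^ q)).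
Proof. by move=> /LqH_cptH hu; apply: (integrableR_sum mG) => i; case: (hu i). Qed.

Lemma energyH_D u v : LqH G q u -> LqH G q v ->
  energyH (fun x => u x + v x) <= 2 `^ q * (energyH u + energyH v).
Proof.
move=> hu hv; have iu := integrable_energyH hu; have iv := integrable_energyH hv.
rewrite /energyH -RintegralD// -RintegralZl//; last exact: integrableRD.
apply: le_Rintegral => //.
- by apply: integrable_energyH; exact: LqH_D.
- by apply: (integrableRZ mG); exact: (integrableRD mG).
move=> x _; rewrite -big_split mulr_sumr; apply: ler_sum => i _.
by rewrite cptHD; exact: powR_normD.
Qed.

Lemma cptH_realZ i (c : R) (p : biquat R) : cptH i (Complex c 0 *: p) = c * cptH i p.
Proof.
rewrite /cptH mxE; case: i => j [] /=; rewrite ?ReM ?ImM /=; ring.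
Qed.

Section Residual.
Variables (B : @coeffs R) (hB : coeffs_LooH G B).

Definition DQ phi x : biquat R := Dop phi x - Qop B phi x.

Lemma LqH_DQ phi : test_funH G phi -> LqH G q (DQ phi).
Proof.
move=> tp; apply: LqH_B => //.
  by apply: LqH_test => //; exact: test_funH_Dop.
by apply: LqH_Qop => //; exact: LqH_test.
Qed.

Lemma DQ_D phi psi : test_funH G phi -> test_funH G psi ->
  DQ (fun y => phi y + psi y) = fun x => DQ phi x + DQ psi x.
Proof.
by move=> tp tq; apply/funext => x; rewrite /DQ (Dop_D tp tq) Qop_D opprD addrACA.
Qed.

Lemma DQ_Z c phi : test_funH G phi -> DQ (fun y => c *: phi y) = fun x => c *: DQ phi x.
Proof. by move=> tp; apply/funext => x; rewrite /DQ (Dop_Z c tp) Qop_Z scalerBr. Qed.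

Lemma DQ_nearest_point f : LqH G q f ->
  exists h, [/\ LqH G q h,
    forall phi, test_funH G phi -> intC G (fun x => dotq (sgH h x) (DQ phi x)) = 0 &
    forall e : R, 0 < e -> exists2 phi, test_funH G phi &
      energyH (fun x => f x - DQ phi x - h x) < e].
Proof.
move=> hf; pose I : finType := ('I_(1 + 3) * bool)%type.
(* The eight real components, extended by 0 outside G: the abstract nearest-point theorem concerns
   real families on the whole space. *)
pose res u : I -> mR3 R -> R := fun i => (fun x => cptH i (u x)) \_ G.
have resE u i x : res u i x = if x \in G then cptH i (u x) else 0 by rewrite /res patchE.
have resD u v i x : res (fun y => u y + v y) i x = res u i x + res v i x.
  by rewrite !resE; case: ifP => _; [exact: cptHD|rewrite addr0].
have resZ (c : R) u i x : res (fun y => Complex c 0 *: u y) i x = c * res u i x.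
  by rewrite !resE; case: ifP => _; [exact: cptH_realZ|rewrite mulr0].
have LqI_res u : LqH G q u -> LqI vol q (res u).
  by move=> /LqH_cptH hu i; apply/(Lq_restrict vol mG _ q0); exact: hu.
pose M := [set m | exists2 phi, test_funH G phi & m = res (DQ phi)].
have MLq : M `<=` @LqI _ _ _ vol q I by move=> _ [phi tp ->]; apply: LqI_res; exact: LqH_DQ.
have MD m m' : M m -> M m' -> M (fun i x => m i x + m' i x).
  move=> [phi tp ->] [psi tq ->]; exists (fun x => phi x + psi x); first exact: test_funH_D.
  by rewrite (DQ_D tp tq); apply/funext => i; apply/funext => x; exact/esym/resD.
have MZ (c : R) m : M m -> M (fun i x => c * m i x).
  move=> [phi tp ->]; exists (fun x => Complex c 0 *: phi x).
    exact: (test_funH_comp (qlinearZ _) tp).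
  by rewrite (DQ_Z _ tp); apply/funext => i; apply/funext => x; exact/esym/resZ.
have M0 : M (fun _ _ => 0).
  have t0 := @test_funH0 R G; have := MZ 0 (res (DQ (fun=> 0))) (ex_intro2 _ _ _ t0 erefl).
  by congr M; apply/funext => i; apply/funext => x; rewrite mul0r.
have [H [hH orth near]] := Lq_nearest_point q1 (LqI_res _ hf) MLq M0 MD MZ.
pose h x : biquat R := \row_j Complex (H (j, true) x) (H (j, false) x).
have hE i x : cptH i (h x) = H i x by case: i => j []; rewrite /cptH /= mxE.
have hh : LqH G q h.
  apply: cptH_LqH => i; rewrite (_ : (fun x => _) = H i); last by apply/funext => x; rewrite hE.
  have [m1 i1] := hH i; split; first exact: measurable_funTS.
  exact: (integrableS measurableT mG).
have Re0 phi : test_funH G phi -> complex.Re (intC G (fun x => dotq (sgH h x) (DQ phi x))) = 0.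
  move=> tp /=; rewrite -[RHS](orth _ (ex_intro2 _ _ _ tp erefl)) [LHS]Rintegral_mkcond.
  apply: eq_Rintegral => x _; rewrite patchE; case: ifPn => xG.
    by rewrite Re_dotq_sgH; apply: eq_bigr => i _; rewrite hE resE xG.
  by rewrite big1// => i _; rewrite resE (negbTE xG) mulr0.
exists h; split; first exact: hh.
- move=> phi tp; apply: complexP; first exact: Re0.
  (* The variation yields real parts only. The test functions form a complex space and [DQ] is
     complex-linear on them, so testing with -i phi turns the imaginary part into a real one. *)
  have tip := test_funH_comp (qlinearZ (Complex 0 (-1))) tp.
  rewrite -[RHS](Re0 _ tip) (DQ_Z _ tp) /=; apply: eq_Rintegral => x _.
  by rewrite dotqZr ReM /=; ring.
- move=> e e0; have [_ [phi tp ->] hm] := near e e0; exists phi; first exact: tp.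
  apply: le_lt_trans hm; rewrite /energyH Rintegral_mkcond.
  have hd := LqI_B q1 (LqI_B q1 (LqI_res _ hf) (LqI_res _ (LqH_DQ tp))) hH.
  apply: le_Rintegral => //.
  + apply/(integrable_restrict vol mG); apply: integrable_energyH.
    by apply: LqH_B => //; apply: LqH_B => //; exact: LqH_DQ.
  + exact: integrable_sum_powR hd.
  + move=> x _; rewrite patchE; case: ifPn => xG; last exact: sum_powR_ge0.
    by rewrite /sum_powR; apply: ler_sum => i _; rewrite 2!cptHB 2!resE xG hE.
Qed.

End Residual.

(* The residual of the best approximation of [f] by the range of [D - Q_{A*}]
   is turned by the duality map [sgH] into a weak solution of [D w = Q_A w]. *)
Lemma Vekua_nearest_point A f : coeffs_LooH G A -> LqH G q f ->
  exists h, [/\ LqH G q h, Vekua G (q / (q - 1))%:E A (sgH h) &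
    forall e : R, 0 < e -> exists m, [/\ DQ_image G q%:E (star_coeffs A) m, LqH G q m &
      energyH (fun x => f x - m x - h x) < e]].
Proof.
move=> hA hf; have hB := star_LooH hA.
have p1 : 1 < q / (q - 1) by rewrite ltr_pdivlMr ?subr_gt0// mul1r ltrBlDr ltrDl.
have [h [hh orth near]] := DQ_nearest_point hB hf; exists h; split; first exact: hh.
- have hw := LqH_sgH hh; split; first exact/(LpH_LqH oG p1).
  have lw := LqH_L1locH oG p1 hw; have lQ := LqH_L1locH oG p1 (LqH_Qop oG p1 hA hw).
  apply: (dotq_weakD lw lQ) => phi tp.
  apply/eqP; rewrite -subr_eq0 -intC_B//; last 2 first.
  - exact: (integrableC_dotq_test oG lw (test_funH_Dop tp)).
  - exact: (integrableC_dotq_test oG lQ tp).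
  rewrite -[X in _ == X](orth _ tp); apply/eqP; apply: eq_intC => x _.
  by rewrite /DQ dotqBr Qop_dotq.
- move=> e e0; have [phi tp hp] := near e e0; exists (DQ (star_coeffs A) phi); split.
  + exists phi, (Dop phi); split; [by move=> j; exact: test_W0|exact: weakD_test|by []].
  + exact: LqH_DQ.
  + exact: hp.
Qed.

End NearestPoint.

(** * Continuity of the pairing, orthogonality and the closure identity *)

Section Orthogonality.
Context {R : realType}.
Variables (G : set (R3 R)) (oG : open G).
Variables (q : R) (q1 : 1 < q).
Implicit Types (u v w h f m : R3 R -> biquat R) (A B : @coeffs R).

Let mG : measurable (G : set (mR3 R)). Proof. exact: open_measurable3. Qed.
Let q0 : 0 < q. Proof. exact: lt_trans ltr01 q1. Qed.
Local Notation p := (q / (q - 1)).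

Lemma conj_exponent_gt1 : 1 < p.
Proof. by rewrite ltr_pdivlMr ?subr_gt0// mul1r ltrBlDr ltrDl. Qed.

Lemma ler_norm_cptD b (x y : R[i]) : `|cpt b (x + y)| <= `|cpt b x| + `|cpt b y|.
Proof. by rewrite cptD; exact: ler_normD. Qed.

Lemma powR_root_small (d c : R) : 0 < d -> 0 < c -> exists2 e : R, 0 < e & c * e `^ q = d.
Proof.
move=> d0 c0; exists ((d / c) `^ q^-1); first by rewrite powR_gt0// divr_gt0.
rewrite -powRrM mulVf ?gt_eqF// powRr1 ?ltW ?divr_gt0//.
by rewrite mulrC mulfVK// gt_eqF.
Qed.

Lemma intC_mul_cpt_small (b : R3 R -> R[i]) (e : R) : LpC G p b -> 0 < e ->
  exists2 dl : R, 0 < dl & forall a, LpC G q a -> energyC G q a < dl ->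
    forall c, `|cpt c (intC G (fun x => a x * b x))| < e.
Proof.
move=> hb e0; have [dl dl0 h] := intC_mul_small oG q1 hb e0.
by exists dl => // a ha /(h _ ha)[h1 h2] [|].
Qed.

Lemma energyC_le_energyH u j : LqH G q u -> energyC G q (fun x => u x 0 j) <= energyH G q u.
Proof.
move=> hu; have hj i : vol.-integrable (G : set (mR3 R)) (EFin \o (fun x => `|cptH i (u x)| `^ q)).
  by have [] := LqH_cptH hu i.
rewrite /energyC -RintegralD; [|exact: mG|exact: (hj (j, true))|exact: (hj (j, false))].
apply: le_Rintegral => //.
- exact: (integrableRD mG (hj (j, true)) (hj (j, false))).
- exact: integrable_energyH.
move=> x _; rewrite -(pair_bigA _ (fun k b => `|cptH (k, b) (u x)| `^ q))/=.
rewrite (bigD1 j)//= big_bool lerDl; apply: sumr_ge0 => k _.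
by apply: sumr_ge0 => b _; exact: powR_ge0.
Qed.

Lemma intC_dotq_small w (e : R) : LqH G p w -> 0 < e ->
  exists2 dl : R, 0 < dl & forall u, LqH G q u -> energyH G q u < dl ->
    forall c, `|cpt c (intC G (fun x => dotq (u x) (w x)))| < e.
Proof.
move=> hw e0; have e4 : 0 < e / 4 by rewrite divr_gt0.
have /choice[d hd] j : exists dl : R, 0 < dl /\ forall a, LpC G q a -> energyC G q a < dl ->
    forall c, `|cpt c (intC G (fun x => a x * w x 0 j))| < e / 4.
  by have [dl d0 h] := intC_mul_cpt_small (hw j) e4; exists dl.
exists (\big[Num.min/1]_j d j).
  by apply: lt_bigmin => // j _; case: (hd j).
move=> u hu su c; rewrite intC_sum//; last first.
  by move=> j; exact: (integrableC_mul oG q1).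
have hj j : `|cpt c (intC G (fun x => u x 0 j * w x 0 j))| < e / 4.
  apply: (hd j).2; first exact: hu.
  apply: (le_lt_trans (energyC_le_energyH _ hu)); apply: (lt_le_trans su).
  exact: bigmin_le_cond.
rewrite sum_biquat; apply: (le_lt_trans (ler_norm_cptD _ _ _)).
rewrite (_ : e = e / 4 + e / 4 + e / 4 + e / 4); last by field.
apply: ltrD => //; apply: (le_lt_trans (ler_norm_cptD _ _ _)).
apply: ltrD => //; apply: (le_lt_trans (ler_norm_cptD _ _ _)).
exact: ltrD.
Qed.

Lemma LpH_norm_energyH_small (dl : R) : 0 < dl -> exists2 e : R, 0 < e &
  forall u, LqH G q u -> (LpH_norm G q%:E u < e%:E)%E -> energyH G q u < dl.
Proof.
move=> dl0; have c0 : (0 : R) < 8 by rewrite ltr0n.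
have [e e0 he] := powR_root_small dl0 c0; exists e => // u hu su.
have hj j := LpH_norm_energyC oG q1 j hu e0 su.
suff -> : energyH G q u = \sum_j energyC G q (fun x => u x 0 j).
  rewrite -he sum_biquat (_ : 8 * e `^ q = 2 * e `^ q + 2 * e `^ q + 2 * e `^ q + 2 * e `^ q); last by ring.
  by do 3 (apply: ltrD; last exact: hj); exact: hj.
rewrite /energyH Rintegral_sum//; last by move=> i; have [] := LqH_cptH hu i.
rewrite -(pair_bigA _ (fun k b => \int[vol]_(x in G) (`|cptH (k, b) (u x)| `^ q)))/=.
by apply: eq_bigr => j _; rewrite big_bool.
Qed.

Lemma ae_eq_intC (f g : R3 R -> R[i]) : integrableC G f -> integrableC G g ->
  {ae vol, forall x, G x -> f x = g x} -> intC G f = intC G g.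
Proof.
move=> [f1 f2] [g1 g2] fg; apply: complexP => /=.
- apply: (Rintegral_ae_eq mG (integrable_measurable f1) (integrable_measurable g1)).
  by apply: ae_vol_impl fg => x h Gx; rewrite h.
- apply: (Rintegral_ae_eq mG (integrable_measurable f2) (integrable_measurable g2)).
  by apply: ae_vol_impl fg => x h Gx; rewrite h.
Qed.

Lemma lee_norm_sum3 (x0 : \bar R) (x : 'I_3 -> \bar R) (e : \bar R) :
  (0 <= x0)%E -> (forall k, 0 <= x k)%E -> (x0 + \sum_k x k < e)%E ->
  (x0 < e)%E /\ forall k, (x k < e)%E.
Proof.
move=> h0 hx h; split.
  by apply: le_lt_trans h; rewrite leeDl// sume_ge0.
move=> k; apply: le_lt_trans h; apply: (@le_trans _ _ (\sum_k x k)%E).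
  by rewrite (bigD1 k)//= leeDl// sume_ge0.
by rewrite leeDr.
Qed.

(** A linear functional on W^{1,q} given by coefficients for the function and for each partial
    derivative; with coefficients in the dual exponent it is continuous. *)
Definition W0form (b0 : R3 R -> R[i]) (b : 'I_3 -> R3 R -> R[i]) (f0 : R3 R -> R[i]) (g : 'I_3 -> R3 R -> R[i]) : R[i] :=
  intC G (fun x => f0 x * b0 x) + \sum_k intC G (fun x => g k x * b k x).

(** Each of the four integrals of the form (the function and its three derivatives) receives a
    quarter of the tolerance. *)
Lemma W0form_approx (f0 : R3 R -> R[i]) g b0 b (e : R) :
  LpC G q f0 -> (forall k, LpC G q (g k)) -> LpC G p b0 -> (forall k, LpC G p (b k)) ->
  (forall e : R, 0 < e -> exists2 phi, test_fun G phi &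
    (Lp_norm G q%:E (f0 \- phi)%R +
       \sum_(k < 3) Lp_norm G q%:E (g k \- partialC k phi)%R < e%:E)%E) ->
  0 < e -> exists2 phi, test_fun G phi & forall c,
    `|cpt c (W0form b0 b f0 g - W0form b0 b phi (fun k => partialC k phi))| < e.
Proof.
move=> hf hg hb0 hb app e0; have e4 : 0 < e / 4 by rewrite divr_gt0.
have [d0 d00 h0] := intC_mul_cpt_small hb0 e4.
have /choice[d hd] k : exists dl : R, 0 < dl /\ forall a, LpC G q a -> energyC G q a < dl ->
    forall c, `|cpt c (intC G (fun x => a x * b k x))| < e / 4.
  by have [dl dl0 h] := intC_mul_cpt_small (hb k) e4; exists dl.
have dl0 : 0 < \big[Num.min/d0]_k d k by apply: lt_bigmin => // k _; case: (hd k).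
have c0 : (0 : R) < 2 by rewrite ltr0n.
have [e1 e10 he1] := powR_root_small dl0 c0.
have [phi tp] := app _ e10; have tpk k := partial_test k tp.
have lp := test_LpC oG q1 tp; have lpk k := test_LpC oG q1 (tpk k).
have n0 (h : R3 R -> R[i]) : (0 <= Lp_norm G q%:E h)%E by exact: Lnorm_ge0.
move=> /(lee_norm_sum3 (n0 _) (fun k => n0 _))[s0 sk]; exists phi => // c.
have D0 := LpC_B oG q1 hf lp; have Dk k := LpC_B oG q1 (hg k) (lpk k).
have k0 := h0 _ D0 (lt_le_trans (Lp_norm_energyC oG q1 D0 e10 s0) _) c.
have {k0}k0 : `|cpt c (intC G (fun x => (f0 x - phi x) * b0 x))| < e / 4.
  by apply: k0; rewrite he1; exact: bigmin_le_id.
have kk k : `|cpt c (intC G (fun x => (g k x - partialC k phi x) * b k x))| < e / 4.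
  apply: (hd k).2; first exact: Dk.
  apply: lt_le_trans (Lp_norm_energyC oG q1 (Dk k) e10 (sk k)) _.
  by rewrite he1; exact: bigmin_le_cond.
have -> : W0form b0 b f0 g - W0form b0 b phi (fun k => partialC k phi) =
    intC G (fun x => (f0 x - phi x) * b0 x) +
    \sum_k intC G (fun x => (g k x - partialC k phi x) * b k x).
  rewrite /W0form opprD addrACA -sumrB; congr (_ + _).
    rewrite -intC_B//; [|exact: (integrableC_mul oG q1)..].
    by apply: eq_intC => x _; rewrite mulrBl.
  apply: eq_bigr => k _; rewrite -intC_B//; [|exact: (integrableC_mul oG q1)..].
  by apply: eq_intC => x _; rewrite mulrBl.
rewrite sum_I3 !addrA; apply: (le_lt_trans (ler_norm_cptD _ _ _)).
rewrite (_ : e = e / 4 + e / 4 + e / 4 + e / 4); last by field.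
apply: ltrD => //; apply: (le_lt_trans (ler_norm_cptD _ _ _)).
apply: ltrD => //; apply: (le_lt_trans (ler_norm_cptD _ _ _)).
exact: ltrD.
Qed.

Variables (A : @coeffs R) (hA : coeffs_LooH G A).

(** Transposing Q and the e_k onto [w] makes the pairing a sum of functionals [W0form], one for each
    component of u. Membership in W_0 is componentwise, so the components can then be approximated
    independently. *)
Lemma intC_dotq_W0form u (g : 'I_3 -> R3 R -> biquat R) w :
  LqH G q u -> (forall k, LqH G q (g k)) -> LqH G p w ->
  intC G (fun x => dotq (\sum_k mulq (eq_ k) (g k x) - Qop (star_coeffs A) u x) (w x)) =
  \sum_j W0form (fun x => (- Qop A w x) 0 j) (fun k x => mulq (conjq (eq_ k)) (w x) 0 j)
    (fun x => u x 0 j) (fun k x => g k x 0 j).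
Proof.
move=> hu hg hw; have p1 := conj_exponent_gt1.
have hQ : LqH G p (fun x => - Qop A w x).
  have := LqH_comp oG p1 (qlinearZ (-1)) (LqH_Qop oG p1 hA hw).
  by under [X in LqH _ _ X -> _]funext => x do rewrite scaleN1r.
have he k : LqH G p (fun x => mulq (conjq (eq_ k)) (w x)).
  exact: (LqH_comp oG p1 (qlinear_mull _) hw).
rewrite /W0form big_split/= exchange_big/=.
have E v v' : LqH G q v -> LqH G p v' ->
    \sum_j intC G (fun x => v x 0 j * v' x 0 j) = intC G (fun x => dotq (v x) (v' x)).
  by move=> hv hv'; rewrite -intC_sum// => j; exact: (integrableC_mul oG q1).
rewrite (E _ _ hu hQ) (eq_bigr _ (fun k _ => E _ _ (hg k) (he k))).
have ik k : integrableC G (fun x => dotq (g k x) (mulq (conjq (eq_ k)) (w x))).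
  exact: (integrableC_dotq oG q1 (hg k) (he k)).
rewrite -(intC_sum oG _ ik) -(intC_D oG); last 2 first.
- exact: (integrableC_dotq oG q1 hu hQ).
- exact: (integrableC_sum oG).
apply: eq_intC => x _; rewrite dotqBl [RHS]addrC; congr (_ + _).
  rewrite dotqC dotq_sumr; apply: eq_bigr => k _; by rewrite dotqC dotq_mull.
by rewrite -[- Qop A w x]scaleN1r dotqZr mulN1r; congr (- _); rewrite dotqC -Qop_dotq dotqC.
Qed.

(** For test functions the pairing vanishes by the weak equation for [w]. As a functional of u and
    its weak gradient the pairing is continuous on W^{1,q}, so it also vanishes on the closure
    W_0^{1,q}. *)
Lemma DQ_image_orthogonal m : DQ_image G q%:E (star_coeffs A) m ->
  LqH G q m /\ forall w, Vekua G p%:E A w -> pairing G m w = 0.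
Proof.
move=> [u [v [hu wv ->]]]; have p1 := conj_exponent_gt1.
have /choice[g hg] j : exists g : 'I_3 -> R3 R -> R[i],
    sobolev1 G q%:E (fun x => u x 0 j) g /\
    forall e : R, 0 < e -> exists2 phi, test_fun G phi &
      (Lp_norm G q%:E ((fun x => u x 0 j) \- phi)%R +
       \sum_(k < 3) Lp_norm G q%:E (g k \- partialC k phi)%R < e%:E)%E.
  by have [g h1 h2] := hu j; exists g.
have lu : LqH G q u by move=> j; apply/(Lp_LpC oG _ q1); case: (hg j) => -[].
pose gr k x : biquat R := \row_j g j k x.
have grE k j : (fun x => gr k x 0 j) = g j k by apply/funext => x; rewrite mxE.
have lg k : LqH G q (gr k).
  by move=> j; rewrite grE; apply/(Lp_LpC oG _ q1); case: (hg j) => -[_ /(_ k)[]].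
(* The representative of the weak derivative built from the weak gradient; it lies in L^q, and by
   uniqueness so does the given [v]. *)
pose v' x := \sum_k mulq (eq_ k) (gr k x).
have lv' : LqH G q v'.
  by apply: (LqH_sum oG q1) => k; exact: (LqH_comp oG q1 (qlinear_mull _)).
have wv' : weakD G u v'.
  apply: (weak_partial_weakD oG).
  - exact: (LqH_L1locH oG q1).
  - by move=> k; exact: (LqH_L1locH oG q1).
  - exact: (LqH_L1locH oG q1).
  - by move=> k j; rewrite grE; case: (hg j) => -[_ /(_ k)[]].
have vv' j := weakD_unique oG j wv wv'.
have lv : LqH G q v.
  have [_ l1v _] := wv; move=> j; have [h1 h2] := lv' j; split.
  - apply: (Lq_on_ae_eq mG q0 h1).
      by apply: (loc_integrable_measurable oG) => K cK KG; case: (l1v j K cK KG).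
    by apply: ae_vol_impl (vv' j) => x h Gx; rewrite h.
  - apply: (Lq_on_ae_eq mG q0 h2).
      by apply: (loc_integrable_measurable oG) => K cK KG; case: (l1v j K cK KG).
    by apply: ae_vol_impl (vv' j) => x h Gx; rewrite h.
have lQ := LqH_Qop oG q1 (star_LooH hA) lu.
have lm : LqH G q (v \- Qop (star_coeffs A) u) by exact: (LqH_B oG q1 lv lQ).
split; first exact: lm.
move=> w [/(LpH_LqH oG p1) lw ww]; rewrite pairingE.
pose b0 j x := (- Qop A w x) 0 j; pose b j k x := mulq (conjq (eq_ k)) (w x) 0 j.
have hb0 j : LpC G p (b0 j).
  rewrite /b0; under [X in LpC _ _ X]funext => x do rewrite mxE -mulN1r.
  by apply: (LpC_Z oG) => //; exact: (LqH_Qop oG p1 hA lw).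
have hb j k : LpC G p (b j k) by exact: (LqH_comp oG p1 (qlinear_mull _) lw).
have form_test phi : test_funH G phi ->
    \sum_j W0form (b0 j) (b j) (fun x => phi x 0 j) (fun k x => partialH k phi x 0 j) = 0.
  move=> tp; rewrite -(intC_dotq_W0form (LqH_test oG q1 tp) _ lw); last first.
    by move=> k; apply: (LqH_test oG q1); exact: test_funH_partialH.
  have lw1 := LqH_L1locH oG p1 lw.
  have lQw1 := LqH_L1locH oG p1 (LqH_Qop oG p1 hA lw).
  apply: (@etrans _ _ (intC G (fun x => dotq (w x) (Dop phi x) - dotq (Qop A w x) (phi x)))).
    by apply: eq_intC => x _; rewrite dotqC dotqBr -Qop_dotq.
  rewrite (intC_B oG); last 2 first.
  - exact: (integrableC_dotq_test oG lw1 (test_funH_Dop tp)).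
  - exact: (integrableC_dotq_test oG lQw1 tp).
  by rewrite (weakD_dotq ww tp) subrr.
set T := \sum_j W0form (b0 j) (b j) (fun x => u x 0 j) (fun k x => gr k x 0 j).
have -> : intC G (fun x => dotq ((v \- Qop (star_coeffs A) u) x) (w x)) = T.
  rewrite /T -(intC_dotq_W0form lu lg lw).
  have lm' : LqH G q (fun x => v' x - Qop (star_coeffs A) u x) by exact: (LqH_B oG q1 lv' lQ).
  rewrite /dotq (intC_sum oG); last by move=> j; exact: (integrableC_mul oG q1).
  rewrite (intC_sum oG); last first.
    by move=> j; exact: (integrableC_mul oG q1 (lm' j) (lw j)).
  apply: eq_bigr => j _; apply: ae_eq_intC.
  - exact: (integrableC_mul oG q1).
  - exact: (integrableC_mul oG q1 (lm' j) (lw j)).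
  - by apply: ae_vol_impl (vv' j) => x h Gx; rewrite !mxE h // !mxE.
suff T0 c : cpt c T = 0 by apply: complexP; [exact: (T0 true)|exact: (T0 false)].
(* Were a part of T nonzero, approximating each of the four components within a quarter of its
   modulus would make that modulus smaller than itself, since the form vanishes on the assembled
   test function. *)
apply/eqP/negPn/negP => Tn; have e0 : 0 < `|cpt c T| / 4 by rewrite divr_gt0// normr_gt0.
have /choice[ph hph] j : exists f : R3 R -> R[i], test_fun G f /\ `|cpt c
    (W0form (b0 j) (b j) (fun x => u x 0 j) (fun k x => gr k x 0 j)
     - W0form (b0 j) (b j) f (fun k => partialC k f))| < `|cpt c T| / 4.
  have [_ app] := hg j; have lgj k : LpC G q (g j k) by rewrite -grE; exact: lg.
  have [f tf hf] := W0form_approx (lu j) lgj (hb0 j) (hb j) app e0; exists f; split => //.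
  rewrite (_ : (fun k x => gr k x 0 j) = g j); first exact: hf.
  by apply/funext => k; exact: grE.
pose phi x : biquat R := \row_j ph j x.
have phE j : (fun x => phi x 0 j) = ph j by apply/funext => x; rewrite mxE.
have tp : test_funH G phi by move=> j; rewrite phE; case: (hph j).
have TE : T = \sum_j (W0form (b0 j) (b j) (fun x => u x 0 j) (fun k x => gr k x 0 j)
    - W0form (b0 j) (b j) (ph j) (fun k => partialC k (ph j))).
  rewrite sumrB -/T.
  suff -> : \sum_j W0form (b0 j) (b j) (ph j) (fun k => partialC k (ph j)) = 0 by rewrite subr0.
  rewrite -[RHS](form_test _ tp); apply: eq_bigr => j _.
  congr W0form; first exact/esym/phE.
  by apply/funext => k; apply/funext => x; rewrite mxE phE.
have hj j := (hph j).2.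
suff : `|cpt c T| < `|cpt c T| by rewrite ltxx.
rewrite {1}TE sum_biquat; apply: (le_lt_trans (ler_norm_cptD _ _ _)).
rewrite [X in _ < X](_ : _ = `|cpt c T| / 4 + `|cpt c T| / 4 + `|cpt c T| / 4 + `|cpt c T| / 4); last by field.
apply: ltrD (hj _); apply: (le_lt_trans (ler_norm_cptD _ _ _)).
apply: ltrD (hj _); apply: (le_lt_trans (ler_norm_cptD _ _ _)).
exact: ltrD (hj _) (hj _).
Qed.

(** The pairing with a fixed [w] of the dual exponent is continuous in the energy, and small
    [LpH_norm] implies small energy. *)
Lemma closure_orthogonal f w : Lp_closure G q%:E (DQ_image G q%:E (star_coeffs A)) f ->
  Vekua G p%:E A w -> pairing G f w = 0.
Proof.
move=> [/(LpH_LqH oG q1) lf app] hw; have p1 := conj_exponent_gt1.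
have lw : LqH G p w by apply/(LpH_LqH oG p1); case: hw.
suff T0 c : cpt c (pairing G f w) = 0 by apply: complexP; [exact: (T0 true)|exact: (T0 false)].
apply/eqP/negPn/negP => Tn; have e0 : 0 < `|cpt c (pairing G f w)| by rewrite normr_gt0.
have [dl dl0 hdl] := intC_dotq_small lw e0.
have [e1 e10 he1] := LpH_norm_energyH_small dl0.
have [m hm sm] := app _ e10; have [lm /(_ _ hw) mw] := DQ_image_orthogonal hm.
have lfm := LqH_B oG q1 lf lm.
have := hdl _ lfm (he1 _ lfm sm) c; suff -> : intC G (fun x => dotq (f x - m x) (w x)) = pairing G f w.
  by rewrite ltxx.
rewrite -[RHS]subr0 -mw !pairingE -(intC_B oG); last 2 first.
- exact: (integrableC_dotq oG q1).
- exact: (integrableC_dotq oG q1).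
by apply: eq_intC => x _; rewrite dotqBl.
Qed.

Lemma annihilator_closure : annihilator G q%:E (Vekua G p%:E A) =
  Lp_closure G q%:E (DQ_image G q%:E (star_coeffs A)).
Proof.
have p1 := conj_exponent_gt1.
apply/seteqP; split => f; last first.
  by move=> hf; split; [case: hf|move=> w; exact: closure_orthogonal].
move=> [/(LpH_LqH oG q1) lf hf].
have [h [lh hw near]] := Vekua_nearest_point oG q1 hA lf.
have lw : LqH G p (sgH q h) by exact: LqH_sgH.
have h0 : energyH G q h = 0.
  (* The duality map recovers the energy as a pairing. Both f and m pair to 0 with [sgH q h], so the
     pairing of the error f - m - h is minus that of h; making it smaller than the energy is a
     contradiction unless the energy is 0. *)
  have hE : energyH G q h = complex.Re (intC G (fun x => dotq (h x) (sgH q h x))).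
    rewrite /= /energyH; apply: eq_Rintegral => x _.
    by rewrite dotqC Re_dotq_sgH; apply: eq_bigr => i _; rewrite spowRM.
  apply/eqP/negPn/negP => Tn.
  have e0 : 0 < `|energyH G q h| by rewrite normr_gt0.
  have [dl dl0 hdl] := intC_dotq_small lw e0.
  have [m [hm lm sm]] := near _ dl0; have [_ /(_ _ hw) mw] := DQ_image_orthogonal hm.
  have lfm := LqH_B oG q1 lf lm; have lfmh := LqH_B oG q1 lfm lh.
  have := hdl _ lfmh sm true.
  suff -> : intC G (fun x => dotq (f x - m x - h x) (sgH q h x)) =
      - intC G (fun x => dotq (h x) (sgH q h x)).
    by rewrite hE /cpt ReN normrN ltxx.
  apply: (@etrans _ _ (pairing G f (sgH q h) - pairing G m (sgH q h)
      - intC G (fun x => dotq (h x) (sgH q h x)))).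
    rewrite !pairingE -!(intC_B oG); try exact: (integrableC_dotq oG q1).
      by apply: eq_intC => x _; rewrite !dotqBl.
    by apply: (integrableC_B oG); exact: (integrableC_dotq oG q1).
  by rewrite mw (hf _ hw) subr0 sub0r.
split; first exact/(LpH_LqH oG q1).
move=> e e0; have [dl dl0 hdl] := LpH_norm_lt oG q1 e0.
have c0 : 0 < 2 `^ q :> R by rewrite powR_gt0.
(* The energy of f - m is at most 2^q times the sum of the energies of f - m - h and of h, and the
   latter is 0; hence the tolerance divided by 2^q. *)
have [m [hm lm sm]] := near _ (divr_gt0 dl0 c0); exists m => //.
have lfm := LqH_B oG q1 lf lm; have lfmh := LqH_B oG q1 lfm lh.
apply: hdl; first exact: lfm.
have := energyH_D oG q1 lfmh lh; rewrite h0 addr0 /energyH.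
under [X in X <= _ -> _]eq_Rintegral => x _ do rewrite subrK.
move=> /le_lt_trans; apply; by rewrite mulrC -ltr_pdivlMr.
Qed.

End Orthogonality.

(** * Complex conjugation *)

Section ComplexConjugation.
Context {R : realType}.
Variables (G : set (R3 R)) (oG : open G).
Implicit Types (u v w : R3 R -> biquat R) (p : biquat R) (A : @coeffs R).

Lemma Sc_cconjq p : Sc (cconjq p) = conjc (Sc p). Proof. by rewrite !ScE mxE. Qed.
Lemma v1_cconjq p : v1 (cconjq p) = conjc (v1 p). Proof. by rewrite /v1 !VecE mxE. Qed.
Lemma v2_cconjq p : v2 (cconjq p) = conjc (v2 p). Proof. by rewrite /v2 !VecE mxE. Qed.
Lemma v3_cconjq p : v3 (cconjq p) = conjc (v3 p). Proof. by rewrite /v3 !VecE mxE. Qed.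

Lemma cconjqM p p' : cconjq (mulq p p') = mulq (cconjq p) (cconjq p').
Proof.
by apply: biquatP; rewrite !(compE, Sc_cconjq, v1_cconjq, v2_cconjq, v3_cconjq)
  ?(rmorphD, rmorphB, rmorphM, rmorphN).
Qed.

Lemma cconjq_conjq p : cconjq (conjq p) = conjq (cconjq p).
Proof.
by apply: biquatP; rewrite !(compE, Sc_cconjq, v1_cconjq, v2_cconjq, v3_cconjq) ?rmorphN.
Qed.

Lemma cconjqD p p' : cconjq (p + p') = cconjq p + cconjq p'.
Proof. exact: map_mxD. Qed.

Lemma cconjqK p : cconjq (cconjq p) = p.
Proof. by apply/rowP => j; rewrite !mxE conjcK. Qed.

Lemma cconjq_eq_ k : cconjq (eq_ k) = eq_ k :> biquat R.
Proof.
by apply/rowP => j; rewrite !mxE; case: splitP => i _; rewrite !mxE ?rmorph_nat// mul0rn conjc0.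
Qed.

Lemma dotq_cconjq p p' : dotq (cconjq p) p' = conjc (dotq p (cconjq p')).
Proof.
by rewrite /dotq rmorph_sum; apply: eq_bigr => j _; rewrite !mxE rmorphM/= conjcK.
Qed.

Lemma Qop_cconj A u x :
  Qop (cconj_coeffs A) (fun y => cconjq (u y)) x = cconjq (Qop A u x).
Proof.
by case: A => [[[a1 a2] a3] a4]; rewrite /= !cconjqD !cconjqM cconjq_conjq.
Qed.

Lemma cconj_coeffsK A : cconj_coeffs (cconj_coeffs A) = A.
Proof.
by case: A => [[[a1 a2] a3] a4]; congr (_, _, _, _); apply/funext => x; exact: cconjqK.
Qed.

Lemma intC_conj (f : R3 R -> R[i]) : integrableC G f ->
  intC G (fun x => conjc (f x)) = conjc (intC G f).
Proof.
move=> [f1 f2]; rewrite /intC; congr Complex.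
  by apply: eq_Rintegral => x _; case: (f x).
rewrite -RintegralN//; last exact: open_measurable3.
by apply: eq_Rintegral => x _; case: (f x).
Qed.

Lemma test_fun_conj (f : R3 R -> R[i]) : test_fun G f -> test_fun G (fun x => conjc (f x)).
Proof.
move=> tf; have [K [cK KG f0]] := test_fun_support tf; have [s1 s2] := test_fun_smooth tf.
apply: (@test_funI _ _ _ K) => //.
- by rewrite (_ : (fun x => _) = fun x => complex.Re (f x))//; apply/funext => x; case: (f x).
- rewrite (_ : (fun x => _) = fun x => - complex.Im (f x)); first exact: smoothN.
  by apply/funext => x; case: (f x).
- by move=> x /f0 ->; rewrite conjc0.
Qed.

Lemma partialC_conj k (f : R3 R -> R[i]) x : test_fun G f ->
  partialC k (fun y => conjc (f y)) x = conjc (partialC k f x).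
Proof.
move=> /test_fun_smooth[s1 s2]; rewrite /partialC /=; congr Complex.
  by congr partial; apply/funext => y; case: (f y).
rewrite -mulN1r -partialZ//; congr partial; apply/funext => y.
by rewrite mulN1r; case: (f y).
Qed.

Lemma test_funH_cconj phi : test_funH G phi -> test_funH G (fun x => cconjq (phi x)).
Proof.
by move=> tp j; under [X in test_fun _ X]funext => x do rewrite mxE; exact: test_fun_conj.
Qed.

Lemma Dop_cconj phi x : test_funH G phi ->
  Dop (fun y => cconjq (phi y)) x = cconjq (Dop phi x).
Proof.
move=> tp; rewrite !DopE.
have cs (F : 'I_3 -> biquat R) : cconjq (\sum_k F k) = \sum_k cconjq (F k).
  by rewrite !sum_I3 !cconjqD.
rewrite cs; apply: eq_bigr => k _; apply: etrans (esym (cconjqM _ _)).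
rewrite cconjq_eq_; congr mulq; apply/rowP => j; rewrite !mxE -partialC_conj//.
by congr partialC; apply/funext => y; rewrite mxE.
Qed.

Lemma L1locH_cconj u : L1locH G u -> L1locH G (fun x => cconjq (u x)).
Proof.
move=> lu j K cK KG; have [h1 h2] := lu j K cK KG; have mK := compact_measurable3 cK; split.
- by apply: eq_integrable h1 => // x _; rewrite mxE; case: (u x 0 j).
- by apply: eq_integrable (integrableRN mK h2) => // x _ /=; rewrite mxE; case: (u x 0 j).
Qed.

(** Complex conjugation fixes the units e_k and commutes with the real partial derivatives, so it
    commutes with D; the conjugate is moved onto the test function. *)
Lemma weakD_cconj u v : weakD G u v ->
  weakD G (fun x => cconjq (u x)) (fun x => cconjq (v x)).
Proof.
move=> h; have [lu lv _] := h.
apply: (dotq_weakD (L1locH_cconj lu) (L1locH_cconj lv)) => phi tp.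
have tc := test_funH_cconj tp.
apply: (@etrans _ _ (conjc (intC G (fun x => dotq (u x) (Dop (fun y => cconjq (phi y)) x))))).
  rewrite -intC_conj; last exact: (integrableC_dotq_test oG lu (test_funH_Dop tc)).
  by apply: eq_intC => x _; rewrite dotq_cconjq Dop_cconj.
rewrite (weakD_dotq h tc) -intC_conj; last exact: (integrableC_dotq_test oG lv tc).
by apply: eq_intC => x _; rewrite dotq_cconjq.
Qed.

Lemma LqH_cconj q u : 1 < q -> LqH G q u -> LqH G q (fun x => cconjq (u x)).
Proof.
move=> q1 lu j; have [h1 h2] := lu j; split.
- rewrite (_ : (fun x => _) = fun x => complex.Re (u x 0 j))//.
  by apply/funext => x; rewrite mxE; case: (u x 0 j).
- rewrite (_ : (fun x => _) = fun x => - complex.Im (u x 0 j)).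
    by apply: Lq_onN => //; exact: open_measurable3.
  by apply/funext => x; rewrite mxE; case: (u x 0 j).
Qed.

Lemma Vekua_cconj q A u : 1 < q -> Vekua G q%:E A u ->
  Vekua G q%:E (cconj_coeffs A) (fun x => cconjq (u x)).
Proof.
move=> q1 [/(LpH_LqH oG q1) lu wu]; split; first by apply/(LpH_LqH oG q1); exact: LqH_cconj.
rewrite (_ : Qop _ _ = fun x => cconjq (Qop A u x)); first exact: weakD_cconj.
by apply/funext => x; exact: Qop_cconj.
Qed.

Lemma star_cconj_coeffs A : star_coeffs (cconj_coeffs A) = dagger_coeffs A.
Proof. by case: A => [[[a1 a2] a3] a4]. Qed.

(** At q = 2 the scalar duality map is the identity, and only the sign of the imaginary parts
    changes. *)
Lemma sgH2 u x : sgH 2 u x = cconjq (u x).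
Proof.
have s2 (r : R) : spowR 2 r = r.
  by rewrite /spowR (_ : 2 - 1 = 1 :> R); [rewrite powRr1// -numEsg|ring].
by apply/rowP => j; rewrite !mxE !s2; case: (u x 0 j).
Qed.

Lemma inner_L2E u v : inner_L2 G u v = pairing G v (fun x => cconjq (u x)).
Proof. by rewrite pairingE; apply: eq_intC => x _; rewrite innerqE dotqC. Qed.

End ComplexConjugation.

(** * The annihilator identity and the orthogonal decomposition *)

Theorem theorem26 (R : realType) (G : set (R3 R)) (hG : liapunov_domain G)
    (A : @coeffs R) (hA : coeffs_Loo G A) :
  (forall p p' : R, 1 < p -> p' = p / (p - 1) ->
     annihilator G p'%:E (Vekua G p%:E A) =
     Lp_closure G p'%:E (DQ_image G p'%:E (star_coeffs A))) /\
  orthogonal_sum G (LpH G 2%:E) (Vekua G 2%:E A)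
    (Lp_closure G 2%:E (DQ_image G 2%:E (dagger_coeffs A))).
Proof.
have oG : open G by case: hG => -[].
have bA := coeffs_Loo_LooH oG hA.
split=> [p _ p1 ->|].
  (* Taking conjugate exponents is an involution: [annihilator_closure] is used with q = p', whose
     conjugate is p. *)
  have pp : (p / (p - 1)) / (p / (p - 1) - 1) = p.
    have d0 : p - 1 != 0 by rewrite subr_eq0 gt_eqF.
    have d1 : p / (p - 1) - 1 = (p - 1)^-1 by field.
    by rewrite d1 invrK mulfVK.
  by have := annihilator_closure oG (conj_exponent_gt1 p1) bA; rewrite pp.
have q1 : 1 < 2 :> R by rewrite ltr1n.
have q2 : 2 / (2 - 1) = 2 :> R by field.
(* The dagger coefficients are the star of the conjugated ones. The Hermitian product with u is the
   bilinear pairing with [cconjq] of u, which solves the equation with conjugated coefficients, so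
   the bilinear results apply to [cconj_coeffs A]. *)
have bA' := cconj_LooH bA; rewrite -star_cconj_coeffs.
split=> [|u v hu hv]; last first.
  rewrite inner_L2E; apply: (closure_orthogonal oG q1 bA' hv).
  by rewrite q2; exact: Vekua_cconj.
apply/seteqP; split=> f; last first.
  move=> [u [v [[/(LpH_LqH oG q1) lu _] [/(LpH_LqH oG q1) lv _] ->]]].
  by apply/(LpH_LqH oG q1); exact: (LqH_D oG q1 lu lv).
move=> /(LpH_LqH oG q1) lf.
have [h [lh hw near]] := Vekua_nearest_point oG q1 bA' lf.
have lfh := LqH_B oG q1 lf lh.
(* The residual is itself the solution component: [sgH 2 h] solves the conjugated equation and its
   conjugate is h. The remainder f - h is a limit of elements of the range by the approximation
   property of the residual. *)
exists h, (f \- h); split.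
- move: hw; rewrite q2 => /(Vekua_cconj oG q1); rewrite cconj_coeffsK.
  by congr Vekua; apply/funext => x; rewrite sgH2 cconjqK.
- split; first by apply/(LpH_LqH oG q1).
  move=> e e0; have [dl dl0 hdl] := LpH_norm_lt oG q1 e0.
  have [m [hm lm sm]] := near _ dl0; exists m; first exact: hm.
  apply: hdl; first exact: (LqH_B oG q1 lfh lm).
  apply: le_lt_trans sm; rewrite /energyH /= le_eqVlt; apply/orP; left; apply/eqP.
  by apply: eq_Rintegral => x _; apply: eq_bigr => i _; rewrite addrAC.
- by apply/funext => x /=; rewrite addrC subrK.
Qed.
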